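(* Let $\epsilon>0$, let $\nu>0$ be a constant, and let $\mathbf{k}=(k_x,k_y)$ be a unit vector with $k_x>0$, $k_y\neq0$. Assume that $g\in\mathcal{S}'(\mathbb{R})$. Then there exists a unique distribution $u(x,\cdot)$, continuous from $\mathbb{R}^+$ (variable $x$) into $\mathcal{S}'_y(\mathbb{R})$, solution to the problem $$ i(k_x\partial_x+k_y\partial_y)u+\frac{\epsilon}{2}\bigl(k_x^2\partial_{yy}^2-2k_xk_y\partial_{xy}^2+k_y^2\partial_{xx}^2\bigr)u+i\nu u=0\quad\text{on }\{(x,y): x>0\}, $$ $$ i\epsilon k_y(k_x\partial_y-k_y\partial_x)u+2k_xu=2k_xg\quad\text{on }\{x=0\}. $$ It is given by $$ \mathcal{F}_y(u;x,\eta)=\frac{2\,\mathcal{F}_y(g;\eta)}{1+\sqrt{1-2\frac{\epsilon k_y\eta}{k_x^2}+2i\nu\frac{\epsilon k_y^2}{k_x^2}}}\;e^{R_-(i\eta)x}, $$ where $$ R_-(i\eta)=i\frac{k_x\eta}{k_y}-i\frac{k_x}{\epsilon k_y^2}\Bigl(1-\sqrt{1-2\frac{\epsilon k_y\eta}{k_x^2}+2i\nu\frac{\epsilon k_y^2}{k_x^2}}\Bigr). $$ It also satisfies $$ \bigl(\partial_x-R_-(i\eta)\bigr)\mathcal{F}_y(u;x,\eta)=0. $$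
   Context: $\sqrt{\ }$ denotes the principal determination of the complex square root (its real part is positive). $\mathcal{S}'(\mathbb{R})$ is the space of tempered distributions on $\mathbb{R}$; $\mathcal{S}'_y(\mathbb{R})$ means tempered distributions in the variable $y$. $\mathcal{F}_y(u;x,\eta)$ denotes the Fourier transform in $y$ of $u(x,\cdot)$ at frequency $\eta$, with the convention that $\partial_y$ becomes multiplication by $i\eta$, and $\mathcal{F}_y(g;\eta)$ is the Fourier transform of $g$ (a distribution of the variable $y$).
   Formalization: Solutions u are additionally required to grow at most polynomially in x as tempered distributions in y; without a condition as x tends to infinity, uniqueness fails because of modes exp(R_+ x) with compactly supported frequency. *)

(* Defs.v *)
(* Stdlib reals with Coquelicot. *)
From Stdlib Require Export Reals.
From Stdlib Require Import Lra.
From Coquelicot Require Export Coquelicot.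
Open Scope R_scope.

Definition cexp (z : C) : C :=
  Cmult (RtoC (exp (Re z))) (cos (Im z), sin (Im z)).

(* Principal determination; the two lemmas below characterize it off the
   half-line of nonpositive reals. *)
Definition csqrt (z : C) : C :=
  (sqrt ((Cmod z + Re z) / 2),
   if Rle_dec 0 (Im z) then sqrt ((Cmod z - Re z) / 2)
   else - sqrt ((Cmod z - Re z) / 2)).

Lemma csqrt_sqr (z : C) : Cmult (csqrt z) (csqrt z) = z.
Proof.
destruct (Rabs_le_between (Re z) (Cmod z)) as [H _].
specialize (H (re_le_Cmod z)).
assert (H1 : 0 <= (Cmod z + Re z) / 2) by lra.
assert (H2 : 0 <= (Cmod z - Re z) / 2) by lra.
assert (Hp : sqrt ((Cmod z + Re z) / 2) * sqrt ((Cmod z - Re z) / 2)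
             = Rabs (Im z) / 2).
{ rewrite <- sqrt_mult by assumption.
  replace ((Cmod z + Re z) / 2 * ((Cmod z - Re z) / 2))
    with (Rsqr (Im z / 2)).
  - rewrite sqrt_Rsqr_abs. unfold Rdiv. rewrite Rabs_mult.
    rewrite (Rabs_pos_eq (/ 2)); lra.
  - generalize (Cmod2_alt z). unfold Rsqr. nra. }
generalize (sqrt_sqrt _ H1) (sqrt_sqrt _ H2); intros Ha Hb.
destruct z as [a b]; unfold csqrt, Cmult; simpl in *.
destruct (Rle_dec 0 b) as [Hle|Hgt]; simpl.
- rewrite Rabs_pos_eq in Hp by assumption. f_equal; nra.
- rewrite Rabs_left in Hp by lra. f_equal; nra.
Qed.

Lemma csqrt_Re_pos (z : C) : Im z <> 0 \/ 0 < Re z -> 0 < Re (csqrt z).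
Proof.
intros H. unfold csqrt; simpl. apply sqrt_lt_R0.
generalize (Cmod2_alt z) (Cmod_ge_0 z). intros. nra.
Qed.

Definition cderive_n (f : R -> C) (n : nat) (x : R) : C :=
  (Derive_n (fun t => Re (f t)) n x, Derive_n (fun t => Im (f t)) n x).

Definition cderive (f : R -> C) : R -> C := cderive_n f 1.

Definition smooth (f : R -> C) : Prop :=
  forall n x, ex_derive_n (fun t => Re (f t)) n x /\
              ex_derive_n (fun t => Im (f t)) n x.

Definition seminorm_le (N : nat) (f : R -> C) (M : R) : Prop :=
  forall j k x, (j <= N)%nat -> (k <= N)%nat ->
    Rabs x ^ j * Cmod (cderive_n f k x) <= M.

Definition schwartz (f : R -> C) : Prop :=
  smooth f /\ forall N, exists M, seminorm_le N f M.

Definition slowly_increasing (m : R -> C) : Prop :=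
  smooth m /\
  forall k, exists (N : nat) (K : R), forall x,
    Cmod (cderive_n m k x) <= K * (1 + Rabs x) ^ N.

(* A distribution is a total functional on functions, of which only the values
   at Schwartz functions matter: linearity, continuity ([tempered]) and equality
   ([dist_eq]) are all relative to Schwartz functions. *)
Definition dist := (R -> C) -> C.

Definition dist_linear (T : dist) : Prop :=
  forall (a b : C) (f h : R -> C), schwartz f -> schwartz h ->
    T (fun y => Cplus (Cmult a (f y)) (Cmult b (h y))) =
    Cplus (Cmult a (T f)) (Cmult b (T h)).

Definition tempered (T : dist) : Prop :=
  dist_linear T /\
  exists (N : nat) (K : R), forall f, schwartz f ->
    forall M, seminorm_le N f M -> Cmod (T f) <= K * M.

Definition dist_eq (T U : dist) : Prop := forall f, schwartz f -> T f = U f.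

Definition dist_dy (T : dist) : dist := fun f => Copp (T (cderive f)).

Definition dist_mul (m : R -> C) (T : dist) : dist :=
  fun f => T (fun y => Cmult (m y) (f y)).

(* Kernel exp(- i y eta), so that the transform of dT/dy is i eta times the
   transform of T. *)
Definition fourier_fun (f : R -> C) (eta : R) : C :=
  RInt_gen (V := C_R_CompleteNormedModule)
    (fun y => Cmult (f y) (cexp (Copp (Cmult Ci (RtoC (y * eta))))))
    (Rbar_locally m_infty) (Rbar_locally p_infty).

Definition fourier (T : dist) : dist := fun f => T (fourier_fun f).

(* Test functions on the open half-line. *)
Definition test_pos (th : R -> C) : Prop :=
  smooth th /\
  exists a b, 0 < a < b /\ forall x, (x < a \/ b < x) -> th x = RtoC 0.

(* Elements of D'((0,+oo); S'(R)), i.e. distributions in x with values in the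
   tempered distributions in y, written as functionals W th f of a test
   function th of x and a Schwartz function f of y. *)
Definition vdist := (R -> C) -> (R -> C) -> C.

(* A family of distributions u(x) = u(x, .) as a vector-valued distribution. *)
Definition vdist_of (u : R -> dist) : vdist := fun th f =>
  RInt_gen (V := C_R_CompleteNormedModule)
    (fun x => Cmult (th x) (u x f)) (at_right 0) (Rbar_locally p_infty).

Definition vdx (W : vdist) : vdist := fun th f => Copp (W (cderive th) f).

Definition vdy (W : vdist) : vdist := fun th => dist_dy (W th).

Definition vmul (m : R -> C) (W : vdist) : vdist := fun th => dist_mul m (W th).

Definition vscal (c : C) (W : vdist) : vdist := fun th f => Cmult c (W th f).

Definition vadd (W Z : vdist) : vdist := fun th f => Cplus (W th f) (Z th f).

Definition vdist_null (W : vdist) : Prop :=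
  forall th f, test_pos th -> schwartz f -> W th f = RtoC 0.

(* Weak-* continuity on the closed half-line [0,+oo); values at x < 0 are
   irrelevant. *)
Definition cont_pos (u : R -> dist) : Prop :=
  forall f, schwartz f -> forall x, 0 <= x ->
    filterlim (fun t => u t f) (within (fun t => 0 <= t) (locally x))
              (locally (u x f)).

(* Temperateness in x of a family of tempered distributions: at most polynomial
   growth in S'(R). Without such a condition as x -> +oo, uniqueness fails: the
   other characteristic root of the equation has positive real part, but
   yields solutions growing exponentially in x that are Schwartz in y for each x
   (compactly supported in frequency). *)
Definition temperate_in_x (u : R -> dist) : Prop :=
  exists (N : nat) (K : R), forall x, 0 <= x -> forall f, schwartz f ->
    forall M, seminorm_le N f M -> Cmod (u x f) <= K * (1 + x) ^ N * M.

(* T is the trace on x = 0 of the x-derivative of u: the (weak-* ) right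
   derivative at 0 of x |-> u(x, .). *)
Definition is_dx_at_0 (u : R -> dist) (T : dist) : Prop :=
  tempered T /\
  forall f, schwartz f ->
    filterlim (fun h => Cdiv (Cminus (u h f) (u 0 f)) (RtoC h)) (at_right 0)
              (locally (T f)).

Definition interior_equation (eps nu kx ky : R) (u : R -> dist) : Prop :=
  let U := vdist_of u in
  vdist_null
    (vadd
      (vscal Ci (vadd (vscal (RtoC kx) (vdx U)) (vscal (RtoC ky) (vdy U))))
      (vadd
        (vscal (RtoC (eps / 2))
          (vadd (vscal (RtoC (kx ^ 2)) (vdy (vdy U)))
            (vadd (vscal (RtoC (- (2 * kx * ky))) (vdx (vdy U)))
                  (vscal (RtoC (ky ^ 2)) (vdx (vdx U))))))
        (vscal (Cmult Ci (RtoC nu)) U))).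

Definition boundary_condition (eps kx ky : R) (g : dist) (u : R -> dist)
    : Prop :=
  exists u1 : dist, is_dx_at_0 u u1 /\
  forall f, schwartz f ->
    (Ci * RtoC (eps * ky) * (RtoC kx * dist_dy (u 0%R) f - RtoC ky * u1 f)
     + RtoC (2 * kx) * u 0%R f = RtoC (2 * kx) * g f)%C.

Definition is_solution (eps nu kx ky : R) (g : dist) (u : R -> dist) : Prop :=
  (forall x, 0 <= x -> tempered (u x)) /\
  cont_pos u /\
  temperate_in_x u /\
  interior_equation eps nu kx ky u /\
  boundary_condition eps kx ky g u.

Definition root (eps nu kx ky eta : R) : C :=
  csqrt (RtoC 1 - RtoC (2 * (eps * ky * eta / kx ^ 2))
         + RtoC 2 * Ci * RtoC nu * RtoC (eps * ky ^ 2 / kx ^ 2))%C.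

(* The value at i eta of the symbol R_-. *)
Definition Rminus (eps nu kx ky eta : R) : C :=
  (Ci * RtoC (kx * eta / ky)
   - Ci * RtoC (kx / (eps * ky ^ 2)) * (RtoC 1 - root eps nu kx ky eta))%C.

Definition solution_symbol (eps nu kx ky x eta : R) : C :=
  (RtoC 2 / (RtoC 1 + root eps nu kx ky eta)
   * cexp (Rminus eps nu kx ky eta * RtoC x))%C.

(* Main.v *)
Require Import Defs.
From Stdlib Require Import ssreflect Lra Lia FunctionalExtensionality.

(** The partial Fourier transform in [y] turns the interior equation into an
    ordinary differential equation of order two in [x] whose coefficients are
    polynomials in the frequency [eta]. Its characteristic roots are [Rminus] and
    a second root [Rp]; because [nu > 0] the square root that enters them has
    positive imaginary part, so that [Rminus] has negative and [Rp] positive real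
    part ([root_real_parts]). A solution that is tempered in [x] can only involve
    the first exponential, and the boundary condition then fixes its trace.

    Existence. Multiplication by exp(x Rminus(eta)) acts on Schwartz functions,
    with seminorms growing polynomially in [x], since its derivatives in [eta]
    do. Transposing it on the transform of [g], corrected by the factor
    2 / (1 + root), defines the solution. The Taylor remainder of order two of
    x |-> exp(x Q) is again a symbol ([symbol_exp_remainder]), and therefore the
    family is differentiable in [x], up to [x = 0], in the weak sense
    ([pairing_derivative]). Integration by parts against test functions gives the
    interior equation ([sol_interior]).

    Uniqueness. The interior equation holds only against products of test
    functions. For a fixed Schwartz function it says that the second derivative
    of a certain continuous function of [x] vanishes weakly; such a function is
    affine ([weak_affine]), which yields a genuine derivative up to [x = 0]. The
    combination dv/dx - Rminus v of the transform then evolves by the generator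
    [Rp]. Pairing it with exp(- t Rp) phi gives a quantity constant in time, and
    this test function decays faster than any power of [t] in every Schwartz
    seminorm although the real part of [Rp] is not bounded below: it is at least
    c / (1 + |eta|), and the loss is absorbed by the decay of phi
    ([symbol_exp_decay]). As the solution grows at most polynomially, the
    combination is zero ([growing_evolution_zero]). What remains is a first order
    equation with generator [Rminus], integrated backwards by the same pairing
    ([transport]), and the boundary condition gives the value at [x = 0]
    ([vhat_trace]).

    Fourier inversion on Schwartz functions is obtained without Fubini: applying
    the transform twice intertwines multiplication by [y] with multiplication by
    [- y], so by Hadamard's lemma a function vanishing at [a] is sent to one
    vanishing at [- a]; hence the double transform is the reflection up to a
    constant factor, read off on the Gaussian ([fourier_twice]). As the Gaussian
    integral is nonzero ([gint_neq_0]), a multiple of the third iterate of the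
    transform is its inverse. *)

(** * Derivatives of complex-valued functions of a real variable *)

Ltac fext x := apply functional_extensionality; intros x.

Lemma C_ext (z w : C) : Re z = Re w -> Im z = Im w -> z = w.
Proof. destruct z, w; simpl; intros; subst; reflexivity. Qed.

Lemma im_le_Cmod (z : C) : Rabs (Im z) <= Cmod z.
Proof. eapply Rle_trans; [apply Rmax_r | apply Rmax_Cmod]. Qed.

Lemma Cmod_le_sum (z : C) : Cmod z <= Rabs (Re z) + Rabs (Im z).
Proof.
  apply Rsqr_incr_0_var.
  - unfold Rsqr. generalize (Cmod2_alt z) (Rabs_pos (Re z)) (Rabs_pos (Im z)).
    generalize (pow2_abs (Re z)) (pow2_abs (Im z)). nra.
  - generalize (Rabs_pos (Re z)) (Rabs_pos (Im z)); lra.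
Qed.

Lemma Cmod_le_of_parts (z : C) (M : R) :
  Rabs (Re z) <= M -> Rabs (Im z) <= M -> Cmod z <= 2 * M.
Proof. generalize (Cmod_le_sum z); lra. Qed.

Lemma Cmod_cexp (z : C) : Cmod (cexp z) = exp (Re z).
Proof.
  unfold cexp. rewrite Cmod_mult Cmod_R Rabs_pos_eq; [|left; apply exp_pos].
  replace (Cmod _) with 1; [ring|].
  symmetry. unfold Cmod; simpl.
  replace (_ + _) with 1; [apply sqrt_1|].
  generalize (sin2_cos2 (Im z)). unfold Rsqr. lra.
Qed.

Lemma Cmod_cexp_le (z : C) : Re z <= 0 -> Cmod (cexp z) <= 1.
Proof.
  intros H. rewrite Cmod_cexp -exp_0.
  destruct H as [H|H]; [left; now apply exp_increasing | right; now rewrite H].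
Qed.

Lemma cexp_0 : cexp (RtoC 0) = RtoC 1.
Proof. unfold cexp; simpl. rewrite exp_0 cos_0 sin_0. apply C_ext; simpl; ring. Qed.

(** Derivatives are taken componentwise, because [smooth] and [cderive_n] are
    stated in terms of the real and imaginary parts. *)
Definition cder (f : R -> C) (x : R) (l : C) : Prop :=
  is_derive (fun t => Re (f t)) x (Re l) /\ is_derive (fun t => Im (f t)) x (Im l).

Lemma cder_eq (f : R -> C) (x : R) (l l' : C) : cder f x l -> l = l' -> cder f x l'.
Proof. now intros H <-. Qed.

Lemma cder_const (a : C) (x : R) : cder (fun _ => a) x (RtoC 0).
Proof. split; apply: is_derive_const. Qed.

Lemma cder_id (x : R) : cder (fun t => RtoC t) x (RtoC 1).
Proof. split; [apply: is_derive_id | apply: is_derive_const]. Qed.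

Lemma cder_plus (f g : R -> C) (x : R) (lf lg : C) :
  cder f x lf -> cder g x lg -> cder (fun t => Cplus (f t) (g t)) x (Cplus lf lg).
Proof.
  intros [H1 H2] [H3 H4]; split; simpl.
  - apply: (is_derive_plus (fun t => Re (f t)) (fun t => Re (g t))); assumption.
  - apply: (is_derive_plus (fun t => Im (f t)) (fun t => Im (g t))); assumption.
Qed.

Lemma cder_mult (f g : R -> C) (x : R) (lf lg : C) :
  cder f x lf -> cder g x lg ->
  cder (fun t => Cmult (f t) (g t)) x (Cplus (Cmult lf (g x)) (Cmult (f x) lg)).
Proof.
  intros [H1 H2] [H3 H4].
  assert (K : forall (u v : R -> R) du dv, is_derive u x du -> is_derive v x dv ->
     is_derive (fun t => u t * v t) x (du * v x + u x * dv)).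
  { intros u v du dv Hu Hv.
    apply: (is_derive_mult u v x du dv Hu Hv). intros; apply Rmult_comm. }
  split; simpl.
  - evar_last.
    + apply: (is_derive_minus (fun t => Re (f t) * Re (g t)) (fun t => Im (f t) * Im (g t)));
      apply K; eassumption.
    + unfold minus, plus, opp, Re, Im; simpl; ring.
  - evar_last.
    + apply: (is_derive_plus (fun t => Re (f t) * Im (g t)) (fun t => Im (f t) * Re (g t)));
      apply K; eassumption.
    + unfold plus, Re, Im; simpl; ring.
Qed.

Lemma cder_cmult (a : C) (f : R -> C) (x : R) (l : C) :
  cder f x l -> cder (fun t => Cmult a (f t)) x (Cmult a l).
Proof.
  intros H. eapply cder_eq; [apply cder_mult; [apply cder_const | exact H]|].
  simpl. ring.
Qed.

Lemma cder_opp (f : R -> C) (x : R) (l : C) :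
  cder f x l -> cder (fun t => Copp (f t)) x (Copp l).
Proof.
  intros [H1 H2]; split; simpl.
  - now apply: (is_derive_opp (fun t => Re (f t))).
  - now apply: (is_derive_opp (fun t => Im (f t))).
Qed.

Lemma cder_minus (f g : R -> C) (x : R) (lf lg : C) :
  cder f x lf -> cder g x lg -> cder (fun t => Cminus (f t) (g t)) x (Cminus lf lg).
Proof. intros. apply cder_plus; [|apply cder_opp]; assumption. Qed.

Lemma cder_unique (f : R -> C) (x : R) (l l' : C) : cder f x l -> cder f x l' -> l = l'.
Proof.
  intros [H1 H2] [H3 H4]. apply C_ext.
  - rewrite <- (is_derive_unique _ _ _ H1). now apply is_derive_unique.
  - rewrite <- (is_derive_unique _ _ _ H2). now apply is_derive_unique.
Qed.

Lemma cder_cderive (f : R -> C) (x : R) (l : C) : cder f x l -> cderive f x = l.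
Proof. intros [H1 H2]. apply C_ext; simpl; now apply is_derive_unique. Qed.

Lemma cder_cexp (f : R -> C) (x : R) (l : C) :
  cder f x l -> cder (fun t => cexp (f t)) x (Cmult l (cexp (f x))).
Proof.
  intros [H1 H2].
  assert (K : forall (u v : R -> R) du dv, is_derive u x du -> is_derive v x dv ->
     is_derive (fun t => exp (u t) * cos (v t) - 0 * sin (v t)) x
       (du * (exp (u x) * cos (v x) - 0 * sin (v x))
        - dv * (exp (u x) * sin (v x) + 0 * cos (v x))) /\
     is_derive (fun t => exp (u t) * sin (v t) + 0 * cos (v t)) x
       (du * (exp (u x) * sin (v x) + 0 * cos (v x))
        + dv * (exp (u x) * cos (v x) - 0 * sin (v x)))).
  { intros u v du dv Hu Hv. split.
    - auto_derive; [repeat split; eexists; eassumption|].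
      replace (Derive (fun t => u t) x) with du by (symmetry; apply is_derive_unique, Hu).
      replace (Derive (fun t => v t) x) with dv by (symmetry; apply is_derive_unique, Hv).
      ring.
    - auto_derive; [repeat split; eexists; eassumption|].
      replace (Derive (fun t => u t) x) with du by (symmetry; apply is_derive_unique, Hu).
      replace (Derive (fun t => v t) x) with dv by (symmetry; apply is_derive_unique, Hv).
      ring. }
  destruct (K _ _ _ _ H1 H2) as [K1 K2]. split; [exact K1 | exact K2].
Qed.

Lemma Re2_Im2_pos (z : C) : z <> RtoC 0 -> 0 < Re z * (Re z * 1) + Im z * (Im z * 1).
Proof.
  intros Hz. apply Cmod_gt_0 in Hz. generalize (Cmod2_alt z). nra.
Qed.

Lemma cder_inv (f : R -> C) (x : R) (l : C) :
  f x <> RtoC 0 -> cder f x l ->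
  cder (fun t => Cinv (f t)) x (Cmult (Copp l) (Cmult (Cinv (f x)) (Cinv (f x)))).
Proof.
  intros Hz [H1 H2]. apply Re2_Im2_pos in Hz.
  assert (K : forall (u v : R -> R) du dv, is_derive u x du -> is_derive v x dv ->
     0 < u x * (u x * 1) + v x * (v x * 1) ->
     let w := Cmult (Copp (du, dv)) (Cmult (Cinv (u x, v x)) (Cinv (u x, v x))) in
     is_derive (fun t => u t / (u t ^ 2 + v t ^ 2)) x (Re w) /\
     is_derive (fun t => - v t / (u t ^ 2 + v t ^ 2)) x (Im w)).
  { intros u v du dv Hu Hv Hp w; unfold w; clear w. split.
    - auto_derive; [repeat split; try (eexists; eassumption); lra|].
      replace (Derive (fun t => u t) x) with du by (symmetry; apply is_derive_unique, Hu).
      replace (Derive (fun t => v t) x) with dv by (symmetry; apply is_derive_unique, Hv).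
      simpl. field. lra.
    - auto_derive; [repeat split; try (eexists; eassumption); lra|].
      replace (Derive (fun t => u t) x) with du by (symmetry; apply is_derive_unique, Hu).
      replace (Derive (fun t => v t) x) with dv by (symmetry; apply is_derive_unique, Hv).
      simpl. field. lra. }
  destruct (K _ _ _ _ H1 H2 Hz) as [K1 K2].
  split; [|].
  - refine (eq_ind _ (is_derive _ x) K1 _ _). destruct l, (f x); reflexivity.
  - refine (eq_ind _ (is_derive _ x) K2 _ _). destruct l, (f x); reflexivity.
Qed.

Definition ccont (f : R -> C) (x : R) : Prop :=
  continuous (fun t => Re (f t)) x /\ continuous (fun t => Im (f t)) x.

Lemma cder_ccont (f : R -> C) (x : R) (l : C) : cder f x l -> ccont f x.
Proof.
  intros [H1 H2]; split; apply: ex_derive_continuous; eexists; eassumption.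
Qed.

Lemma ccont_mult (f g : R -> C) (x : R) :
  ccont f x -> ccont g x -> ccont (fun t => Cmult (f t) (g t)) x.
Proof.
  intros [H1 H2] [H3 H4]; split; simpl.
  - apply: (continuous_minus (fun t => Re (f t) * Re (g t)) (fun t => Im (f t) * Im (g t)));
     apply: continuous_mult; assumption.
  - apply: (continuous_plus (fun t => Re (f t) * Im (g t)) (fun t => Im (f t) * Re (g t)));
     apply: continuous_mult; assumption.
Qed.

Lemma ccont_plus (f g : R -> C) (x : R) :
  ccont f x -> ccont g x -> ccont (fun t => Cplus (f t) (g t)) x.
Proof.
  intros [H1 H2] [H3 H4]; split; simpl.
  - apply: (continuous_plus (fun t => Re (f t)) (fun t => Re (g t))); assumption.
  - apply: (continuous_plus (fun t => Im (f t)) (fun t => Im (g t))); assumption.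
Qed.

Lemma ccont_const (a : C) (x : R) : ccont (fun _ => a) x.
Proof. split; apply: continuous_const. Qed.

(** The mean value theorem fails for complex values; applying it to both
    components costs the factor 2. *)
Lemma mean_value_bound (f f' : R -> C) (x y M : R) :
  (forall t, Rmin x y <= t <= Rmax x y -> cder f t (f' t)) ->
  (forall t, Rmin x y <= t <= Rmax x y -> Cmod (f' t) <= M) ->
  Cmod (Cminus (f y) (f x)) <= 2 * (M * Rabs (y - x)).
Proof.
  intros Hd Hb. apply Cmod_le_of_parts.
  - destruct (MVT_gen (fun t => Re (f t)) x y (fun t => Re (f' t))) as [c [Hc Hc']].
    + intros t Ht. apply Hd. lra.
    + intros t Ht. apply continuity_pt_filterlim. apply: ex_derive_continuous.
      eexists; apply (proj1 (Hd t Ht)).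
    + replace (Re (Cminus (f y) (f x))) with (Re (f y) - Re (f x)) by reflexivity.
      rewrite Hc' Rabs_mult. apply Rmult_le_compat_r; [apply Rabs_pos|].
      eapply Rle_trans; [apply re_le_Cmod | now apply Hb].
  - destruct (MVT_gen (fun t => Im (f t)) x y (fun t => Im (f' t))) as [c [Hc Hc']].
    + intros t Ht. apply Hd. lra.
    + intros t Ht. apply continuity_pt_filterlim. apply: ex_derive_continuous.
      eexists; apply (proj2 (Hd t Ht)).
    + replace (Im (Cminus (f y) (f x))) with (Im (f y) - Im (f x)) by reflexivity.
      rewrite Hc' Rabs_mult. apply Rmult_le_compat_r; [apply Rabs_pos|].
      eapply Rle_trans; [apply im_le_Cmod | now apply Hb].
Qed.

Lemma cder_zero_constant (f : R -> C) :
  (forall x, cder f x (RtoC 0)) -> forall x y, f x = f y.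
Proof.
  intros H x y.
  assert (E := mean_value_bound f (fun _ => RtoC 0) y x 0
     (fun t _ => H t) (fun t _ => Req_le _ _ Cmod_0)).
  rewrite Rmult_0_l Rmult_0_r in E.
  assert (E0 : (f x - f y)%C = RtoC 0).
  { apply Cmod_eq_0. apply Rle_antisym; [exact E | apply Cmod_ge_0]. }
  replace (f x) with (f x - f y + f y)%C by ring. rewrite E0. ring.
Qed.

(** Differentiability within a set, with the increment multiplied out: it covers
    the one-sided derivative at the end of the half-line and, unlike a quotient,
    holds trivially at [y = x]. *)
Definition wder (S : R -> Prop) (f : R -> C) (x : R) (l : C) : Prop :=
  forall e, 0 < e -> exists d, 0 < d /\ forall y, S y -> Rabs (y - x) < d ->
    Cmod (f y - f x - RtoC (y - x) * l)%C <= e * Rabs (y - x).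

Lemma cder_of_wder (S : R -> Prop) (f : R -> C) (x r : R) (l : C) :
  0 < r -> (forall y, Rabs (y - x) < r -> S y) -> wder S f x l -> cder f x l.
Proof.
  intros Hr HS H.
  assert (K : forall g : C -> R, (forall z, Rabs (g z) <= Cmod z) ->
     (forall y, g (f y - f x - RtoC (y - x) * l)%C = g (f y) - g (f x) - (y - x) * g l) ->
     is_derive (fun t => g (f t)) x (g l)).
  { intros g Hg Hl. apply is_derive_Reals. intros e He.
    destruct (H (e / 2)) as [d [Hd Hd']]; [lra|].
    exists (mkposreal _ (Rmin_stable_in_posreal (mkposreal _ Hd) (mkposreal _ Hr))).
    simpl. intros h Hh Hh'.
    assert (h1 : Rabs h < d) by (eapply Rlt_le_trans; [exact Hh'|apply Rmin_l]).
    assert (h2 : Rabs h < r) by (eapply Rlt_le_trans; [exact Hh'|apply Rmin_r]).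
    specialize (Hd' (x + h)). replace (x + h - x) with h in Hd' by ring.
    specialize (Hd' (HS _ ltac:(now replace (x + h - x) with h by ring)) h1).
    replace ((g (f (x + h)) - g (f x)) / h - g l)
      with ((g (f (x + h)) - g (f x) - h * g l) * / h) by (field; assumption).
    rewrite Rabs_mult Rabs_inv.
    assert (0 < Rabs h) by now apply Rabs_pos_lt.
    apply Rmult_lt_reg_r with (Rabs h); [assumption|].
    rewrite Rmult_assoc Rinv_l; [|lra]. rewrite Rmult_1_r.
    generalize (Hg (f (x + h)%R - f x - RtoC (x + h - x) * l)%C). rewrite Hl.
    replace (x + h - x) with h by ring. nra. }
  split; apply K.
  - apply re_le_Cmod.
  - intros; unfold Re, Im; simpl; ring.
  - apply im_le_Cmod.
  - intros; unfold Re, Im; simpl; ring.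
Qed.

Lemma wder_of_cder (S : R -> Prop) (f : R -> C) (x : R) (l : C) : cder f x l -> wder S f x l.
Proof.
  intros [H1 H2] e He.
  apply is_derive_Reals in H1. apply is_derive_Reals in H2.
  destruct (H1 (e / 2)) as [d1 Hd1]; [lra|]. destruct (H2 (e / 2)) as [d2 Hd2]; [lra|].
  exists (Rmin d1 d2). split; [apply Rmin_stable_in_posreal|].
  intros y _ Hy. destruct (Req_dec y x) as [->|Hyx].
  { replace (f x - f x - RtoC (x - x) * l)%C with (RtoC 0).
    - rewrite Cmod_0 Rminus_diag Rabs_R0. lra.
    - apply C_ext; simpl; ring. }
  assert (Hh : y - x <> 0) by lra.
  assert (0 < Rabs (y - x)) by now apply Rabs_pos_lt.
  specialize (Hd1 _ Hh ltac:(eapply Rlt_le_trans; [exact Hy|apply Rmin_l])).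
  specialize (Hd2 _ Hh ltac:(eapply Rlt_le_trans; [exact Hy|apply Rmin_r])).
  replace (x + (y - x)) with y in Hd1, Hd2 by ring.
  assert (K : forall u v w, Rabs ((u - v) / (y - x) - w) < e / 2 ->
     Rabs (u - v - (y - x) * w) <= e / 2 * Rabs (y - x)).
  { intros u v w Huv.
    replace (u - v - (y - x) * w) with (((u - v) / (y - x) - w) * (y - x)) by (field; lra).
    rewrite Rabs_mult. apply Rmult_le_compat_r; lra. }
  eapply Rle_trans; [apply Cmod_le_of_parts with (M := e / 2 * Rabs (y - x))|lra].
  - apply K in Hd1. replace (Re _) with (Re (f y) - Re (f x) - (y - x) * Re l); [exact Hd1|].
    unfold Re, Im; simpl; ring.
  - apply K in Hd2. replace (Im _) with (Im (f y) - Im (f x) - (y - x) * Im l); [exact Hd2|].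
    unfold Re, Im; simpl; ring.
Qed.

Lemma wder_plus S (f g : R -> C) (x : R) (lf lg : C) :
  wder S f x lf -> wder S g x lg -> wder S (fun t => Cplus (f t) (g t)) x (Cplus lf lg).
Proof.
  intros H1 H2 e He. destruct (H1 (e / 2)) as [d1 [Hd1 K1]]; [lra|].
  destruct (H2 (e / 2)) as [d2 [Hd2 K2]]; [lra|].
  exists (Rmin d1 d2). split; [now apply Rmin_pos|]. intros y Hy Hyx.
  specialize (K1 y Hy ltac:(eapply Rlt_le_trans; [exact Hyx|apply Rmin_l])).
  specialize (K2 y Hy ltac:(eapply Rlt_le_trans; [exact Hyx|apply Rmin_r])).
  replace (f y + g y - (f x + g x) - RtoC (y - x) * (lf + lg))%C
    with ((f y - f x - RtoC (y - x) * lf) + (g y - g x - RtoC (y - x) * lg))%C by ring.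
  eapply Rle_trans; [apply Cmod_triangle|]. lra.
Qed.

Lemma wder_cmult S (a : C) (f : R -> C) (x : R) (l : C) :
  wder S f x l -> wder S (fun t => Cmult a (f t)) x (Cmult a l).
Proof.
  intros H e He. assert (Ha := Cmod_ge_0 a).
  assert (Hp : 0 < / (Cmod a + 1)) by (apply Rinv_0_lt_compat; lra).
  destruct (H (e * / (Cmod a + 1))) as [d [Hd K]]; [now apply Rmult_lt_0_compat|].
  exists d. split; [assumption|]. intros y Hy Hyx. specialize (K y Hy Hyx).
  replace (a * f y - a * f x - RtoC (y - x) * (a * l))%C
    with (a * (f y - f x - RtoC (y - x) * l))%C by ring.
  rewrite Cmod_mult.
  apply Rle_trans with ((Cmod a + 1) * (e * / (Cmod a + 1) * Rabs (y - x))).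
  - apply Rmult_le_compat; try apply Cmod_ge_0; [lra|assumption].
  - right. field. lra.
Qed.

Lemma wder_ext S (f g : R -> C) (x : R) (l l' : C) :
  S x -> (forall t, S t -> f t = g t) -> l = l' -> wder S f x l -> wder S g x l'.
Proof.
  intros Hx Hfg <- H e He. destruct (H e He) as [d [Hd K]]. exists d. split; [assumption|].
  intros y Hy. rewrite -(Hfg x Hx) -(Hfg y Hy). now apply K.
Qed.

Lemma wder_cont S (f : R -> C) (x : R) (l : C) :
  wder S f x l ->
  forall e, 0 < e -> exists d, 0 < d /\ forall y, S y -> Rabs (y - x) < d ->
    Cmod (f y - f x)%C < e.
Proof.
  intros H e He. destruct (H 1 Rlt_0_1) as [d [Hd K]].
  assert (Hl := Cmod_ge_0 l).
  assert (Hp : 0 < e / (Cmod l + 2)) by (apply Rdiv_lt_0_compat; lra).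
  exists (Rmin d (e / (Cmod l + 2))). split; [now apply Rmin_pos|].
  intros y Hy Hyx.
  specialize (K y Hy ltac:(eapply Rlt_le_trans; [exact Hyx|apply Rmin_l])).
  assert (Hyx' : Rabs (y - x) < e / (Cmod l + 2)) by
    (eapply Rlt_le_trans; [exact Hyx|apply Rmin_r]).
  replace (f y - f x)%C with ((f y - f x - RtoC (y - x) * l) + RtoC (y - x) * l)%C by ring.
  eapply Rle_lt_trans; [apply Cmod_triangle|]. rewrite Cmod_mult Cmod_R.
  apply Rmult_lt_compat_r with (r := Cmod l + 2) in Hyx'; [|lra].
  unfold Rdiv in Hyx'. rewrite Rmult_assoc Rinv_l in Hyx'; [|lra].
  generalize (Rabs_pos (y - x)). nra.
Qed.

(** Composing with the projection onto [a, b], which is 1-Lipschitz, turns a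
    derivative within the interval into a two-sided one on the line. *)
Lemma wder_zero_constant (f : R -> C) (a b : R) :
  a <= b ->
  (forall x, a <= x <= b -> wder (fun y => a <= y <= b) f x (RtoC 0)) -> f b = f a.
Proof.
  intros Hab H. set (c := fun x => Rmax a (Rmin b x)).
  assert (Hc : forall x, a <= c x <= b).
  { intros x. unfold c, Rmax, Rmin.
    destruct (Rle_dec b x); match goal with |- context [Rle_dec a ?t] => destruct (Rle_dec a t) end; lra. }
  assert (Hl : forall x y, Rabs (c y - c x) <= Rabs (y - x)).
  { intros x y. unfold c.
    assert (K1 : forall u v, Rabs (Rmin b u - Rmin b v) <= Rabs (u - v)).
    { intros u v. unfold Rmin, Rabs. destruct (Rle_dec b u), (Rle_dec b v);
      repeat destruct Rcase_abs; lra. }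
    assert (K2 : forall u v, Rabs (Rmax a u - Rmax a v) <= Rabs (u - v)).
    { intros u v. unfold Rmax, Rabs. destruct (Rle_dec a u), (Rle_dec a v);
      repeat destruct Rcase_abs; lra. }
    eapply Rle_trans; [apply K2 | apply K1]. }
  assert (Hd : forall x, cder (fun t => f (c t)) x (RtoC 0)).
  { intros x. apply (cder_of_wder (fun _ => True)) with (r := 1); [lra|auto|].
    intros e He. destruct (H _ (Hc x) e He) as [d [Hd K]].
    exists d. split; [assumption|]. intros y _ Hy.
    specialize (K (c y) (Hc y) ltac:(eapply Rle_lt_trans; [apply Hl | exact Hy])).
    rewrite Cmult_0_r in K. rewrite Cmult_0_r.
    eapply Rle_trans; [exact K|]. apply Rmult_le_compat_l; [lra|apply Hl]. }
  assert (E := cder_zero_constant _ Hd b a). cbv beta in E.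
  replace (c b) with b in E; [replace (c a) with a in E; [exact E|]|].
  - unfold c. rewrite Rmin_right; [|lra]. rewrite Rmax_left; lra.
  - unfold c. rewrite Rmin_left; [|lra]. rewrite Rmax_right; lra.
Qed.

(** Both bounds come from the mean value inequality for t |-> exp(t z), whose
    derivative has modulus at most |z| as long as the exponent keeps a nonpositive
    real part. The statement also covers purely imaginary [z], for any [x], [y]. *)
Lemma exp_taylor_bound (z : C) (x y : R) :
  x * Re z <= 0 -> y * Re z <= 0 ->
  Cmod (cexp (RtoC y * z) - cexp (RtoC x * z))%C <= 2 * (Cmod z * Rabs (y - x)) /\
  Cmod (cexp (RtoC y * z) - cexp (RtoC x * z) - RtoC (y - x) * (z * cexp (RtoC x * z)))%C
    <= 4 * (Cmod z ^ 2 * Rabs (y - x) ^ 2).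
Proof.
  intros Hx Hy.
  assert (Hd : forall t, cder (fun t => cexp (RtoC t * z)) t (z * cexp (RtoC t * z))%C).
  { intros t. apply cder_cexp. eapply cder_eq.
    - apply cder_mult; [apply cder_id | apply cder_const].
    - simpl. ring. }
  assert (Ht : forall y, y * Re z <= 0 -> forall t, Rmin x y <= t <= Rmax x y -> t * Re z <= 0).
  { intros y' Hy' t. unfold Rmin, Rmax. destruct Rle_dec; intros Ht;
    destruct (Rle_dec 0 (Re z)); nra. }
  assert (H1 : forall y, y * Re z <= 0 ->
    Cmod (cexp (RtoC y * z) - cexp (RtoC x * z))%C <= 2 * (Cmod z * Rabs (y - x))).
  { intros y' Hy'. apply (mean_value_bound (fun t => cexp (RtoC t * z)%C) (fun t => z * cexp (RtoC t * z))%C).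
    - intros; apply Hd.
    - intros t Htt. rewrite Cmod_mult -{2}(Rmult_1_r (Cmod z)).
      apply Rmult_le_compat_l; [apply Cmod_ge_0|]. apply Cmod_cexp_le. simpl.
      apply Rle_trans with (t * Re z); [right; unfold Re, Im; simpl; ring | now apply (Ht y')]. }
  split; [now apply H1|].
  replace (cexp (RtoC y * z) - cexp (RtoC x * z) - RtoC (y - x) * (z * cexp (RtoC x * z)))%C
    with ((cexp (RtoC y * z) - RtoC y * (z * cexp (RtoC x * z)))
      - (cexp (RtoC x * z) - RtoC x * (z * cexp (RtoC x * z))))%C
    by (rewrite RtoC_minus; ring).
  eapply Rle_trans.
  - apply (mean_value_bound (fun t => cexp (RtoC t * z) - RtoC t * (z * cexp (RtoC x * z)))%C
     (fun t => z * (cexp (RtoC t * z) - cexp (RtoC x * z)))%C)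
    with (M := Cmod z * (2 * (Cmod z * Rabs (y - x)))).
    + intros t _. eapply cder_eq.
      * apply cder_minus; [apply Hd|]. apply cder_mult; [apply cder_id|apply cder_const].
      * simpl. ring.
    + intros t Htt. rewrite Cmod_mult.
      apply Rmult_le_compat_l; [apply Cmod_ge_0|].
      eapply Rle_trans; [now apply H1, (Ht y)|]. apply Rmult_le_compat_l; [lra|].
      apply Rmult_le_compat_l; [apply Cmod_ge_0|].
      revert Htt. unfold Rmin, Rmax, Rabs. destruct Rle_dec; repeat destruct Rcase_abs; lra.
  - right. ring.
Qed.

(** Induction on [n], spending half of the exponential on each factor. *)
Lemma pow_exp_bound (n : nat) : exists c, forall t, 0 <= t -> t ^ n * exp (- t) <= c.
Proof.
  induction n as [|n [c Hc]].
  - exists 1. intros t Ht. rewrite pow_O Rmult_1_l -exp_0.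
    destruct Ht as [Ht|<-]; [left; apply exp_increasing; lra|rewrite Ropp_0; lra].
  - exists (2 ^ n * c * 2). intros t Ht.
    assert (H2 : t * exp (- (t / 2)) <= 2).
    { rewrite exp_Ropp. apply Rmult_le_reg_r with (exp (t / 2)); [apply exp_pos|].
      rewrite Rmult_assoc Rinv_l; [|generalize (exp_pos (t / 2)); lra].
      generalize (exp_ineq1_le (t / 2)). lra. }
    replace (t ^ S n * exp (- t))
      with (2 ^ n * ((t / 2) ^ n * exp (- (t / 2))) * (t * exp (- (t / 2)))).
    + apply Rmult_le_compat.
      * apply Rmult_le_pos; [apply pow_le; lra|]. apply Rmult_le_pos; [apply pow_le; lra|].
        left; apply exp_pos.
      * apply Rmult_le_pos; [assumption|left; apply exp_pos].
      * apply Rmult_le_compat_l; [apply pow_le; lra|]. apply Hc. lra.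
      * exact H2.
    + replace (- t) with (- (t / 2) + - (t / 2)) by field. rewrite exp_plus.
      replace (2 ^ n * ((t / 2) ^ n * exp (- (t / 2))) * (t * exp (- (t / 2))))
        with (((2 * (t / 2)) ^ n) * exp (- (t / 2)) * (t * exp (- (t / 2))))
        by (rewrite Rpow_mult_distr; ring).
      replace (2 * (t / 2)) with t by field. simpl. ring.
Qed.

Lemma Derive_n_shift (g : R -> R) (n : nat) (t : R) :
  Derive_n g (S n) t = Derive_n (Derive_n g 1) n t.
Proof. rewrite Derive_n_comp. f_equal; lia. Qed.

Lemma cderive_n_S (f : R -> C) (n : nat) : cderive_n f (S n) = cderive_n (cderive f) n.
Proof.
  fext x. apply C_ext; simpl Re; simpl Im.
  - change (Derive_n (fun t => Re (f t)) (S n) x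
      = Derive_n (Derive_n (fun t => Re (f t)) 1) n x).
    rewrite Derive_n_comp. f_equal; lia.
  - change (Derive_n (fun t => Im (f t)) (S n) x
      = Derive_n (Derive_n (fun t => Im (f t)) 1) n x).
    rewrite Derive_n_comp. f_equal; lia.
Qed.

Lemma cderive_n_0 (f : R -> C) : cderive_n f 0 = f.
Proof. fext x. apply C_ext; reflexivity. Qed.

Lemma cderive_fun (f f' : R -> C) : (forall x, cder f x (f' x)) -> cderive f = f'.
Proof. intros H. fext x. apply cder_cderive, H. Qed.

Lemma smooth_cder (f : R -> C) (x : R) : smooth f -> cder f x (cderive f x).
Proof.
  intros H. destruct (H 1%nat x) as [H1 H2].
  split; apply Derive_correct; assumption.
Qed.

Lemma smooth_cderive (f : R -> C) : smooth f -> smooth (cderive f).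
Proof.
  intros H [|n] x; [split; exact I|].
  destruct (H (S (S n)) x) as [H1 H2]. split.
  - change (ex_derive (Derive_n (Derive_n (fun t => Re (f t)) 1) n) x).
    eapply ex_derive_ext; [|exact H1]. intros t; apply Derive_n_shift.
  - change (ex_derive (Derive_n (Derive_n (fun t => Im (f t)) 1) n) x).
    eapply ex_derive_ext; [|exact H2]. intros t; apply Derive_n_shift.
Qed.

(** * Families of smooth functions and their derivatives *)

(** Differentiability up to order [n] with every derivative in the class [B]. An
    induction on [n] with [f'] existentially quantified makes closure properties
    provable without Leibniz or chain rule formulas for higher derivatives: one
    only differentiates once and reuses the induction hypothesis. *)
Fixpoint jet {P : Type} (B : (P -> R -> C) -> Prop) (n : nat) (f : P -> R -> C) : Prop :=
  B f /\
  match n with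
  | O => True
  | S m => exists f', (forall p x, cder (f p) x (f' p x)) /\ jet B m f'
  end.

Lemma jet_base {P} (B : (P -> R -> C) -> Prop) n f : jet B n f -> B f.
Proof. destruct n; intros [H _]; exact H. Qed.

Lemma jet_S {P} (B : (P -> R -> C) -> Prop) n f : jet B (S n) f -> jet B n f.
Proof.
  revert f; induction n as [|n IH]; intros f [H1 [f' [H2 H3]]].
  - split; [exact H1|exact I].
  - split; [exact H1|]. exists f'. split; [exact H2|now apply IH].
Qed.

Lemma jet_reparam {P P'} (B : (P -> R -> C) -> Prop) (B' : (P' -> R -> C) -> Prop)
    (pi : P' -> P) n f :
  (forall g, B g -> B' (fun p => g (pi p))) -> jet B n f -> jet B' n (fun p => f (pi p)).
Proof.
  intros HB. revert f; induction n as [|n IH]; intros f [H1 H2]; split; auto.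
  destruct H2 as [f' [H2 H3]]. exists (fun p => f' (pi p)). split; auto.
Qed.

Lemma jet_plus {P} (B : (P -> R -> C) -> Prop) n f g :
  (forall f g, B f -> B g -> B (fun p x => f p x + g p x)%C) ->
  jet B n f -> jet B n g -> jet B n (fun p x => f p x + g p x)%C.
Proof.
  intros HB. revert f g; induction n as [|n IH]; intros f g [H1 H2] [H3 H4];
    split; auto.
  destruct H2 as [f' [H2 H2']], H4 as [g' [H4 H4']].
  exists (fun p x => f' p x + g' p x)%C. split; auto.
  intros; now apply cder_plus.
Qed.

(** The derivative f' g + f g' has order one less, and lowering the order of the
    undifferentiated factors is [jet_S]. *)
Lemma jet_mult {P} (B : (P -> R -> C) -> Prop) n f g :
  (forall f g, B f -> B g -> B (fun p x => f p x + g p x)%C) ->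
  (forall f g, B f -> B g -> B (fun p x => f p x * g p x)%C) ->
  jet B n f -> jet B n g -> jet B n (fun p x => f p x * g p x)%C.
Proof.
  intros HB HB'. revert f g; induction n as [|n IH]; intros f g Hf Hg.
  - split; auto. apply HB'; [apply Hf | apply Hg].
  - assert (Hf0 := jet_S _ _ _ Hf). assert (Hg0 := jet_S _ _ _ Hg).
    destruct Hf as [H1 [f' [H2 H2']]], Hg as [H3 [g' [H4 H4']]].
    split; auto.
    exists (fun p x => f' p x * g p x + f p x * g' p x)%C. split.
    + intros; now apply cder_mult.
    + apply jet_plus; auto.
Qed.

Lemma jet_cst {P} (B : (P -> R -> C) -> Prop) n (c : P -> C) :
  B (fun p _ => c p) -> B (fun _ _ => RtoC 0) -> jet B n (fun p _ => c p).
Proof.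
  intros H H0. revert c H. induction n as [|n IH]; intros c H; split; auto.
  exists (fun _ _ => RtoC 0). split; [intros; apply cder_const|].
  now apply (IH (fun _ => RtoC 0)).
Qed.

Lemma jet_smooth {P} (B : (P -> R -> C) -> Prop) f :
  (forall n, jet B n f) -> forall p, smooth (f p).
Proof.
  intros H p n. assert (Hn := H n). clear H. revert f Hn.
  induction n as [|n IH]; intros f [_ Hn] x; [split; exact I|].
  destruct Hn as [f' [Hf' Hn]]. specialize (IH f' Hn).
  destruct n as [|n]; [destruct (Hf' p x); split; eexists; eassumption|].
  rewrite -(cderive_fun _ _ (Hf' p)) in IH. destruct (IH x) as [I1 I2]. split.
  - eapply ex_derive_ext; [|exact I1]. intros t; symmetry; apply Derive_n_shift.
  - eapply ex_derive_ext; [|exact I2]. intros t; symmetry; apply Derive_n_shift.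
Qed.

Lemma jet_derive {P} (B : (P -> R -> C) -> Prop) n f :
  jet B (S n) f -> jet B n (fun p => cderive (f p)).
Proof.
  intros [_ [f' [H1 H2]]]. replace (fun p => cderive (f p)) with f'; [exact H2|].
  fext p. symmetry. apply cderive_fun, H1.
Qed.

Lemma jet_derive_n {P} (B : (P -> R -> C) -> Prop) k f :
  jet B k f -> B (fun p => cderive_n (f p) k).
Proof.
  revert f; induction k as [|k IH]; intros f H.
  - replace (fun p => cderive_n (f p) 0) with f; [apply H|].
    fext p. now rewrite cderive_n_0.
  - apply jet_derive, IH in H. refine (eq_ind _ B H _ _).
    fext p. now rewrite cderive_n_S.
Qed.

Lemma jet_of_smooth {P} (B : (P -> R -> C) -> Prop) f :
  (forall p, smooth (f p)) -> (forall k, B (fun p => cderive_n (f p) k)) ->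
  forall n, jet B n f.
Proof.
  intros H1 H2 n. revert f H1 H2; induction n as [|n IH]; intros f H1 H2; split.
  1,3: specialize (H2 0%nat); refine (eq_ind _ B H2 _ _);
    apply functional_extensionality; intros p; now rewrite cderive_n_0.
  - exact I.
  - exists (fun p => cderive (f p)). split.
    + intros; apply smooth_cder, H1.
    + apply IH; [intros; apply smooth_cderive, H1|].
      intros k. refine (eq_ind _ B (H2 (S k)) _ _).
      fext p. now rewrite cderive_n_S.
Qed.

Lemma smooth_jet (f : R -> C) :
  smooth f <-> forall n, jet (fun _ : unit -> R -> C => True) n (fun _ => f).
Proof.
  split.
  - intros H. apply jet_of_smooth; auto.
  - intros H. exact (jet_smooth _ _ H tt).
Qed.

Lemma smooth_intro (f f' : R -> C) : (forall x, cder f x (f' x)) -> smooth f' -> smooth f.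
Proof.
  intros H Hs. apply smooth_jet. intros [|n]; split; auto.
  exists (fun _ => f'). split; [auto|]. now apply smooth_jet.
Qed.

Lemma smooth_plus (f g : R -> C) :
  smooth f -> smooth g -> smooth (fun x => f x + g x)%C.
Proof.
  rewrite !smooth_jet. intros Hf Hg n.
  now apply (jet_plus _ n (fun _ => f) (fun _ => g)).
Qed.

Lemma smooth_mult (f g : R -> C) :
  smooth f -> smooth g -> smooth (fun x => f x * g x)%C.
Proof.
  rewrite !smooth_jet. intros Hf Hg n.
  now apply (jet_mult _ n (fun _ => f) (fun _ => g)).
Qed.

Lemma smooth_const (a : C) : smooth (fun _ => a).
Proof.
  apply smooth_jet. intros n. now apply (jet_cst (fun _ : unit -> R -> C => True) n (fun _ => a)).
Qed.

Lemma cderive_plus (f g : R -> C) : smooth f -> smooth g ->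
  cderive (fun x => f x + g x)%C = fun x => (cderive f x + cderive g x)%C.
Proof. intros. apply cderive_fun. intros; apply cder_plus; now apply smooth_cder. Qed.

Lemma cderive_mult (f g : R -> C) : smooth f -> smooth g ->
  cderive (fun x => f x * g x)%C = fun x => (cderive f x * g x + f x * cderive g x)%C.
Proof. intros. apply cderive_fun. intros; apply cder_mult; now apply smooth_cder. Qed.

Lemma cderive_n_plus (f g : R -> C) (n : nat) : smooth f -> smooth g ->
  cderive_n (fun x => f x + g x)%C n = fun x => (cderive_n f n x + cderive_n g n x)%C.
Proof.
  revert f g; induction n as [|n IH]; intros f g Hf Hg.
  - now rewrite !cderive_n_0.
  - rewrite !cderive_n_S cderive_plus; auto. apply IH; now apply smooth_cderive.
Qed.

Lemma smooth_cderive_n (f : R -> C) n : smooth f -> smooth (cderive_n f n).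
Proof.
  revert f; induction n as [|n IH]; intros f Hf; [now rewrite cderive_n_0|].
  rewrite cderive_n_S. now apply IH, smooth_cderive.
Qed.

(** * Schwartz seminorms *)

(** The least admissible constant in [seminorm_le]; having it as a number lets
    operator bounds be linear in it. *)
Definition schwartz_norm (N : nat) (f : R -> C) : R :=
  real (Lub_Rbar (fun r => exists j k x, (j <= N)%nat /\ (k <= N)%nat /\
    r = Rabs x ^ j * Cmod (cderive_n f k x))).

(** Any upper bound makes the supremum finite; the values at [j = k = 0] keep it
    from being minus infinity. *)
Lemma schwartz_norm_spec (N : nat) (f : R -> C) (M : R) :
  seminorm_le N f M ->
  seminorm_le N f (schwartz_norm N f) /\ schwartz_norm N f <= M.
Proof.
  intros HM. unfold schwartz_norm.
  set (E := fun r => _). destruct (Lub_Rbar_correct E) as [H1 H2].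
  assert (HE : Rbar_le (Lub_Rbar E) M).
  { apply H2. intros r [j [k [x [Hj [Hk ->]]]]]. now apply HM. }
  assert (HE0 : Rbar_le (Rabs 0 ^ 0 * Cmod (cderive_n f 0 0)) (Lub_Rbar E)).
  { apply H1. exists 0%nat, 0%nat, 0. repeat split; lia. }
  destruct (Lub_Rbar E) as [l| |]; simpl in HE, HE0; try contradiction.
  split; [|exact HE]. intros j k x Hj Hk. apply (H1 (Rabs x ^ j * Cmod (cderive_n f k x))).
  exists j, k, x. now repeat split.
Qed.

Lemma schwartz_norm_le (N : nat) (f : R -> C) (M : R) :
  seminorm_le N f M -> schwartz_norm N f <= M.
Proof. intros H. now apply schwartz_norm_spec. Qed.

Lemma schwartz_norm_bound (N j k : nat) (f : R -> C) (x : R) :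
  schwartz f -> (j <= N)%nat -> (k <= N)%nat ->
  Rabs x ^ j * Cmod (cderive_n f k x) <= schwartz_norm N f.
Proof.
  intros [_ H] Hj Hk. destruct (H N) as [M HM].
  apply (proj1 (schwartz_norm_spec _ _ _ HM)); assumption.
Qed.

Lemma schwartz_norm_seminorm (N : nat) (f : R -> C) :
  schwartz f -> seminorm_le N f (schwartz_norm N f).
Proof. intros Hf j k x Hj Hk. now apply schwartz_norm_bound. Qed.

Lemma schwartz_norm_pos (N : nat) (f : R -> C) : schwartz f -> 0 <= schwartz_norm N f.
Proof.
  intros H. eapply Rle_trans; [|apply (schwartz_norm_bound N 0 0 f 0 H); lia].
  simpl. generalize (Cmod_ge_0 (cderive_n f 0 0)). lra.
Qed.

Lemma schwartz_norm_mono (N N' : nat) (f : R -> C) :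
  schwartz f -> (N <= N')%nat -> schwartz_norm N f <= schwartz_norm N' f.
Proof.
  intros H HN. apply schwartz_norm_le. intros j k x Hj Hk.
  apply schwartz_norm_bound; [assumption|lia|lia].
Qed.

Lemma schwartz_smooth f : schwartz f -> smooth f.
Proof. intros H; apply H. Qed.

Lemma pow2_above (c : R) : exists n : nat, c <= 2 ^ n.
Proof.
  destruct (Pow_x_infinity 2 ltac:(rewrite Rabs_pos_eq; lra) c) as [N HN].
  exists N. specialize (HN N (le_n _)). rewrite Rabs_pos_eq in HN; [lra|].
  apply pow_le; lra.
Qed.

(** Turns bounds depending on the pair (j, k) into one bound for all pairs below
    [N], as required by [seminorm_le]. *)
Lemma uniform_index (Q : nat -> nat -> nat -> Prop) :
  (forall j k n n', (n <= n')%nat -> Q j k n -> Q j k n') ->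
  (forall j k, exists n, Q j k n) ->
  forall N, exists n, forall j k, (j <= N)%nat -> (k <= N)%nat -> Q j k n.
Proof.
  intros Hmono H N.
  assert (K : forall a b, exists n, forall j k, (j < a)%nat -> (k < b)%nat -> Q j k n).
  { induction a as [|a IHa]; [exists 0%nat; intros; lia|].
    induction b as [|b [n1 H1]]; [exists 0%nat; intros; lia|].
    destruct (IHa (S b)) as [n2 H2]. destruct (H a b) as [n3 H3].
    exists (n1 + n2 + n3)%nat. intros j k Hj Hk.
    destruct (Nat.eq_dec j a) as [->|]; [destruct (Nat.eq_dec k b) as [->|]|].
    - apply (Hmono _ _ n3); [lia|exact H3].
    - apply (Hmono _ _ n1); [lia|]. apply H1; lia.
    - apply (Hmono _ _ n2); [lia|]. apply H2; lia. }
  destruct (K (S N) (S N)) as [n Hn]. exists n. intros; apply Hn; lia.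
Qed.

Lemma schwartz_intro (f : R -> C) : smooth f ->
  (forall j k, exists M, forall x, Rabs x ^ j * Cmod (cderive_n f k x) <= M) -> schwartz f.
Proof.
  intros Hf H. split; [assumption|]. intros N.
  destruct (uniform_index (fun j k n => forall x, Rabs x ^ j * Cmod (cderive_n f k x) <= 2 ^ n))
    with (N := N) as [n Hn].
  - intros j k n n' Hn K x. eapply Rle_trans; [apply K|]. apply Rle_pow; [lra|assumption].
  - intros j k. destruct (H j k) as [M HM]. destruct (pow2_above M) as [n Hn]. exists n.
    intros x. eapply Rle_trans; [apply HM|exact Hn].
  - exists (2 ^ n). intros j k x Hj Hk. now apply Hn.
Qed.

Lemma size_pow_ge1 (s : R) n : 2 <= s -> 1 <= s ^ n.
Proof. intros; apply pow_R1_Rle; lra. Qed.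

Lemma size_const (s c : R) n : 2 <= s -> c <= 2 ^ n -> c <= s ^ n.
Proof. intros Hs Hc. eapply Rle_trans; [exact Hc|]. apply pow_incr; lra. Qed.

(** * Symbols *)

(** Polynomial growth in the frequency and in a size [s p] of the parameter. Sizes
    are at least 2, so that constants are absorbed by powers of the size and one
    exponent records everything. *)
Definition slow {P} (s : P -> R) (m : P -> R -> C) : Prop :=
  exists n, forall p x, Cmod (m p x) <= (s p * (1 + Rabs x)) ^ n.

(** Symbols act by multiplication on Schwartz functions, uniformly up to powers of
    the size of the parameter. *)
Definition symbol {P} (s : P -> R) (m : P -> R -> C) : Prop := forall n, jet (slow s) n m.

Lemma size_weight (s x : R) : 2 <= s -> 2 <= s * (1 + Rabs x).
Proof. intros. generalize (Rabs_pos x). nra. Qed.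

Lemma slow_intro {P} (s : P -> R) (m : P -> R -> C) (c : R) (n : nat) :
  (forall p, 2 <= s p) -> 
  (forall p x, Cmod (m p x) <= c * (s p * (1 + Rabs x)) ^ n) -> slow s m.
Proof.
  intros Hs H. destruct (pow2_above c) as [k Hk]. exists (k + n)%nat. intros p x.
  eapply Rle_trans; [apply H|]. rewrite pow_add.
  assert (Hw := size_weight _ x (Hs p)).
  apply Rmult_le_compat_r; [apply pow_le; lra|]. now apply size_const.
Qed.

Lemma slow_plus {P} (s : P -> R) (f g : P -> R -> C) : (forall p, 2 <= s p) ->
  slow s f -> slow s g -> slow s (fun p x => f p x + g p x)%C.
Proof.
  intros Hs [n Hn] [k Hk]. apply slow_intro with (c := 2) (n := (n + k)%nat); [assumption|].
  intros p x. assert (Hw := size_weight _ x (Hs p)).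
  eapply Rle_trans; [apply Cmod_triangle|].
  assert (Cmod (f p x) <= (s p * (1 + Rabs x)) ^ (n + k)).
  { eapply Rle_trans; [apply Hn|]. apply Rle_pow; [lra|lia]. }
  assert (Cmod (g p x) <= (s p * (1 + Rabs x)) ^ (n + k)).
  { eapply Rle_trans; [apply Hk|]. apply Rle_pow; [lra|lia]. }
  lra.
Qed.

Lemma slow_mult {P} (s : P -> R) (f g : P -> R -> C) :
  slow s f -> slow s g -> slow s (fun p x => f p x * g p x)%C.
Proof.
  intros [n Hn] [k Hk]. exists (n + k)%nat.
  intros p x. rewrite Cmod_mult pow_add.
  apply Rmult_le_compat; auto using Cmod_ge_0.
Qed.

Lemma slow_const {P} (s : P -> R) (c : C) : (forall p, 2 <= s p) -> slow s (fun _ _ => c).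
Proof.
  intros Hs. apply slow_intro with (c := Cmod c) (n := 0%nat); auto.
  intros; simpl; lra.
Qed.

Lemma symbol_const {P} (s : P -> R) (c : C) : (forall p, 2 <= s p) -> symbol s (fun _ _ => c).
Proof. intros Hs n. apply (jet_cst _ n (fun _ => c)); now apply slow_const. Qed.

Lemma symbol_plus {P} (s : P -> R) (f g : P -> R -> C) : (forall p, 2 <= s p) ->
  symbol s f -> symbol s g -> symbol s (fun p x => f p x + g p x)%C.
Proof. intros Hs Hf Hg n. apply jet_plus; auto. intros; now apply slow_plus. Qed.

Lemma symbol_mult {P} (s : P -> R) (f g : P -> R -> C) : (forall p, 2 <= s p) ->
  symbol s f -> symbol s g -> symbol s (fun p x => f p x * g p x)%C.
Proof.
  intros Hs Hf Hg n. apply jet_mult; auto.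
  - intros; now apply slow_plus.
  - intros; now apply slow_mult.
Qed.

Lemma symbol_cmult {P} (s : P -> R) (c : C) (f : P -> R -> C) : (forall p, 2 <= s p) ->
  symbol s f -> symbol s (fun p x => c * f p x)%C.
Proof.
  intros Hs Hf. apply (symbol_mult s (fun _ _ => c)); auto. now apply symbol_const.
Qed.

Lemma symbol_id {P} (s : P -> R) : (forall p, 2 <= s p) -> symbol s (fun _ x => RtoC x).
Proof.
  intros Hs n.
  assert (H : slow s (fun _ x => RtoC x)).
  { exists 1%nat. intros p x. rewrite Cmod_R pow_1. generalize (Hs p) (Rabs_pos x). nra. }
  destruct n as [|n]; split; auto.
  exists (fun _ _ => RtoC 1). split; [intros; apply cder_id|]. now apply symbol_const.
Qed.

Lemma symbol_smooth {P} (s : P -> R) m p : symbol s m -> smooth (m p).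
Proof. intros H. exact (jet_smooth _ _ H p). Qed.

Lemma symbol_derive {P} (s : P -> R) m : symbol s m -> symbol s (fun p => cderive (m p)).
Proof. intros H n. apply jet_derive, H. Qed.

Lemma symbol_reparam {P P'} (s : P -> R) (s' : P' -> R) (pi : P' -> P) m :
  (forall p, 0 <= s (pi p) <= s' p) -> symbol s m -> symbol s' (fun p => m (pi p)).
Proof.
  intros Hs H n. apply (jet_reparam (slow s)); [|apply H].
  intros g [k Hk]. exists k. intros p x. eapply Rle_trans; [apply Hk|].
  assert (0 <= Rabs x) by apply Rabs_pos. specialize (Hs p).
  apply pow_incr. nra.
Qed.

Lemma symbol_slowly_increasing {P} (s : P -> R) m p :
  (forall p, 2 <= s p) -> symbol s m -> slowly_increasing (m p).
Proof.
  intros Hs H. split; [now apply (symbol_smooth s)|]. intros k.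
  destruct (jet_derive_n _ k m (H k)) as [n Hn].
  exists n, (s p ^ n). intros x. rewrite -Rpow_mult_distr. apply Hn.
Qed.

(** * Bounded operators and distributions *)

(** Each seminorm of the image is controlled by some seminorm, with a polynomial
    loss in the size of the parameter. One exponent serves as power, order of the
    seminorm and (the size being at least 2) constant. *)
Definition sbounded {P} (s : P -> R) (A : P -> (R -> C) -> (R -> C)) : Prop :=
  (forall p f, schwartz f -> schwartz (A p f)) /\
  forall N, exists n, forall p f, schwartz f ->
    schwartz_norm N (A p f) <= s p ^ n * schwartz_norm n f.

Lemma scale_mono (s : R) (n n' : nat) (f : R -> C) : 2 <= s -> schwartz f -> (n <= n')%nat ->
  s ^ n * schwartz_norm n f <= s ^ n' * schwartz_norm n' f.
Proof.
  intros Hs Hf Hn. apply Rmult_le_compat.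
  - apply pow_le; lra.
  - now apply schwartz_norm_pos.
  - apply Rle_pow; [lra|assumption].
  - now apply schwartz_norm_mono.
Qed.

Lemma sbounded_intro {P} (s : P -> R) (A : P -> (R -> C) -> (R -> C)) :
  (forall p, 2 <= s p) ->
  (forall p f, schwartz f -> smooth (A p f)) ->
  (forall j k, exists n, forall p f x, schwartz f ->
     Rabs x ^ j * Cmod (cderive_n (A p f) k x) <= s p ^ n * schwartz_norm n f) ->
  sbounded s A.
Proof.
  intros Hs Hsm H.
  split.
  { intros p f Hf. apply schwartz_intro; auto. intros j k. destruct (H j k) as [n Hn].
    eexists. intros x. now apply Hn. }
  intros N.
  destruct (uniform_index (fun j k n => forall p f x, schwartz f ->
     Rabs x ^ j * Cmod (cderive_n (A p f) k x) <= s p ^ n * schwartz_norm n f))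
    with (N := N) as [n Hn]; [|assumption|].
  - intros j k n n' Hn K p f x Hf. eapply Rle_trans; [now apply K|]. now apply scale_mono.
  - exists n. intros p f Hf. apply schwartz_norm_le. intros j k x Hj Hk. now apply Hn.
Qed.

Lemma sbounded_comp {P} (s : P -> R) A B : (forall p, 2 <= s p) ->
  sbounded s A -> sbounded s B -> sbounded s (fun p f => A p (B p f)).
Proof.
  intros Hs [A1 A2] [B1 B2]. split; [auto|].
  intros N. destruct (A2 N) as [n Hn]. destruct (B2 n) as [k Hk].
  exists (n + k)%nat. intros p f Hf.
  eapply Rle_trans; [apply Hn; auto|].
  rewrite pow_add Rmult_assoc. apply Rmult_le_compat_l; [apply pow_le; specialize (Hs p); lra|].
  eapply Rle_trans; [apply Hk; auto|].
  apply Rmult_le_compat_l; [apply pow_le; specialize (Hs p); lra|].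
  apply schwartz_norm_mono; auto; lia.
Qed.

Lemma sbounded_id {P} (s : P -> R) : (forall p, 2 <= s p) -> sbounded s (fun _ f => f).
Proof.
  intros Hs. split; auto. intros N. exists N. intros p f Hf.
  rewrite -{1}(Rmult_1_l (schwartz_norm N f)). apply Rmult_le_compat_r.
  - now apply schwartz_norm_pos.
  - now apply size_pow_ge1.
Qed.

Lemma sbounded_derive {P} (s : P -> R) : (forall p, 2 <= s p) -> sbounded s (fun _ f => cderive f).
Proof.
  intros Hs. apply sbounded_intro; auto.
  - intros p f Hf. now apply smooth_cderive, schwartz_smooth.
  - intros j k. exists (j + S k)%nat. intros p f x Hf.
    rewrite -cderive_n_S -{1}(Rmult_1_l (_ * _)). apply Rmult_le_compat.
    + lra.
    + apply Rmult_le_pos; [apply pow_le, Rabs_pos|apply Cmod_ge_0].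
    + now apply size_pow_ge1.
    + apply schwartz_norm_bound; auto; lia.
Qed.

Lemma one_plus_pow (t : R) n : 0 <= t -> (1 + t) ^ n <= 2 ^ n * (1 + t ^ n).
Proof.
  intros Ht. assert (0 <= t ^ n) by now apply pow_le.
  assert (H2 : 1 <= 2 ^ n) by (apply pow_R1_Rle; lra).
  destruct (Rle_dec t 1).
  - apply Rle_trans with (2 ^ n); [apply pow_incr; lra|]. nra.
  - apply Rle_trans with ((2 * t) ^ n); [apply pow_incr; lra|].
    rewrite Rpow_mult_distr. nra.
Qed.

(** Induction on the order of the derivative for all symbols at once, by the
    product rule; at order zero the growth of the symbol is paid for by further
    powers of [x] in the seminorm of [f]. *)
Lemma sbounded_symbol {P} (s : P -> R) m : (forall p, 2 <= s p) ->
  symbol s m -> sbounded s (fun p f x => m p x * f x)%C.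
Proof.
  intros Hs Hm. apply sbounded_intro; auto.
  - intros p f Hf. apply smooth_mult; [now apply (symbol_smooth s) | now apply schwartz_smooth].
  - intros j k. revert m Hm. induction k as [|k IH]; intros m Hm.
    + destruct (jet_base _ _ _ (Hm 0%nat)) as [a Ha].
      exists (a + a + 1 + j)%nat. intros p f x Hf. rewrite cderive_n_0 Cmod_mult.
      assert (B1 := schwartz_norm_bound (j + a) j 0 f x Hf ltac:(lia) ltac:(lia)).
      assert (B2 := schwartz_norm_bound (j + a) (j + a) 0 f x Hf ltac:(lia) ltac:(lia)).
      rewrite cderive_n_0 in B1, B2. rewrite pow_add in B2.
      assert (Hx := Rabs_pos x). assert (Hc := Cmod_ge_0 (f x)).
      assert (Hxj : 0 <= Rabs x ^ j) by now apply pow_le.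
      assert (Hsp := Hs p).
      assert (Hsa : 0 <= s p ^ a) by (apply pow_le; lra).
      assert (Hn := schwartz_norm_pos (j + a) f Hf).
      apply Rle_trans with (s p ^ a * (2 ^ a * (2 * schwartz_norm (j + a) f))).
      * apply Rle_trans with (Rabs x ^ j * (s p ^ a * (2 ^ a * (1 + Rabs x ^ a)) * Cmod (f x))).
        -- apply Rmult_le_compat_l; [assumption|]. apply Rmult_le_compat_r; [assumption|].
           eapply Rle_trans; [apply Ha|]. rewrite Rpow_mult_distr.
           apply Rmult_le_compat_l; [assumption|]. now apply one_plus_pow.
        -- replace (Rabs x ^ j * (s p ^ a * (2 ^ a * (1 + Rabs x ^ a)) * Cmod (f x)))
             with (s p ^ a * (2 ^ a * (Rabs x ^ j * Cmod (f x) + Rabs x ^ j * Rabs x ^ a * Cmod (f x)))) by ring.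
           apply Rmult_le_compat_l; [assumption|]. apply Rmult_le_compat_l; [apply pow_le; lra|].
           lra.
      * apply Rle_trans with (s p ^ (a + a + 1) * schwartz_norm (j + a) f).
        -- rewrite !pow_add pow_1. 
           assert (2 ^ a <= s p ^ a) by (apply pow_incr; lra).
           assert (0 <= 2 ^ a) by (apply pow_le; lra).
           rewrite !Rmult_assoc. apply Rmult_le_compat_l; [assumption|].
           apply Rmult_le_compat; [assumption|lra|assumption|].
           apply Rmult_le_compat_r; assumption.
        -- apply Rmult_le_compat; [apply pow_le; lra|assumption| |].
           ++ apply Rle_pow; [lra|lia].
           ++ apply schwartz_norm_mono; auto; lia.
    + destruct (IH _ (symbol_derive _ _ Hm)) as [n1 H1].
      destruct (IH _ Hm) as [n2 H2].
      exists (n1 + n2 + 2)%nat. intros p f x Hf.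
      assert (Hf' : schwartz (cderive f)).
      { apply (proj1 (sbounded_derive (fun _ : unit => 2) ltac:(intros; lra))); auto. exact tt. }
      assert (Hmp : smooth (m p)) by now apply (symbol_smooth s).
      rewrite cderive_n_S cderive_mult; auto using schwartz_smooth.
      rewrite cderive_n_plus.
      2: apply smooth_mult; [now apply smooth_cderive|now apply schwartz_smooth].
      2: apply smooth_mult; [assumption|now apply schwartz_smooth].
      eapply Rle_trans.
      { apply Rmult_le_compat_l; [apply pow_le, Rabs_pos|apply Cmod_triangle]. }
      rewrite Rmult_plus_distr_l.
      assert (E1 := H1 p f x Hf). assert (E2 := H2 p (cderive f) x Hf').
      assert (E3 : schwartz_norm n2 (cderive f) <= schwartz_norm (n2 + 1) f).
      { apply schwartz_norm_le. intros j' k' y Hj Hk. rewrite -cderive_n_S.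
        apply schwartz_norm_bound; auto; lia. }
      assert (Hsp := Hs p).
      assert (E4 : s p ^ n2 * schwartz_norm n2 (cderive f) <= s p ^ (n1 + n2 + 1) * schwartz_norm (n1 + n2 + 1) f).
      { apply Rmult_le_compat; [apply pow_le; lra|now apply schwartz_norm_pos| |].
        - apply Rle_pow; [lra|lia].
        - eapply Rle_trans; [exact E3|]. apply schwartz_norm_mono; auto; lia. }
      assert (E5 : s p ^ n1 * schwartz_norm n1 f <= s p ^ (n1 + n2 + 1) * schwartz_norm (n1 + n2 + 1) f).
      { apply scale_mono; auto; lia. }
      apply Rle_trans with (2 * (s p ^ (n1 + n2 + 1) * schwartz_norm (n1 + n2 + 1) f)); [lra|].
      replace (n1 + n2 + 2)%nat with (1 + (n1 + n2 + 1))%nat by lia.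
      rewrite (pow_add _ 1) pow_1 Rmult_assoc. 
      assert (schwartz_norm (n1 + n2 + 1) f <= schwartz_norm (1 + (n1 + n2 + 1)) f).
      { apply schwartz_norm_mono; auto; lia. }
      assert (0 <= schwartz_norm (n1 + n2 + 1) f) by now apply schwartz_norm_pos.
      assert (0 <= s p ^ (n1 + n2 + 1)) by (apply pow_le; lra).
      apply Rmult_le_compat; [lra|apply Rmult_le_pos; auto|lra|].
      apply Rmult_le_compat_l; auto.
Qed.

Lemma sbounded_cmult {P} (s : P -> R) (c : C) A : (forall p, 2 <= s p) ->
  sbounded s A -> sbounded s (fun p f x => c * A p f x)%C.
Proof.
  intros Hs HA. apply (sbounded_comp s (fun _ f x => c * f x)%C); auto.
  apply (sbounded_symbol s (fun _ _ => c)); auto. now apply symbol_const.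
Qed.

Lemma schwartz_of_sbounded (A : (R -> C) -> (R -> C)) f :
  sbounded (fun _ : unit => 2) (fun _ => A) -> schwartz f -> schwartz (A f).
Proof. intros [H _]. apply (H tt). Qed.

Lemma two_le_two : forall _ : unit, 2 <= 2.
Proof. intros _; lra. Qed.

Lemma schwartz_derive f : schwartz f -> schwartz (cderive f).
Proof. apply schwartz_of_sbounded, sbounded_derive, two_le_two. Qed.

Lemma schwartz_symbol (m f : R -> C) :
  symbol (fun _ : unit => 2) (fun _ => m) -> schwartz f -> schwartz (fun x => m x * f x)%C.
Proof.
  intros Hm. apply (schwartz_of_sbounded (fun f x => m x * f x)%C).
  apply (sbounded_symbol _ (fun _ => m)); auto using two_le_two.
Qed.

Lemma schwartz_cmult (c : C) f : schwartz f -> schwartz (fun x => c * f x)%C.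
Proof. apply (schwartz_symbol (fun _ => c)). apply symbol_const, two_le_two. Qed.

Lemma schwartz_plus (f g : R -> C) : schwartz f -> schwartz g -> schwartz (fun x => f x + g x)%C.
Proof.
  intros Hf Hg. apply schwartz_intro; [apply smooth_plus; now apply schwartz_smooth|].
  intros j k. exists (schwartz_norm (j + k) f + schwartz_norm (j + k) g). intros x.
  rewrite cderive_n_plus; auto using schwartz_smooth.
  eapply Rle_trans.
  { apply Rmult_le_compat_l; [apply pow_le, Rabs_pos|apply Cmod_triangle]. }
  rewrite Rmult_plus_distr_l. apply Rplus_le_compat; apply schwartz_norm_bound; auto; lia.
Qed.

(** Tempered distributions depending on a parameter, of polynomial growth in its
    size. *)
Definition dbounded {P} (s : P -> R) (T : P -> dist) : Prop :=
  exists n, forall p f, schwartz f -> Cmod (T p f) <= s p ^ n * schwartz_norm n f.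

Lemma dbounded_comp {P} (s : P -> R) T A : (forall p, 2 <= s p) ->
  dbounded s T -> sbounded s A -> dbounded s (fun p f => T p (A p f)).
Proof.
  intros Hs [n Hn] [A1 A2]. destruct (A2 n) as [k Hk].
  exists (n + k)%nat. intros p f Hf.
  eapply Rle_trans; [apply Hn; auto|].
  rewrite pow_add Rmult_assoc. apply Rmult_le_compat_l; [apply pow_le; specialize (Hs p); lra|].
  eapply Rle_trans; [apply Hk; auto|].
  apply Rmult_le_compat_l; [apply pow_le; specialize (Hs p); lra|].
  apply schwartz_norm_mono; auto; lia.
Qed.

Lemma dbounded_reparam {P P'} (s : P -> R) (s' : P' -> R) (pi : P' -> P) T :
  (forall p, 0 <= s (pi p) <= s' p) -> dbounded s T -> dbounded s' (fun p => T (pi p)).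
Proof.
  intros Hs [n Hn]. exists n. intros p f Hf.
  eapply Rle_trans; [now apply Hn|]. apply Rmult_le_compat_r; [now apply schwartz_norm_pos|].
  apply pow_incr, Hs.
Qed.

Lemma sbounded_reparam {P P'} (s : P -> R) (s' : P' -> R) (pi : P' -> P) A :
  (forall p, 0 <= s (pi p) <= s' p) -> sbounded s A -> sbounded s' (fun p => A (pi p)).
Proof.
  intros Hs [H1 H2]. split; [intros; now apply H1|]. intros N.
  destruct (H2 N) as [n Hn]. exists n. intros p f Hf.
  eapply Rle_trans; [now apply Hn|]. apply Rmult_le_compat_r; [now apply schwartz_norm_pos|].
  apply pow_incr, Hs.
Qed.

Lemma tempered_dbounded (T : dist) :
  tempered T <-> dist_linear T /\ dbounded (fun _ : unit => 2) (fun _ => T).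
Proof.
  split; intros [HT H]; (split; [exact HT|]).
  - destruct H as [N [K H]]. destruct (pow2_above K) as [n Hn].
    exists (n + N)%nat. intros _ f Hf.
    eapply Rle_trans; [apply (H f Hf _ (schwartz_norm_seminorm N f Hf))|].
    assert (H0 := schwartz_norm_pos N f Hf).
    apply Rle_trans with (2 ^ n * schwartz_norm N f); [now apply Rmult_le_compat_r|].
    apply Rmult_le_compat; [apply pow_le; lra|assumption| |].
    + apply Rle_pow; [lra|lia].
    + apply schwartz_norm_mono; auto; lia.
  - destruct H as [n H]. exists n, (2 ^ n). intros f Hf M HM.
    eapply Rle_trans; [now apply (H tt)|]. apply Rmult_le_compat_l; [apply pow_le; lra|].
    now apply schwartz_norm_le.
Qed.

(** * Integrals over the line *)

Local Notation m_inf := (Rbar_locally m_infty).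
Local Notation p_inf := (Rbar_locally p_infty).

(** Convergence componentwise. The relational form makes linearity available
    without separate integrability proofs. *)
Definition has_int (f : R -> C) (l : C) : Prop :=
  is_RInt_gen (V := R_NormedModule) (fun t => Re (f t)) m_inf p_inf (Re l) /\
  is_RInt_gen (V := R_NormedModule) (fun t => Im (f t)) m_inf p_inf (Im l).

Lemma is_RInt_gen_pair (Fa Fb : (R -> Prop) -> Prop) {FFa : Filter Fa} {FFb : Filter Fb}
    (f : R -> C) (l : C) :
  is_RInt_gen (V := R_NormedModule) (fun t => Re (f t)) Fa Fb (Re l) ->
  is_RInt_gen (V := R_NormedModule) (fun t => Im (f t)) Fa Fb (Im l) ->
  is_RInt_gen (V := C_R_NormedModule) f Fa Fb l.
Proof.
  intros H1 H2 P [e He].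
  assert (K1 := H1 (ball (Re l) e) (locally_ball _ _)).
  assert (K2 := H2 (ball (Im l) e) (locally_ball _ _)).
  unfold filtermapi in *.
  generalize (filter_and _ _ K1 K2). apply filter_imp.
  intros [a b] [[y1 [I1 B1]] [y2 [I2 B2]]]. exists (y1, y2). split.
  - now apply (is_RInt_fct_extend_pair (U := R_NormedModule) (V := R_NormedModule)).
  - apply He. now split.
Qed.

Lemma has_int_gen (f : R -> C) (l : C) :
  has_int f l ->
  RInt_gen (V := C_R_CompleteNormedModule) f m_inf p_inf = l.
Proof.
  intros [H1 H2]. refine (is_RInt_gen_unique (V := C_R_CompleteNormedModule) f l _).
  exact (is_RInt_gen_pair _ _ f l H1 H2).
Qed.

Lemma has_int_plus f g lf lg : has_int f lf -> has_int g lg ->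
  has_int (fun t => f t + g t)%C (lf + lg)%C.
Proof.
  intros [H1 H2] [H3 H4]; split; simpl.
  - now apply: (is_RInt_gen_plus (fun t => Re (f t)) (fun t => Re (g t))).
  - now apply: (is_RInt_gen_plus (fun t => Im (f t)) (fun t => Im (g t))).
Qed.

Lemma has_int_cmult (a : C) f l : has_int f l -> has_int (fun t => a * f t)%C (a * l)%C.
Proof.
  intros [H1 H2]; split; simpl.
  - apply: (is_RInt_gen_minus (fun t => Re a * Re (f t)) (fun t => Im a * Im (f t)));
     now apply: (is_RInt_gen_scal).
  - apply: (is_RInt_gen_plus (fun t => Re a * Im (f t)) (fun t => Im a * Re (f t)));
     now apply: (is_RInt_gen_scal).
Qed.

Lemma gen_int_ge (h : R -> R) (l c : R) :
  is_RInt_gen (V := R_NormedModule) h m_inf p_inf l ->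
  (forall a b y, a <= -1 -> 1 <= b -> is_RInt (V := R_NormedModule) h a b y -> c <= y) -> c <= l.
Proof.
  intros H Hc. apply le_epsilon. intros e He.
  assert (K := H (ball l (mkposreal e He)) (locally_ball _ _)). unfold filtermapi in K.
  destruct K as [Q S [A HA] [B HB] HQ].
  destruct (HQ (Rmin (A - 1) (-1)) (Rmax (B + 1) 1)) as [y [Hy Hb]].
  - apply HA. generalize (Rmin_l (A - 1) (-1)). lra.
  - apply HB. generalize (Rmax_l (B + 1) 1). lra.
  - simpl in Hy. apply Hc in Hy; [|apply Rmin_r|apply Rmax_r].
    change (Rabs (y - l) < e) in Hb. apply Rabs_def2 in Hb. lra.
Qed.

(** The integrable majorant used throughout; its primitive is the arctangent. *)
Definition lorentz (M y : R) : R := M * / (1 + y ^ 2).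

Lemma is_RInt_lorentz (M a b : R) :
  is_RInt (V := R_NormedModule) (lorentz M) a b (M * atan b - M * atan a).
Proof.
  apply: (is_RInt_derive (fun y => M * atan y) (lorentz M)).
  - intros x _. unfold lorentz. auto_derive; [exact I|]. unfold Rsqr.
    field. nra.
  - intros x _. unfold lorentz. apply: ex_derive_continuous. auto_derive. nra.
Qed.

Lemma int_atan_bound (h : R -> R) (M a b : R) :
  (forall y, continuous h y) -> (forall y, Rabs (h y) <= lorentz M y) ->
  Rabs (RInt h a b) <= M * Rabs (atan b - atan a).
Proof.
  intros Hc Hb.
  assert (K : forall a b, a <= b -> Rabs (RInt h a b) <= M * Rabs (atan b - atan a)).
  { clear a b. intros a b Hab.
    assert (atan a <= atan b).
    { destruct Hab as [Hab| ->]; [left; now apply atan_increasing|lra]. }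
    rewrite (Rabs_pos_eq (atan b - atan a)); [|lra].
    rewrite Rmult_minus_distr_l.
    apply: (norm_RInt_le (V := R_NormedModule) h (lorentz M) a b).
    - exact Hab.
    - intros x _. apply Hb.
    - apply: RInt_correct. apply: ex_RInt_continuous. auto.
    - apply is_RInt_lorentz. }
  destruct (Rle_dec a b); [now apply K|].
  rewrite -(opp_RInt_swap (V := R_CompleteNormedModule)).
  - unfold opp; simpl. rewrite Rabs_Ropp Rabs_minus_sym. apply K. lra.
  - apply: ex_RInt_continuous. auto.
Qed.

Lemma atan_near_end (e : R) : 0 < e -> exists A, forall x, A < x -> PI / 2 - e < atan x.
Proof.
  intros He. assert (Hpi := PI_RGT_0).
  set (t := Rmax 0 (PI / 2 - e)).
  assert (Ht : - (PI / 2) < t < PI / 2).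
  { unfold t, Rmax. destruct Rle_dec; lra. }
  exists (tan t). intros x Hx. apply atan_increasing in Hx. rewrite atan_tan in Hx; [|exact Ht].
  eapply Rle_lt_trans; [|exact Hx]. apply Rmax_r.
Qed.

(** The Cauchy criterion at both ends, with the increments of the integral
    dominated by those of [M * atan]. *)
Lemma ex_gen_int (h : R -> R) (M : R) :
  (forall y, continuous h y) -> (forall y, Rabs (h y) <= lorentz M y) ->
  exists l, is_RInt_gen (V := R_NormedModule) h m_inf p_inf l /\ Rabs l <= 4 * M.
Proof.
  intros Hc Hb.
  assert (HM : 0 <= M).
  { generalize (Hb 0) (Rabs_pos (h 0)). unfold lorentz.
    replace (1 + 0 ^ 2) with 1 by ring. rewrite Rinv_1. lra. }
  assert (Hex : forall a b, ex_RInt (V := R_CompleteNormedModule) h a b).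
  { intros. apply: ex_RInt_continuous. auto. }
  assert (Hdiff : forall u v, Rabs (RInt h 0 u - RInt h 0 v) <= M * Rabs (atan u - atan v)).
  { intros u v. assert (E : RInt h 0 v + RInt h v u = RInt h 0 u).
    { now apply (RInt_Chasles (V := R_CompleteNormedModule)). }
    assert (G : forall x y : R, y + x - y = x) by (intros; ring).
    rewrite -E G.
    now apply int_atan_bound. }
  assert (Hlim : forall G, ProperFilter G ->
      (forall e, 0 < e -> exists Q, G Q /\ forall u v, Q u -> Q v -> Rabs (atan v - atan u) <= e) ->
      exists l, filterlim (fun b => RInt h 0 b) G (locally l)).
  { intros G FG HG. apply (filterlim_locally_cauchy (U := R_CompleteSpace)). intros e.
    destruct (HG (e / (M + 1))) as [Q [HQ Ha]]; [apply Rdiv_lt_0_compat; [apply cond_pos|lra]|].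
    exists Q. split; [exact HQ|]. intros u v Hu Hv. change (Rabs (RInt h 0 v - RInt h 0 u) < e).
    eapply Rle_lt_trans; [apply Hdiff|].
    apply Rle_lt_trans with (M * (e / (M + 1))); [apply Rmult_le_compat_l; auto|].
    apply Rmult_lt_reg_r with (M + 1); [lra|].
    replace (M * (e / (M + 1)) * (M + 1)) with (M * e) by (field; lra).
    generalize (cond_pos e). nra. }
  assert (Hp : exists l, filterlim (fun b => RInt h 0 b) p_inf (locally l)).
  { apply Hlim; [apply Rbar_locally_filter|]. intros e He.
    destruct (atan_near_end e He) as [A HA]. exists (fun x => A < x). split; [now exists A|].
    intros u v Hu Hv. generalize (HA u Hu) (HA v Hv) (atan_bound u) (atan_bound v).
    intros. apply Rabs_le. lra. }
  assert (Hm : exists l, filterlim (fun b => RInt h 0 b) m_inf (locally l)).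
  { apply Hlim; [apply Rbar_locally_filter|]. intros e He.
    destruct (atan_near_end e He) as [A HA]. exists (fun x => x < - A). split; [now exists (- A)|].
    intros u v Hu Hv.
    generalize (HA (- u) ltac:(lra)) (HA (- v) ltac:(lra)) (atan_bound u) (atan_bound v).
    rewrite !atan_opp. intros. apply Rabs_le. lra. }
  destruct Hp as [lp Hp], Hm as [lm Hm]. exists (lp - lm).
  assert (HI : is_RInt_gen (V := R_NormedModule) h m_inf p_inf (lp - lm)).
  { replace (lp - lm) with (plus (opp lm) lp) by (unfold plus, opp; simpl; ring).
    apply: (is_RInt_gen_Chasles (V := R_NormedModule) h 0).
    - intros P HP.
      assert (HP' : locally lm (fun z => P (opp z))).
      { apply: (filterlim_opp (V := R_NormedModule) lm). exact HP. }
      assert (K := Hm _ HP'). unfold filtermap in K. unfold filtermapi.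
      refine (Filter_prod _ _ _ _ (fun b => b = 0) K _ _); [reflexivity|].
      intros a b Ha ->. exists (opp (RInt h 0 a)). split; [|exact Ha]. simpl.
      apply: is_RInt_swap. now apply: RInt_correct.
    - intros P HP.
      assert (K := Hp _ HP). unfold filtermap in K. unfold filtermapi.
      refine (Filter_prod _ _ _ (fun b => b = 0) _ _ K _); [reflexivity|].
      intros a b -> Ha. exists (RInt h 0 b). split; [|exact Ha]. simpl.
      now apply: RInt_correct. }
  split; [exact HI|].
  assert (Hall : forall a b, Rabs (RInt h a b) <= 4 * M).
  { intros a b. eapply Rle_trans; [now apply (int_atan_bound h M)|].
    rewrite Rmult_comm. apply Rmult_le_compat_r; [assumption|].
    generalize (atan_bound a) (atan_bound b) PI_4. intros. apply Rabs_le. lra. }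
  apply Rabs_le. split.
  - apply (gen_int_ge h); [assumption|]. intros a b y _ _ Hy.
    apply (is_RInt_unique (V := R_CompleteNormedModule)) in Hy. rewrite -Hy. exact (proj1 (proj1 (Rabs_le_between _ _) (Hall a b))).
  - cut (- (4 * M) <= - (lp - lm)); [lra|].
    apply (gen_int_ge (fun y => opp (h y))).
    + now apply: is_RInt_gen_opp.
    + intros a b y _ _ Hy.
      apply (is_RInt_opp (V := R_NormedModule)) in Hy.
      apply (is_RInt_unique (V := R_CompleteNormedModule)) in Hy.
      rewrite (RInt_ext _ h) in Hy; [|intros; apply opp_opp].
      generalize (Hall a b). rewrite Hy. unfold opp; simpl. rewrite Rabs_Ropp.
      intros HH. apply Rabs_le_between in HH. lra.
Qed.

Definition integrable (f : R -> C) (M : R) : Prop :=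
  (forall y, ccont f y) /\ forall y, Cmod (f y) <= lorentz M y.

Definition cint (f : R -> C) : C := RInt_gen (V := C_R_CompleteNormedModule) f m_inf p_inf.

Lemma integrable_has_int (f : R -> C) (M : R) :
  integrable f M -> has_int f (cint f) /\ Cmod (cint f) <= 8 * M.
Proof.
  intros [H1 H2].
  destruct (ex_gen_int (fun t => Re (f t)) M) as [l1 [I1 B1]].
  - intros y; exact (proj1 (H1 y)).
  - intros. eapply Rle_trans; [apply re_le_Cmod | apply H2].
  - destruct (ex_gen_int (fun t => Im (f t)) M) as [l2 [I2 B2]].
    + intros y; exact (proj2 (H1 y)).
    + intros. eapply Rle_trans; [apply im_le_Cmod | apply H2].
    + assert (H : has_int f (l1, l2)) by now split.
      unfold cint. rewrite (has_int_gen _ _ H). split; [exact H|].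
      eapply Rle_trans; [apply Cmod_le_of_parts; [exact B1|exact B2]|]. lra.
Qed.

Lemma vanish_at_ends (h : R -> R) (M : R) :
  (forall y, Rabs y * Rabs (h y) <= M) ->
  filterlim h m_inf (locally 0) /\ filterlim h p_inf (locally 0).
Proof.
  intros H.
  assert (K : forall e y : R, 0 < e -> M / e < Rabs y -> Rabs (h y - 0) < e).
  { intros e y He Hy. rewrite Rminus_0_r. specialize (H y).
    destruct (Rlt_dec (Rabs (h y)) e) as [|Hn]; [assumption|exfalso].
    apply Rmult_lt_compat_r with (r := e) in Hy; [|assumption].
    replace (M / e * e) with M in Hy by (field; lra).
    generalize (Rabs_pos y). nra. }
  assert (HM : 0 <= M).
  { generalize (H 0). rewrite Rabs_R0. lra. }
  split; apply filterlim_locally; intros e.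
  - exists (- (M / e)). intros y Hy. apply (K e y (cond_pos e)).
    assert (0 <= M / e) by (apply Rdiv_le_0_compat; [assumption|apply cond_pos]).
    rewrite Rabs_left; lra.
  - exists (M / e). intros y Hy. apply (K e y (cond_pos e)).
    assert (0 <= M / e) by (apply Rdiv_le_0_compat; [assumption|apply cond_pos]).
    rewrite Rabs_pos_eq; lra.
Qed.

Lemma cint_derivative (F f : R -> C) (M : R) :
  (forall y, cder F y (f y)) -> (forall y, ccont f y) ->
  (forall y, Rabs y * Cmod (F y) <= M) -> has_int f (RtoC 0).
Proof.
  intros Hd Hc Hb.
  assert (K : forall H h : R -> R, (forall y, is_derive H y (h y)) ->
     (forall y, continuous h y) -> (forall y, Rabs y * Rabs (H y) <= M) ->
     is_RInt_gen (V := R_NormedModule) h m_inf p_inf 0).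
  { intros H h Hh Hhc HM. destruct (vanish_at_ends H M HM) as [L1 L2].
    replace h with (Derive H).
    - replace 0 with (0 - 0) by ring. apply (is_RInt_gen_Derive H 0 0); auto.
      + apply filter_forall. intros ab x _. now exists (h x).
      + apply filter_forall. intros ab x _. eapply continuous_ext; [|apply Hhc].
        intros; symmetry; now apply is_derive_unique.
    - fext x. now apply is_derive_unique. }
  split.
  - apply (K (fun t => Re (F t))).
    + intros y; exact (proj1 (Hd y)).
    + intros y; exact (proj1 (Hc y)).
    + intros y. eapply Rle_trans; [|apply (Hb y)].
      apply Rmult_le_compat_l; [apply Rabs_pos|apply re_le_Cmod].
  - apply (K (fun t => Im (F t))).
    + intros y; exact (proj2 (Hd y)).
    + intros y; exact (proj2 (Hc y)).
    + intros y. eapply Rle_trans; [|apply (Hb y)].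
      apply Rmult_le_compat_l; [apply Rabs_pos|apply im_le_Cmod].
Qed.

(** * The Fourier transform of Schwartz functions *)

Definition kern (y eta : R) : C := cexp (Copp (Cmult Ci (RtoC (y * eta)))).

Lemma Cmod_kern y eta : Cmod (kern y eta) = 1.
Proof. unfold kern. rewrite Cmod_cexp -exp_0. f_equal. simpl; ring. Qed.

Lemma cder_kern_l y eta : cder (fun t => kern t eta) y (- (Ci * RtoC eta) * kern y eta)%C.
Proof.
  apply cder_cexp. eapply cder_eq.
  - apply cder_opp, cder_cmult.
    replace (fun t => RtoC (t * eta)) with (fun t => RtoC t * RtoC eta)%C.
    + apply cder_mult; [apply cder_id|apply cder_const].
    + fext t. now rewrite RtoC_mult.
  - simpl. ring.
Qed.

Lemma ccont_kern y eta : ccont (fun t => kern t eta) y.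
Proof. eapply cder_ccont, cder_kern_l. Qed.

(** The Taylor estimate of the exponential at [z = - i y], in the variable [eta]. *)
Lemma kern_taylor y eta eta' :
  Cmod (kern y eta' - kern y eta - RtoC (eta' - eta) * (- (Ci * RtoC y) * kern y eta))%C
    <= 4 * (Rabs y ^ 2 * Rabs (eta' - eta) ^ 2).
Proof.
  set (z := (- (Ci * RtoC y))%C).
  assert (E : forall e, kern y e = cexp (RtoC e * z)).
  { intros e. unfold kern, z. f_equal. rewrite RtoC_mult. ring. }
  assert (Hz : Re z = 0) by (unfold z; simpl; ring).
  assert (Hm : Cmod z = Rabs y).
  { unfold z. rewrite Cmod_opp Cmod_mult Cmod_Ci Cmod_R. ring. }
  rewrite !E -Hm. apply exp_taylor_bound; rewrite Hz; lra.
Qed.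

Lemma schwartz_integrable (f m : R -> C) (c : R) (k : nat) :
  schwartz f -> (forall y, ccont m y) -> 0 <= c -> (forall y, Cmod (m y) <= c * Rabs y ^ k) ->
  integrable (fun y => f y * m y)%C (c * (2 * schwartz_norm (k + 2) f)).
Proof.
  intros Hf Hm Hc Hb. split.
  - intros y. apply ccont_mult; [|apply Hm]. eapply cder_ccont, smooth_cder, schwartz_smooth, Hf.
  - intros y. unfold lorentz. rewrite Cmod_mult.
    assert (Hp : 0 < 1 + y ^ 2) by nra.
    apply Rmult_le_reg_r with (1 + y ^ 2); [assumption|].
    rewrite (Rmult_assoc _ (/ _)) Rinv_l; [|lra]. rewrite Rmult_1_r.
    assert (B1 := schwartz_norm_bound (k + 2) k 0 f y Hf ltac:(lia) ltac:(lia)).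
    assert (B2 := schwartz_norm_bound (k + 2) (k + 2) 0 f y Hf ltac:(lia) ltac:(lia)).
    rewrite cderive_n_0 in B1, B2. rewrite pow_add pow2_abs in B2.
    apply Rle_trans with (Cmod (f y) * (c * Rabs y ^ k) * (1 + y ^ 2)).
    + apply Rmult_le_compat_r; [lra|]. apply Rmult_le_compat_l; [apply Cmod_ge_0|apply Hb].
    + replace (Cmod (f y) * (c * Rabs y ^ k) * (1 + y ^ 2))
        with (c * (Rabs y ^ k * Cmod (f y) + Rabs y ^ k * y ^ 2 * Cmod (f y))) by ring.
      apply Rmult_le_compat_l; [assumption|lra].
Qed.

Local Notation F := fourier_fun.

Lemma fourier_has_int f eta : schwartz f ->
  has_int (fun y => f y * kern y eta)%C (F f eta) /\ Cmod (F f eta) <= 16 * schwartz_norm 2 f.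
Proof.
  intros Hf.
  assert (H : integrable (fun y => f y * kern y eta)%C (1 * (2 * schwartz_norm (0 + 2) f))).
  { apply schwartz_integrable; auto.
    - intros; apply ccont_kern.
    - lra.
    - intros; rewrite Cmod_kern; simpl; lra. }
  apply integrable_has_int in H. destruct H as [H1 H2]. split; [exact H1|].
  eapply Rle_trans; [exact H2|]. change (0 + 2)%nat with 2%nat. lra.
Qed.

Lemma has_int_unique f l l' : has_int f l -> has_int f l' -> l = l'.
Proof. intros H1 H2. rewrite -(has_int_gen _ _ H1). now apply has_int_gen. Qed.

Lemma has_int_ext f g l : (forall t, f t = g t) -> has_int f l -> has_int g l.
Proof. intros H. now rewrite (functional_extensionality _ _ H). Qed.

Lemma fourier_eq f eta l : has_int (fun y => f y * kern y eta)%C l -> F f eta = l.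
Proof. intros H. exact (has_int_gen _ _ H). Qed.

Lemma cint_eq f l : has_int f l -> cint f = l.
Proof. intros H. exact (has_int_gen _ _ H). Qed.

Lemma fourier_comb (a b : C) f g eta : schwartz f -> schwartz g ->
  F (fun y => a * f y + b * g y)%C eta = (a * F f eta + b * F g eta)%C.
Proof.
  intros Hf Hg. apply fourier_eq.
  apply has_int_ext with (fun y => a * (f y * kern y eta) + b * (g y * kern y eta))%C.
  - intros t. unfold kern. ring.
  - apply has_int_plus; apply has_int_cmult; now apply fourier_has_int.
Qed.

Lemma fourier_cmult (a : C) f : schwartz f ->
  F (fun y => a * f y)%C = (fun eta => a * F f eta)%C.
Proof.
  intros Hf. fext eta. apply fourier_eq.
  apply has_int_ext with (fun y => a * (f y * kern y eta))%C.
  - intros t. unfold kern. ring.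
  - apply has_int_cmult; now apply fourier_has_int.
Qed.

(** Multiplication by [- i y], the operator that the transform turns into d/deta. *)
Definition mulx (f : R -> C) : R -> C := fun y => (- (Ci * RtoC y) * f y)%C.

Lemma symbol_mulx {P} (s : P -> R) : (forall p, 2 <= s p) -> symbol s (fun _ y => - (Ci * RtoC y))%C.
Proof.
  intros Hs. replace (fun (_ : P) y => - (Ci * RtoC y))%C with (fun (_ : P) y => (- Ci) * RtoC y)%C.
  - apply symbol_cmult; auto. now apply symbol_id.
  - apply functional_extensionality; intros p; fext y. ring.
Qed.

Lemma schwartz_mulx' f : schwartz f -> schwartz (mulx f).
Proof. apply schwartz_symbol. apply symbol_mulx, two_le_two. Qed.

(** Differentiation under the integral sign done by hand: by [kern_taylor] the
    error is quadratic in the increment, with integrand dominated by y^2 |f(y)|. *)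
Lemma cder_fourier f eta : schwartz f -> cder (F f) eta (F (mulx f) eta).
Proof.
  intros Hf. apply (cder_of_wder (fun _ => True)) with (r := 1); [lra|auto|].
  set (S := schwartz_norm 4 f). assert (HS : 0 <= S) by now apply schwartz_norm_pos.
  assert (K : forall eta', Cmod (F f eta' - F f eta - RtoC (eta' - eta) * F (mulx f) eta)%C
     <= 64 * S * Rabs (eta' - eta) ^ 2).
  { intros eta'.
    set (m := fun y => (kern y eta' - kern y eta
       - RtoC (eta' - eta) * (- (Ci * RtoC y) * kern y eta))%C).
    assert (H : integrable (fun y => f y * m y)%C
       ((4 * Rabs (eta' - eta) ^ 2) * (2 * schwartz_norm (2 + 2) f))).
    { apply schwartz_integrable; auto.
      - intros y. unfold m, Cminus.
        apply ccont_plus; [apply ccont_plus; [apply ccont_kern|]|].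
        + eapply cder_ccont, cder_opp, cder_kern_l.
        + eapply cder_ccont, cder_opp, cder_cmult, cder_mult; [|apply cder_kern_l].
          apply cder_opp, cder_cmult, cder_id.
      - generalize (pow2_ge_0 (Rabs (eta' - eta))). lra.
      - intros y. unfold m. eapply Rle_trans; [apply kern_taylor|]. right. ring. }
    apply integrable_has_int in H. destruct H as [H1 H2].
    replace (F f eta' - F f eta - RtoC (eta' - eta) * F (mulx f) eta)%C
      with (cint (fun y => f y * m y)%C).
    - eapply Rle_trans; [exact H2|]. right. unfold S. change (2 + 2)%nat with 4%nat. ring.
    - apply cint_eq.
      apply has_int_ext with (fun y => (f y * kern y eta' + (-1)%R * (f y * kern y eta))
         + (- RtoC (eta' - eta)) * (mulx f y * kern y eta))%C.
      + intros t. unfold m, mulx. ring.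
      + replace (F f eta' - F f eta - RtoC (eta' - eta) * F (mulx f) eta)%C
          with ((F f eta' + (-1)%R * F f eta) + (- RtoC (eta' - eta)) * F (mulx f) eta)%C by ring.
        apply has_int_plus; [apply has_int_plus|].
        * now apply fourier_has_int.
        * apply has_int_cmult. now apply fourier_has_int.
        * apply has_int_cmult. apply fourier_has_int; now apply schwartz_mulx'. }
  intros e He. exists (e / (64 * S + 1)).
  split; [apply Rdiv_lt_0_compat; lra|].
  intros y _ Hy. eapply Rle_trans; [apply K|].
  apply Rmult_lt_compat_r with (r := 64 * S + 1) in Hy; [|lra].
  replace (e / (64 * S + 1) * (64 * S + 1)) with e in Hy by (field; lra).
  assert (H0 := Rabs_pos (y - eta)).
  replace (64 * S * Rabs (y - eta) ^ 2) with (64 * S * Rabs (y - eta) * Rabs (y - eta)) by ring.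
  apply Rmult_le_compat_r; nra.
Qed.

Lemma cderive_fourier f : schwartz f -> cderive (F f) = F (mulx f).
Proof. intros Hf. apply cderive_fun. intros; now apply cder_fourier. Qed.

(** The integral over the line of the derivative of f(y) exp(- i y eta) is zero. *)
Lemma fourier_cderive f eta : schwartz f -> F (cderive f) eta = (Ci * RtoC eta * F f eta)%C.
Proof.
  intros Hf.
  assert (Hs := schwartz_smooth _ Hf).
  assert (Hc : forall y, ccont f y) by (intros; eapply cder_ccont, smooth_cder, Hs).
  assert (Hc' : forall y, ccont (cderive f) y).
  { intros; eapply cder_ccont, smooth_cder, smooth_cderive, Hs. }
  assert (H : has_int (fun y => cderive f y * kern y eta
     + f y * (- (Ci * RtoC eta) * kern y eta))%C (RtoC 0)).
  { apply cint_derivative with (F := fun y => (f y * kern y eta)%C) (M := schwartz_norm 1 f).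
    - intros y. apply (cder_mult f (fun y => kern y eta)); [now apply smooth_cder|apply cder_kern_l].
    - intros y. apply ccont_plus; apply ccont_mult; auto using ccont_kern.
      apply ccont_mult; [apply ccont_const|apply ccont_kern].
    - intros y. rewrite Cmod_mult Cmod_kern Rmult_1_r.
      assert (B1 := schwartz_norm_bound 1 1 0 f y Hf ltac:(lia) ltac:(lia)).
      rewrite cderive_n_0 pow_1 in B1. exact B1. }
  assert (H' : has_int (fun y => cderive f y * kern y eta
     + f y * (- (Ci * RtoC eta) * kern y eta))%C
     (F (cderive f) eta + (- (Ci * RtoC eta)) * F f eta)%C).
  { apply has_int_ext with (fun y => cderive f y * kern y eta
       + (- (Ci * RtoC eta)) * (f y * kern y eta))%C.
    - intros; ring.
    - apply has_int_plus.
      + apply fourier_has_int; now apply schwartz_derive.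
      + apply has_int_cmult; now apply fourier_has_int. }
  assert (E := has_int_unique _ _ _ H H').
  replace (F (cderive f) eta) with ((F (cderive f) eta + - (Ci * RtoC eta) * F f eta)
     + Ci * RtoC eta * F f eta)%C by ring.
  rewrite -E. ring.
Qed.

Lemma fourier_smooth f : schwartz f -> smooth (F f).
Proof.
  rewrite smooth_jet. intros Hf n. revert f Hf. induction n as [|n IH]; intros f Hf; split; auto.
  exists (fun _ => F (mulx f)). split.
  - intros _ x. now apply cder_fourier.
  - now apply IH, schwartz_mulx'.
Qed.

Lemma fourier_cderive_n f k : schwartz f ->
  cderive_n (F f) k = F (Nat.iter k mulx f).
Proof.
  revert f. induction k as [|k IH]; intros f Hf.
  - now rewrite cderive_n_0.
  - rewrite cderive_n_S (cderive_fun _ (F (mulx f))); [|intros; now apply cder_fourier].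
    rewrite IH; [|now apply schwartz_mulx']. f_equal. symmetry. apply Nat.iter_succ_r.
Qed.

Lemma fourier_iter_cderive f j eta : schwartz f ->
  F (Nat.iter j cderive f) eta = (Cpow (Ci * RtoC eta) j * F f eta)%C.
Proof.
  revert f; induction j as [|j IH]; intros f Hf.
  - simpl. ring.
  - rewrite Nat.iter_succ_r IH; [|now apply schwartz_derive].
    rewrite fourier_cderive; auto. simpl. ring.
Qed.

Lemma sbounded_iter {P} (s : P -> R) A k : (forall p, 2 <= s p) ->
  sbounded s (fun _ => A) -> sbounded s (fun _ f => Nat.iter k A f).
Proof.
  intros Hs HA. induction k as [|k IH].
  - now apply sbounded_id.
  - now apply (sbounded_comp s (fun _ => A)).
Qed.

(** Powers of [eta] and derivatives in [eta] are exchanged with derivatives and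
    multiplications by [y] applied to [f], and the transform is bounded by a
    seminorm of order 2. *)
Lemma sbounded_fourier : sbounded (fun _ : unit => 2) (fun _ => F).
Proof.
  apply sbounded_intro; [apply two_le_two|intros; now apply fourier_smooth|].
  intros j k.
  assert (H : sbounded (fun _ : unit => 2) (fun _ f => Nat.iter j cderive (Nat.iter k mulx f))).
  { apply (sbounded_comp _ (fun _ f => Nat.iter j cderive f) (fun _ f => Nat.iter k mulx f));
      [apply two_le_two| |]; apply sbounded_iter; try apply two_le_two.
    - apply sbounded_derive, two_le_two.
    - apply sbounded_symbol; [apply two_le_two|apply symbol_mulx, two_le_two]. }
  destruct H as [H1 H2]. destruct (H2 2%nat) as [n Hn].
  exists (4 + n)%nat. intros p f x Hf.
  assert (Hk : schwartz (Nat.iter k mulx f)).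
  { clear -Hf. induction k as [|k IH]; [exact Hf|]. now apply schwartz_mulx'. }
  rewrite fourier_cderive_n; auto.
  replace (Rabs x ^ j * Cmod (F (Nat.iter k mulx f) x))
    with (Cmod (F (Nat.iter j cderive (Nat.iter k mulx f)) x)).
  - eapply Rle_trans; [apply fourier_has_int; auto|].
    apply Rle_trans with (16 * (2 ^ n * schwartz_norm n f)).
    + apply Rmult_le_compat_l; [lra|]. now apply Hn.
    + rewrite pow_add Rmult_assoc. apply Rmult_le_compat; [lra| |simpl; lra|].
      * apply Rmult_le_pos; [apply pow_le; lra|now apply schwartz_norm_pos].
      * apply Rmult_le_compat_l; [apply pow_le; lra|]. apply schwartz_norm_mono; auto; lia.
  - rewrite fourier_iter_cderive; auto. rewrite Cmod_mult Cmod_pow Cmod_mult Cmod_Ci Cmod_R.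
    now rewrite Rmult_1_l.
Qed.

Lemma schwartz_fourier f : schwartz f -> schwartz (F f).
Proof. apply schwartz_of_sbounded, sbounded_fourier. Qed.

(** * Hadamard's lemma *)

(** The integral in Hadamard's formula
    f(y) - f(a) = (y - a) * int_0^1 f'(a + t (y - a)) dt; the weight [t ^ k] appears
    on differentiating [k] times in [y]. *)
Definition hmean (k : nat) (g : R -> R) (a y : R) : R :=
  RInt (fun t => t ^ k * g (a + t * (y - a))) 0 1.

Lemma is_derive_hmean k (g g' : R -> R) a y :
  (forall x, is_derive g x (g' x)) -> (forall x, continuous g' x) ->
  is_derive (hmean k g a) y (hmean (S k) g' a y).
Proof.
  intros Hg Hc.
  assert (Hd : forall t z, is_derive (fun u => t ^ k * g (a + t * (u - a))) z
     (t ^ S k * g' (a + t * (z - a)))).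
  { intros t z. auto_derive.
    - eexists; apply Hg.
    - rewrite (is_derive_unique _ _ _ (Hg _)). simpl. unfold Rdefinitions.Rminus. ring. }
  assert (Hcont : forall h : R -> R, (forall x, continuous h x) -> forall j z t,
     continuous (fun t => t ^ j * h (a + t * (z - a))) t).
  { intros h Hh j z t. apply: (continuous_mult (K := R_AbsRing)).
    - apply: ex_derive_continuous. auto_derive. exact I.
    - apply (continuous_comp (fun t => a + t * (z - a)) h); [|apply Hh].
      apply: ex_derive_continuous. auto_derive. exact I. }
  unfold hmean. evar_last.
  - apply: (is_derive_RInt_param (fun u t => t ^ k * g (a + t * (u - a))) 0 1 y).
    + apply filter_forall. intros x t _. eexists; apply Hd.
    + intros t _.
      apply (continuity_2d_pt_ext (fun u v => v ^ S k * g' (a + v * (u - a)))).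
      { intros u v. symmetry. now apply is_derive_unique. }
      apply continuity_2d_pt_mult.
      * apply (continuity_1d_2d_pt_comp (fun w => w ^ S k) (fun _ v => v)); [|apply continuity_2d_pt_id2].
        apply continuity_pt_filterlim. apply: ex_derive_continuous. auto_derive. exact I.
      * apply (continuity_1d_2d_pt_comp g' (fun u v => a + v * (u - a))); [apply continuity_pt_filterlim, Hc|].
        apply continuity_2d_pt_plus; [apply continuity_2d_pt_const|].
        apply continuity_2d_pt_mult; [apply continuity_2d_pt_id2|].
        apply continuity_2d_pt_minus; [apply continuity_2d_pt_id1|apply continuity_2d_pt_const].
    + apply filter_forall. intros x. apply: ex_RInt_continuous. intros z _.
      apply Hcont. intros w. apply: ex_derive_continuous. eexists; apply Hg.
  - apply RInt_ext. intros t _. now apply is_derive_unique.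
Qed.

Lemma hmean_bound k (g : R -> R) a y M :
  (forall x, continuous g x) -> (forall x, Rabs (g x) <= M) -> Rabs (hmean k g a y) <= M.
Proof.
  intros Hc HM.
  assert (HM0 : 0 <= M) by (eapply Rle_trans; [apply Rabs_pos|apply (HM 0)]).
  replace M with ((1 - 0) * M) by ring.
  apply: (norm_RInt_le_const (V := R_NormedModule)
     (fun t => t ^ k * g (a + t * (y - a))) 0 1); [lra| |].
  - intros t Ht. change (Rabs (t ^ k * g (a + t * (y - a))) <= M).
    rewrite Rabs_mult -(Rmult_1_l M). apply Rmult_le_compat; auto using Rabs_pos.
    rewrite Rabs_pos_eq; [|apply pow_le; lra].
    rewrite -(pow1 k). apply pow_incr. lra.
  - apply: RInt_correct. apply: ex_RInt_continuous. intros z _.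
    apply: (continuous_mult (K := R_AbsRing)).
    + apply: ex_derive_continuous. auto_derive. exact I.
    + apply (continuous_comp (fun t => a + t * (y - a)) g); [|apply Hc].
      apply: ex_derive_continuous. auto_derive. exact I.
Qed.

Lemma hmean_value (g g' : R -> R) a y :
  (forall x, is_derive g x (g' x)) -> (forall x, continuous g' x) ->
  (y - a) * hmean 0 g' a y = g y - g a.
Proof.
  intros Hg Hc.
  assert (H : is_RInt (V := R_NormedModule) (fun t => (y - a) * (t ^ 0 * g' (a + t * (y - a)))) 0 1
     (g y - g a)).
  { evar_last.
    - apply: (is_RInt_derive (fun t => g (a + t * (y - a)))).
      + intros t _. auto_derive; [eexists; apply Hg|].
        rewrite (is_derive_unique _ _ _ (Hg _)). simpl. unfold Rdefinitions.Rminus. ring.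
      + intros t _. apply: (continuous_scal_r (V := R_NormedModule)).
        apply: (continuous_mult (K := R_AbsRing)).
        * apply: ex_derive_continuous. auto_derive. exact I.
        * apply (continuous_comp (fun t => a + t * (y - a)) g'); [|apply Hc].
          apply: ex_derive_continuous. auto_derive. exact I.
    - unfold minus, plus, opp; simpl. replace (a + 1 * (y - a)) with y by ring.
      replace (a + 0 * (y - a)) with a by ring. ring. }
  unfold hmean. rewrite -(is_RInt_unique _ _ _ _ H).
  symmetry. apply: (RInt_scal (V := R_CompleteNormedModule)).
  apply: ex_RInt_continuous. intros t _. apply: (continuous_mult (K := R_AbsRing)).
  - apply: ex_derive_continuous. auto_derive. exact I.
  - apply (continuous_comp (fun t => a + t * (y - a)) g'); [|apply Hc].
    apply: ex_derive_continuous. auto_derive. exact I.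
Qed.

Definition chmean (k : nat) (f : R -> C) (a y : R) : C :=
  (hmean k (fun t => Re (f t)) a y, hmean k (fun t => Im (f t)) a y).

Lemma cder_chmean k f a y : smooth f -> cder (chmean k f a) y (chmean (S k) (cderive f) a y).
Proof.
  intros Hf. assert (H1 := fun x => smooth_cder _ x Hf).
  assert (H2 := fun x => smooth_cder _ x (smooth_cderive _ Hf)).
  split; simpl.
  - apply: (is_derive_hmean k _ (fun t => Re (cderive f t))).
    + intros u; exact (proj1 (H1 u)).
    + intros u; exact (proj1 (cder_ccont _ _ _ (H2 u))).
  - apply: (is_derive_hmean k _ (fun t => Im (cderive f t))).
    + intros u; exact (proj2 (H1 u)).
    + intros u; exact (proj2 (cder_ccont _ _ _ (H2 u))).
Qed.

Lemma smooth_chmean k f a : smooth f -> smooth (chmean k f a).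
Proof.
  rewrite (smooth_jet (chmean _ _ _)). intros Hf n. revert k f Hf.
  induction n as [|n IH]; intros k f Hf; split; auto.
  exists (fun _ => chmean (S k) (cderive f) a). split.
  - intros _ x. now apply cder_chmean.
  - now apply IH, smooth_cderive.
Qed.

Lemma cderive_n_chmean n k f a : smooth f ->
  cderive_n (chmean k f a) n = chmean (n + k) (cderive_n f n) a.
Proof.
  revert k f. induction n as [|n IH]; intros k f Hf; [now rewrite !cderive_n_0|].
  rewrite !cderive_n_S (cderive_fun _ (chmean (S k) (cderive f) a)).
  - rewrite IH; [f_equal; lia|now apply smooth_cderive].
  - intros; now apply cder_chmean.
Qed.

Lemma leibniz_linear (h : R -> C) (a : R) k : smooth h ->
  cderive_n (fun y => RtoC (y - a) * h y)%C k
  = (fun y => RtoC (y - a) * cderive_n h k y + RtoC (INR k) * cderive_n h (pred k) y)%C.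
Proof.
  assert (Hd : forall x, cder (fun y => RtoC (y - a)) x (RtoC 1)).
  { intros x. replace (fun y => RtoC (y - a)) with (fun y => RtoC y - RtoC a)%C.
    - eapply cder_eq; [apply cder_minus; [apply cder_id|apply cder_const]|ring].
    - fext y. now rewrite RtoC_minus. }
  revert h. induction k as [|k IH]; intros h Hh.
  - rewrite !cderive_n_0. fext y. simpl. ring.
  - rewrite cderive_n_S (cderive_fun _ (fun y => h y + RtoC (y - a) * cderive h y)%C).
    2: { intros x. eapply cder_eq; [apply (cder_mult (fun y => RtoC (y - a)) h); [apply Hd|now apply smooth_cder]|cbv beta; ring]. }
    rewrite cderive_n_plus; [|assumption|].
    2: { apply smooth_mult; [|now apply smooth_cderive].
         eapply smooth_intro; [exact Hd|apply smooth_const]. }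
    rewrite IH; [|now apply smooth_cderive]. fext y.
    rewrite -cderive_n_S. simpl pred. destruct k as [|k].
    + simpl pred. replace (INR 1) with 1 by reflexivity. replace (INR 0) with 0 by reflexivity. ring.
    + simpl pred. rewrite -cderive_n_S (S_INR (S k)) RtoC_plus. ring.
Qed.

(** Hadamard's quotient [h] has bounded derivatives. By Leibniz' rule
    y h^(k) = f^(k) - k h^(k-1) + a h^(k), so each power of [y] can be traded for
    lower ones: the decay of [h] follows by induction on the power, for all [k]
    simultaneously. *)
Lemma hadamard (f : R -> C) (a : R) : schwartz f -> f a = RtoC 0 ->
  exists h, schwartz h /\ f = (fun y => RtoC (y - a) * h y)%C.
Proof.
  intros Hf Ha. set (h := chmean 0 (cderive f) a).
  assert (Hsf := schwartz_smooth _ Hf).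
  assert (Hsf' := smooth_cderive _ Hsf).
  assert (Hh : smooth h) by now apply smooth_chmean.
  assert (E : f = (fun y => RtoC (y - a) * h y)%C).
  { assert (H1 := fun x => smooth_cder _ x Hsf).
    assert (H2 := fun x => smooth_cder _ x Hsf').
    assert (K1 : forall y, (y - a) * hmean 0 (fun t => Re (cderive f t)) a y = Re (f y) - Re (f a)).
    { intros y. apply (hmean_value (fun t => Re (f t))).
      - intros u; exact (proj1 (H1 u)).
      - intros u; exact (proj1 (cder_ccont _ _ _ (H2 u))). }
    assert (K2 : forall y, (y - a) * hmean 0 (fun t => Im (cderive f t)) a y = Im (f y) - Im (f a)).
    { intros y. apply (hmean_value (fun t => Im (f t))).
      - intros u; exact (proj2 (H1 u)).
      - intros u; exact (proj2 (cder_ccont _ _ _ (H2 u))). }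
    fext y.
    specialize (K1 y). specialize (K2 y). rewrite Ha in K1, K2. simpl in K1, K2.
    apply C_ext.
    - simpl. simpl in K1. rewrite Rmult_0_l Rminus_0_r. rewrite K1. ring.
    - simpl. simpl in K2. rewrite Rmult_0_l Rplus_0_r. rewrite K2. ring. }
  exists h. split; [|exact E].
  apply schwartz_intro; [assumption|].
  induction j as [|j IH]; intros k.
  - exists (2 * schwartz_norm (S k) f). intros x.
    unfold h. rewrite cderive_n_chmean; auto. rewrite Nat.add_0_r -cderive_n_S pow_O Rmult_1_l.
    assert (B : forall x, Cmod (cderive_n f (S k) x) <= schwartz_norm (S k) f).
    { intros y. assert (B := schwartz_norm_bound (S k) 0 (S k) f y Hf ltac:(lia) ltac:(lia)).
      rewrite pow_O Rmult_1_l in B. exact B. }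
    assert (Hc : forall y, ccont (cderive_n f (S k)) y).
    { intros y. eapply cder_ccont, smooth_cder, smooth_cderive_n, Hsf. }
    apply Cmod_le_of_parts;
      [apply (hmean_bound _ (fun t => Re (cderive_n f (S k) t)))
      |apply (hmean_bound _ (fun t => Im (cderive_n f (S k) t)))].
    + intros u; exact (proj1 (Hc u)).
    + intros y. eapply Rle_trans; [apply re_le_Cmod|apply B].
    + intros u; exact (proj2 (Hc u)).
    + intros y. eapply Rle_trans; [apply im_le_Cmod|apply B].
  - destruct (IH k) as [M1 H1]. destruct (IH (pred k)) as [M2 H2].
    exists (schwartz_norm (j + k) f + INR k * M2 + Rabs a * M1). intros x.
    (* Leibniz' rule for f = (x - a) h trades one power of x in the seminorm of h
       for seminorms with fewer powers. *)
    assert (Hx : (RtoC x * cderive_n h k x = cderive_n f k x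
       + - (RtoC (INR k) * cderive_n h (pred k) x) + RtoC a * cderive_n h k x)%C).
    { rewrite {1}E leibniz_linear; auto. rewrite RtoC_minus. ring. }
    replace (Rabs x ^ S j * Cmod (cderive_n h k x))
      with (Rabs x ^ j * Cmod (RtoC x * cderive_n h k x)%C)
      by (rewrite Cmod_mult Cmod_R; simpl; ring).
    assert (Hp : 0 <= Rabs x ^ j) by apply pow_le, Rabs_pos.
    rewrite Hx. eapply Rle_trans.
    { apply Rmult_le_compat_l; [assumption|]. eapply Rle_trans; [apply Cmod_triangle|].
      apply Rplus_le_compat_r, Cmod_triangle. }
    rewrite Cmod_opp !Cmod_mult !Cmod_R (Rabs_pos_eq (INR k)); [|apply pos_INR].
    rewrite !Rmult_plus_distr_l. apply Rplus_le_compat; [apply Rplus_le_compat|].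
    + apply schwartz_norm_bound; auto; lia.
    + apply Rle_trans with (INR k * (Rabs x ^ j * Cmod (cderive_n h (pred k) x))); [right; ring|].
      apply Rmult_le_compat_l; [apply pos_INR|apply H2].
    + apply Rle_trans with (Rabs a * (Rabs x ^ j * Cmod (cderive_n h k x))); [right; ring|].
      apply Rmult_le_compat_l; [apply Rabs_pos|apply H1].
Qed.

(** * Fourier inversion *)

Definition gauss (y : R) : C := RtoC (exp (- (y ^ 2 / 2))).

Lemma cder_RtoC (f : R -> R) x l : is_derive f x l -> cder (fun t => RtoC (f t)) x (RtoC l).
Proof. intros H; split; [exact H|apply: is_derive_const]. Qed.

Lemma cder_gauss y : cder gauss y (- (RtoC y) * gauss y)%C.
Proof.
  unfold gauss. eapply cder_eq.
  - apply cder_RtoC. auto_derive; [exact I|reflexivity].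
  - rewrite -RtoC_opp -RtoC_mult. apply (f_equal RtoC). unfold Rdiv. simpl. field.
Qed.

Lemma gauss_decay n : exists c, forall y, (1 + Rabs y) ^ n * Cmod (gauss y) <= c.
Proof.
  destruct (pow_exp_bound n) as [c Hc].
  exists (c * exp (3 / 2)). intros y. assert (Hy := Rabs_pos y).
  unfold gauss. rewrite Cmod_R (Rabs_pos_eq (exp _)); [|left; apply exp_pos].
  apply Rle_trans with ((1 + Rabs y) ^ n * (exp (- (1 + Rabs y)) * exp (3 / 2))).
  - apply Rmult_le_compat_l; [apply pow_le; lra|].
    rewrite -exp_plus.
    assert (H : - (y ^ 2 / 2) <= - (1 + Rabs y) + 3 / 2).
    { rewrite -(pow2_abs y). generalize (pow2_ge_0 (Rabs y - 1)); lra. }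
    destruct H as [H| ->]; [left; now apply exp_increasing|lra].
  - rewrite -Rmult_assoc. apply Rmult_le_compat_r; [left; apply exp_pos|]. apply Hc. lra.
Qed.

(** Proved for P times the Gaussian with [P] any symbol, a class stable under
    derivation: the derivative is (P' - y P) times the Gaussian. *)
Lemma schwartz_gauss : schwartz gauss.
Proof.
  set (rapid := fun m : unit -> R -> C => forall j, exists M, forall x,
    Rabs x ^ j * Cmod (m tt x) <= M).
  assert (K : forall n P, symbol (fun _ : unit => 2) (fun _ => P) ->
    jet rapid n (fun _ y => P y * gauss y)%C).
  { assert (K0 : forall P, symbol (fun _ : unit => 2) (fun _ => P) ->
      rapid (fun _ y => P y * gauss y)%C).
    { intros P HP j. destruct (jet_base _ _ _ (HP 0%nat)) as [n Hn].
      destruct (gauss_decay (j + n)) as [c Hc]. exists (2 ^ n * c). intros x.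
      specialize (Hn tt x). specialize (Hc x). rewrite Cmod_mult.
      rewrite Rpow_mult_distr in Hn. rewrite pow_add in Hc.
      assert (H0 := Rabs_pos x). assert (Hg := Cmod_ge_0 (gauss x)).
      assert (Rabs x ^ j <= (1 + Rabs x) ^ j) by (apply pow_incr; lra).
      assert (0 <= Rabs x ^ j) by now apply pow_le.
      apply Rle_trans with ((1 + Rabs x) ^ j * (2 ^ n * (1 + Rabs x) ^ n * Cmod (gauss x))).
      - apply Rmult_le_compat; auto.
        + apply Rmult_le_pos; [apply Cmod_ge_0|assumption].
        + now apply Rmult_le_compat_r.
      - apply Rle_trans with (2 ^ n * ((1 + Rabs x) ^ j * (1 + Rabs x) ^ n * Cmod (gauss x))).
        + right; ring.
        + apply Rmult_le_compat_l; [apply pow_le; lra|assumption]. }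
    induction n as [|n IH]; intros P HP; split; auto.
    exists (fun _ y => (cderive P y + (- (1)) * (RtoC y * P y)) * gauss y)%C. split.
    - intros _ x. eapply cder_eq.
      + apply cder_mult; [|apply cder_gauss].
        apply smooth_cder. exact (symbol_smooth _ _ tt HP).
      + ring.
    - apply IH. apply (symbol_plus _ (fun _ => cderive P)); [apply two_le_two| |].
      + apply (symbol_derive _ _ HP).
      + apply symbol_cmult; [apply two_le_two|].
        apply (symbol_mult _ (fun _ => RtoC)); [apply two_le_two| |exact HP].
        apply symbol_id, two_le_two. }
  assert (K1 : forall n, jet rapid n (fun _ => gauss)).
  { intros n. replace gauss with (fun y => RtoC 1 * gauss y)%C.
    - apply (K n (fun _ => RtoC 1)). apply symbol_const, two_le_two.
    - apply functional_extensionality; intros; ring. }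
  apply schwartz_intro.
  - exact (jet_smooth _ _ K1 tt).
  - intros j k. exact (jet_derive_n _ _ _ (K1 k) j).
Qed.

Definition gint : C := F gauss 0.

(** Both sides solve w' = - eta w: divide by the Gaussian to get a constant. *)
Lemma fourier_gauss eta : F gauss eta = (gint * gauss eta)%C.
Proof.
  set (H := fun eta => (F gauss eta * RtoC (exp (eta ^ 2 / 2)))%C).
  assert (HH : forall x, cder H x (RtoC 0)).
  { intros x. unfold H. eapply cder_eq.
    - apply cder_mult; [apply cder_fourier, schwartz_gauss|].
      apply cder_RtoC. auto_derive; [exact I|reflexivity].
    - replace (F (mulx gauss) x) with (- RtoC x * F gauss x)%C.
      + apply C_ext; unfold Re, Im, Rdiv; simpl; field.
      + replace (mulx gauss) with (fun y => Ci * cderive gauss y)%C.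
        * rewrite fourier_cmult; [|apply schwartz_derive, schwartz_gauss].
          rewrite fourier_cderive; [|apply schwartz_gauss].
          apply C_ext; unfold Re, Im; simpl; ring.
        * fext y.
          rewrite (cder_cderive _ _ _ (cder_gauss y)). unfold mulx. ring. }
  assert (E := cder_zero_constant H HH eta 0). unfold H in E.
  replace (0 ^ 2 / 2) with 0 in E by field. rewrite exp_0 Cmult_1_r in E.
  change (gauss eta) with (RtoC (exp (- (eta ^ 2 / 2)))). unfold gint.
  rewrite -E -Cmult_assoc -RtoC_mult -exp_plus.
  replace (eta ^ 2 / 2 + - (eta ^ 2 / 2)) with 0 by ring. rewrite exp_0. ring.
Qed.

(** The integrand is positive, so the integral dominates its part over [-1, 1]. *)
Lemma gint_neq_0 : gint <> RtoC 0.
Proof.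
  destruct (fourier_has_int gauss 0 schwartz_gauss) as [[H _] _]. fold gint in H.
  assert (Hc : forall y, continuous (fun y => exp (- (y ^ 2 / 2))) y).
  { intros y. apply: ex_derive_continuous. auto_derive. exact I. }
  assert (Hex : forall a b, ex_RInt (V := R_CompleteNormedModule) (fun y => exp (- (y ^ 2 / 2))) a b).
  { intros. apply: ex_RInt_continuous. auto. }
  set (c := RInt (fun y => exp (- (y ^ 2 / 2))) (-1) 1).
  assert (Hc0 : 0 < c).
  { apply RInt_gt_0; [lra| |].
    - intros; apply exp_pos.
    - intros; apply Hc. }
  assert (Hle : c <= Re gint).
  { apply (gen_int_ge _ _ _ H). intros a b y Ha Hb Hy.
    assert (Hy' : RInt (fun y => exp (- (y ^ 2 / 2))) a b = y).
    { apply (is_RInt_unique (V := R_CompleteNormedModule)).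
      eapply is_RInt_ext; [|exact Hy]. intros x _. cbv beta.
      assert (E0 : kern x 0 = RtoC 1).
      { unfold kern. rewrite Rmult_0_r -cexp_0. f_equal. ring. }
      rewrite E0. simpl. ring. }
    assert (E1 : RInt (fun y => exp (- (y ^ 2 / 2))) a (-1) + c = RInt (fun y => exp (- (y ^ 2 / 2))) a 1).
    { now apply (RInt_Chasles (V := R_CompleteNormedModule)). }
    assert (E2 : RInt (fun y => exp (- (y ^ 2 / 2))) a 1 + RInt (fun y => exp (- (y ^ 2 / 2))) 1 b
      = RInt (fun y => exp (- (y ^ 2 / 2))) a b).
    { now apply (RInt_Chasles (V := R_CompleteNormedModule)). }
    assert (P1 : 0 <= RInt (fun y => exp (- (y ^ 2 / 2))) a (-1)).
    { apply RInt_ge_0; [lra|auto|]. intros; left; apply exp_pos. }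
    assert (P2 : 0 <= RInt (fun y => exp (- (y ^ 2 / 2))) 1 b).
    { apply RInt_ge_0; [lra|auto|]. intros; left; apply exp_pos. }
    rewrite -Hy'. rewrite -E2 -E1. clear -P1 P2. 
    revert P1 P2. generalize (RInt (fun y => exp (- (y ^ 2 / 2))) a (-1)) (RInt (fun y => exp (- (y ^ 2 / 2))) 1 b) c.
    clear. intros u v w. change (0 <= (u : R) -> 0 <= (v : R) -> (w : R) <= u + w + v).
    intros; lra. }
  intros E. rewrite E in Hle. simpl in Hle. lra.
Qed.

(** Write f = (y - a) h. Two transforms turn the multiplication by [y - a] into
    that by [- y - a], which vanishes at [- a]. *)
Lemma fourier_twice_vanish f a : schwartz f -> f a = RtoC 0 -> F (F f) (- a) = RtoC 0.
Proof.
  intros Hf Ha. destruct (hadamard f a Hf Ha) as [h [Hh E]].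
  assert (HFh := schwartz_fourier _ Hh).
  assert (E1 : F f = (fun eta => Ci * cderive (F h) eta + (- RtoC a) * F h eta)%C).
  { fext eta.
    rewrite (cder_cderive _ _ _ (cder_fourier h eta Hh)).
    rewrite E. rewrite -(fourier_comb Ci (- RtoC a)%C); auto using schwartz_mulx'.
    f_equal. fext y. unfold mulx.
    rewrite RtoC_minus. apply C_ext; unfold Re, Im; simpl; ring. }
  rewrite E1 fourier_comb; auto using schwartz_derive.
  rewrite fourier_cderive; auto. apply C_ext; unfold Re, Im; simpl; ring.
Qed.

(** Subtract from [f] the multiple of the Gaussian with the same value at [a] and
    use [fourier_twice_vanish]. *)
Lemma fourier_twice f a : schwartz f -> F (F f) (- a) = (gint * gint * f a)%C.
Proof.
  intros Hf.
  assert (Hg : gauss a <> RtoC 0).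
  { apply Cmod_gt_0. unfold gauss. rewrite Cmod_R Rabs_pos_eq; [apply exp_pos|left; apply exp_pos]. }
  set (b := (f a / gauss a)%C).
  assert (H : F (F (fun y => RtoC 1 * f y + (- b) * gauss y)%C) (- a) = RtoC 0).
  { apply fourier_twice_vanish.
    - apply schwartz_plus; apply schwartz_cmult; [assumption|apply schwartz_gauss].
    - unfold b. field. exact Hg. }
  replace (F (fun y => RtoC 1 * f y + - b * gauss y)%C)
    with (fun eta => RtoC 1 * F f eta + (- b) * F gauss eta)%C in H.
  2: { fext eta. rewrite fourier_comb; auto using schwartz_gauss. }
  rewrite fourier_comb in H; auto using schwartz_gauss, schwartz_fourier.
  replace (F (F gauss)) with (fun eta => gint * F gauss eta)%C in H.
  2: { rewrite -fourier_cmult; [|apply schwartz_gauss]. f_equal.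
       fext eta. symmetry. apply fourier_gauss. }
  rewrite fourier_gauss in H.
  assert (Hs : gauss (- a) = gauss a) by (unfold gauss; do 4 f_equal; ring).
  rewrite Hs in H. unfold b in H.
  replace (F (F f) (- a)) with (RtoC 1 * F (F f) (- a) + - (f a / gauss a) * (gint * (gint * gauss a))
     + gint * gint * f a)%C.
  - rewrite H. ring.
  - field. exact Hg.
Qed.

(** The double transform is the reflection times [gint ^ 2]; iterating four times
    gives the identity times [gint ^ 4], whence this inverse. *)
Definition fourier_inv (f : R -> C) : R -> C :=
  fun x => (/ (gint * gint * (gint * gint)) * F (F (F f)) x)%C.

Lemma fourier_inv_l f : schwartz f -> fourier_inv (F f) = f.
Proof.
  intros Hf. fext x. unfold fourier_inv.
  assert (H2 := schwartz_fourier _ (schwartz_fourier _ Hf)).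
  rewrite -{1}(Ropp_involutive x) fourier_twice; auto.
  rewrite fourier_twice; auto. field. apply gint_neq_0.
Qed.

Lemma fourier_inv_r f : schwartz f -> F (fourier_inv f) = f.
Proof.
  intros Hf. unfold fourier_inv.
  assert (H : schwartz (F (F (F f)))) by now do 3 apply schwartz_fourier.
  rewrite (fourier_cmult _ (F (F (F f))) H).
  exact (fourier_inv_l f Hf).
Qed.

Global Opaque fourier_fun fourier_inv.

Lemma sbounded_fourier_inv : sbounded (fun _ : unit => 2) (fun _ => fourier_inv).
Proof.
  Transparent fourier_inv. unfold fourier_inv. Opaque fourier_inv.
  assert (H := sbounded_comp _ _ _ two_le_two sbounded_fourier
    (sbounded_comp _ _ _ two_le_two sbounded_fourier sbounded_fourier)).
  exact (sbounded_cmult _ (/ (gint * gint * (gint * gint)))%C _ two_le_two H).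
Qed.

Lemma schwartz_fourier_inv f : schwartz f -> schwartz (fourier_inv f).
Proof. apply schwartz_of_sbounded, sbounded_fourier_inv. Qed.

Lemma fourier_inv_comb (a b : C) f g : schwartz f -> schwartz g ->
  fourier_inv (fun y => a * f y + b * g y)%C = (fun y => a * fourier_inv f y + b * fourier_inv g y)%C.
Proof.
  intros Hf Hg.
  rewrite -(fourier_inv_l (fun y => a * fourier_inv f y + b * fourier_inv g y)%C).
  - f_equal. fext y.
    rewrite fourier_comb; auto using schwartz_fourier_inv.
    f_equal; f_equal; symmetry.
    + exact (equal_f (fourier_inv_r f Hf) y).
    + exact (equal_f (fourier_inv_r g Hg) y).
  - apply schwartz_plus; apply schwartz_cmult; auto using schwartz_fourier_inv.
Qed.

Lemma fourier_inv_derive f : schwartz f ->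
  fourier_inv (cderive f) = mulx (fourier_inv f).
Proof.
  intros Hf.
  rewrite -(fourier_inv_l (mulx (fourier_inv f))); [|now apply schwartz_mulx', schwartz_fourier_inv].
  f_equal. apply cderive_fun. intros x. rewrite -{1}(fourier_inv_r f); auto.
  now apply cder_fourier, schwartz_fourier_inv.
Qed.

(** * Exponentials of symbols *)

Local Notation sym2 m := (symbol (fun _ : unit => 2) (fun _ => m)).

Lemma symbol_of_sym2 {P} (s : P -> R) (m : R -> C) :
  (forall p, 2 <= s p) -> sym2 m -> symbol s (fun _ => m).
Proof.
  intros Hs. apply (symbol_reparam (fun _ : unit => 2) s (fun _ => tt) (fun _ => m)).
  intros p; specialize (Hs p); lra.
Qed.

Lemma slow_of_symbol {P} (s : P -> R) m : symbol s m -> slow s m.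
Proof. intros H. exact (jet_base _ _ _ (H 0%nat)). Qed.

(** A function of slow growth solving f' = a f + b with symbol coefficients is a
    symbol: each derivative is obtained from lower ones. This covers exponentials
    and their Taylor remainders alike. *)
Lemma symbol_linear_ode {P} (s : P -> R) (a b f : P -> R -> C) : (forall p, 2 <= s p) ->
  symbol s a -> symbol s b -> slow s f ->
  (forall p x, cder (f p) x (a p x * f p x + b p x)%C) -> symbol s f.
Proof.
  intros Hs Ha Hb Hf Hd n. induction n as [|n IH]; split; auto.
  exists (fun p x => a p x * f p x + b p x)%C. split; [exact Hd|].
  apply jet_plus; [intros; now apply slow_plus| |apply Hb].
  apply jet_mult; auto.
  - intros; now apply slow_plus.
  - intros; now apply slow_mult.
Qed.

(** The derivative of 1/f is - f' (1/f)^2. *)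
Lemma jet_inv {P} (s : P -> R) n (f : P -> R -> C) : (forall p, 2 <= s p) ->
  (forall p x, f p x <> RtoC 0) -> slow s (fun p x => / f p x)%C ->
  jet (slow s) n f -> jet (slow s) n (fun p x => / f p x)%C.
Proof.
  intros Hs H0 Hi. induction n as [|n IH]; intros Hf; split; auto.
  assert (Hf0 := jet_S _ _ _ Hf). destruct Hf as [_ [f' [Hd Hf']]].
  exists (fun p x => (- (1)) * f' p x * (/ f p x * / f p x))%C. split.
  - intros p x. eapply cder_eq; [apply cder_inv; [apply H0|apply Hd]|].
    cbv beta. ring.
  - assert (Hp : forall g h, slow s g -> slow s h -> slow s (fun p x => g p x + h p x)%C)
      by (intros; now apply slow_plus).
    assert (Hm : forall g h, slow s g -> slow s h -> slow s (fun p x => g p x * h p x)%C)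
      by (intros; now apply slow_mult).
    apply (jet_mult _ n (fun p x => (- (1)) * f' p x)%C (fun p x => / f p x * / f p x)%C); auto.
    + apply (jet_mult _ n (fun _ _ => - (1))%C); auto. apply symbol_const, Hs.
    + apply (jet_mult _ n (fun p x => / f p x)%C); auto.
Qed.

Lemma symbol_inv {P} (s : P -> R) (f : P -> R -> C) : (forall p, 2 <= s p) ->
  (forall p x, f p x <> RtoC 0) -> slow s (fun p x => / f p x)%C ->
  symbol s f -> symbol s (fun p x => / f p x)%C.
Proof. intros Hs H0 Hi Hf n. now apply jet_inv. Qed.

Lemma symbol_param {P} (s tau : P -> R) : (forall p, 2 <= s p) ->
  (forall p, 0 <= tau p <= s p) -> symbol s (fun p _ => RtoC (tau p)).
Proof.
  intros Hs Ht n. apply (jet_cst _ n (fun p => RtoC (tau p))).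
  - exists 1%nat. intros p x. rewrite pow_1 Cmod_R Rabs_pos_eq; [|apply Ht].
    generalize (Ht p) (Hs p) (Rabs_pos x). nra.
  - now apply slow_const.
Qed.

Lemma cder_sym2 m x : sym2 m -> cder m x (cderive m x).
Proof. intros H. apply smooth_cder. exact (symbol_smooth _ _ tt H). Qed.

Lemma cder_exp_scaled (t : R) (Q : R -> C) x : sym2 Q ->
  cder (fun eta => cexp (RtoC t * Q eta)) x
    (RtoC t * cderive Q x * cexp (RtoC t * Q x))%C.
Proof. intros HQ. apply cder_cexp, cder_cmult, cder_sym2, HQ. Qed.

Lemma symbol_exp {P} (s tau : P -> R) (Q : R -> C) : (forall p, 2 <= s p) ->
  (forall p, 0 <= tau p <= s p) -> sym2 Q -> (forall eta, Re (Q eta) <= 0) ->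
  symbol s (fun p eta => cexp (RtoC (tau p) * Q eta))%C.
Proof.
  intros Hs Ht HQ HR.
  apply (symbol_linear_ode s (fun p eta => RtoC (tau p) * cderive Q eta)%C (fun _ _ => RtoC 0)); auto.
  - apply symbol_mult; [assumption|now apply symbol_param|].
    apply symbol_of_sym2; [assumption|]. exact (symbol_derive _ _ HQ).
  - now apply symbol_const.
  - apply slow_intro with (c := 1) (n := 0%nat); auto. intros p x. rewrite pow_O Rmult_1_r.
    apply Cmod_cexp_le. specialize (HR x). specialize (Ht p).
    apply Rle_trans with (tau p * Re (Q x)); [right; unfold Re, Im; simpl; ring|nra].
  - intros p x. eapply cder_eq; [now apply cder_exp_scaled|]. ring.
Qed.

Definition two_points := {xy : R * R | 0 <= fst xy /\ 0 <= snd xy /\ fst xy <> snd xy}.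
Definition pt1 (p : two_points) : R := fst (proj1_sig p).
Definition pt2 (p : two_points) : R := snd (proj1_sig p).
Definition tsize (p : two_points) : R := 2 + pt1 p + pt2 p.

Lemma tp_spec (p : two_points) : 0 <= pt1 p /\ 0 <= pt2 p /\ pt2 p - pt1 p <> 0.
Proof. destruct p as [[x y] [H1 [H2 H3]]]; unfold pt1, pt2; simpl in *. repeat split; lra. Qed.

Lemma tsize_ge2 p : 2 <= tsize p.
Proof. unfold tsize. generalize (tp_spec p). lra. Qed.

Definition exp_slope (Q : R -> C) (p : two_points) (eta : R) : C :=
  (/ RtoC (pt2 p - pt1 p) * (cexp (RtoC (pt2 p) * Q eta) - cexp (RtoC (pt1 p) * Q eta)))%C.

Definition exp_remainder (Q : R -> C) (p : two_points) (eta : R) : C :=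
  (/ RtoC (pt2 p - pt1 p) * / RtoC (pt2 p - pt1 p) *
   (cexp (RtoC (pt2 p) * Q eta) - cexp (RtoC (pt1 p) * Q eta)
     - RtoC (pt2 p - pt1 p) * (Q eta * cexp (RtoC (pt1 p) * Q eta))))%C.

Lemma RtoC_neq0 (x : R) : x <> 0 -> RtoC x <> RtoC 0.
Proof. intros H E. apply H. now apply RtoC_inj. Qed.

Lemma exp_taylor_sym2 (Q : R -> C) (p : two_points) eta : (forall eta, Re (Q eta) <= 0) ->
  Cmod (exp_slope Q p eta) <= 2 * Cmod (Q eta) /\
  Cmod (exp_remainder Q p eta) <= 4 * Cmod (Q eta) ^ 2.
Proof.
  intros HR. destruct (tp_spec p) as [H1 [H2 H3]]. specialize (HR eta).
  destruct (exp_taylor_bound (Q eta) (pt1 p) (pt2 p) ltac:(nra) ltac:(nra)) as [K1 K2].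
  assert (Hd := Rabs_pos_lt _ H3). set (d := Rabs (pt2 p - pt1 p)) in *.
  unfold exp_slope, exp_remainder.
  assert (Hi : Cmod (/ RtoC (pt2 p - pt1 p))%C = / d).
  { rewrite Cmod_inv; [|now apply RtoC_neq0]. now rewrite Cmod_R. }
  rewrite !Cmod_mult Hi. split.
  - apply Rmult_le_reg_l with d; [assumption|]. rewrite -Rmult_assoc Rinv_r; [|lra]. lra.
  - apply Rmult_le_reg_l with (d * d); [nra|].
    rewrite -Rmult_assoc. replace (d * d * (/ d * / d)) with 1 by (field; lra). nra.
Qed.

(** With slope G1, d/deta G1 = Q' (x G1 + exp(y Q)). *)
Lemma symbol_exp_slope (Q : R -> C) : sym2 Q -> (forall eta, Re (Q eta) <= 0) ->
  symbol tsize (exp_slope Q).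
Proof.
  intros HQ HR.
  assert (HQ' : symbol tsize (fun _ => cderive Q)).
  { apply symbol_of_sym2; [apply tsize_ge2|]. exact (symbol_derive _ _ HQ). }
  apply (symbol_linear_ode tsize (fun p eta => RtoC (pt1 p) * cderive Q eta)%C
    (fun p eta => cderive Q eta * cexp (RtoC (pt2 p) * Q eta))%C); [apply tsize_ge2| | | |].
  - apply symbol_mult; [apply tsize_ge2| |exact HQ'].
    apply symbol_param; [apply tsize_ge2|]. intros p; unfold tsize; generalize (tp_spec p); lra.
  - apply symbol_mult; [apply tsize_ge2|exact HQ'|].
    apply symbol_exp; auto; [apply tsize_ge2|].
    intros p; unfold tsize; generalize (tp_spec p); lra.
  - destruct (slow_of_symbol _ _ HQ) as [n Hn].
    apply slow_intro with (c := 2) (n := n); [apply tsize_ge2|]. intros p x.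
    eapply Rle_trans; [now apply exp_taylor_sym2|]. apply Rmult_le_compat_l; [lra|].
    eapply Rle_trans; [apply (Hn tt)|]. apply pow_incr.
    generalize (tsize_ge2 p) (Rabs_pos x). nra.
  - intros p x. unfold exp_slope. eapply cder_eq.
    + apply cder_cmult, cder_minus; now apply cder_exp_scaled.
    + destruct (tp_spec p) as [_ [_ H3]]. rewrite RtoC_minus.
      field. rewrite -RtoC_minus. now apply RtoC_neq0.
Qed.

(** With remainder G and slope G1, d/deta G = Q' (x G + G1). *)
Lemma symbol_exp_remainder (Q : R -> C) : sym2 Q -> (forall eta, Re (Q eta) <= 0) ->
  symbol tsize (exp_remainder Q).
Proof.
  intros HQ HR.
  assert (HQ' : symbol tsize (fun _ => cderive Q)).
  { apply symbol_of_sym2; [apply tsize_ge2|]. exact (symbol_derive _ _ HQ). }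
  apply (symbol_linear_ode tsize (fun p eta => RtoC (pt1 p) * cderive Q eta)%C
    (fun p eta => cderive Q eta * exp_slope Q p eta)%C); [apply tsize_ge2| | | |].
  - apply symbol_mult; [apply tsize_ge2| |exact HQ'].
    apply symbol_param; [apply tsize_ge2|]. intros p; unfold tsize; generalize (tp_spec p); lra.
  - apply symbol_mult; [apply tsize_ge2|exact HQ'|]. now apply symbol_exp_slope.
  - destruct (slow_of_symbol _ _ HQ) as [n Hn].
    apply slow_intro with (c := 4) (n := (n * 2)%nat); [apply tsize_ge2|]. intros p x.
    eapply Rle_trans; [now apply exp_taylor_sym2|]. apply Rmult_le_compat_l; [lra|].
    rewrite pow_mult. apply pow_incr. split; [apply Cmod_ge_0|].
    eapply Rle_trans; [apply (Hn tt)|]. apply pow_incr.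
    generalize (tsize_ge2 p) (Rabs_pos x). nra.
  - intros p x. unfold exp_remainder. eapply cder_eq.
    + apply cder_cmult, cder_minus; [apply cder_minus; now apply cder_exp_scaled|].
      apply cder_cmult, cder_mult; [now apply cder_sym2|now apply cder_exp_scaled].
    + unfold exp_slope. destruct (tp_spec p) as [_ [_ H3]]. rewrite RtoC_minus.
      field. rewrite -RtoC_minus. now apply RtoC_neq0.
Qed.

(** Decay in time is bought with growth in frequency: writing
    u = t c / (1 + |eta|), t^M exp(- u) equals u^M exp(- u) ((1 + |eta|) / c)^M. The
    family in [M] is closed under derivation, with derivative Q' times the member
    of index [M + 1], and all bounds are uniform in [t]. *)
Lemma symbol_exp_decay (Q : R -> C) (c : R) (M : nat) : sym2 Q -> 0 < c ->
  (forall eta, Re (Q eta) <= - (c / (1 + Rabs eta))) ->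
  symbol (fun _ : nonnegreal => 2)
    (fun t eta => RtoC (t ^ M) * cexp (RtoC t * Q eta))%C.
Proof.
  intros HQ Hc HR.
  assert (Hs : forall M, slow (fun _ : nonnegreal => 2)
    (fun t eta => RtoC (t ^ M) * cexp (RtoC t * Q eta))%C).
  { clear M. intros M. destruct (pow_exp_bound M) as [K HK].
    apply slow_intro with (c := K * (/ c) ^ M) (n := M); [intros; lra|].
    intros t x. rewrite Cmod_mult Cmod_R Cmod_cexp.
    assert (Ht := cond_nonneg t). assert (Hx := Rabs_pos x).
    rewrite Rabs_pos_eq; [|now apply pow_le].
    set (u := t * c * / (1 + Rabs x)).
    assert (Hi : 0 < / (1 + Rabs x)) by (apply Rinv_0_lt_compat; lra).
    assert (Hu : 0 <= u) by (unfold u; apply Rmult_le_pos; [apply Rmult_le_pos|]; lra).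
    assert (E : t ^ M = u ^ M * ((/ c) ^ M * (1 + Rabs x) ^ M)).
    { rewrite -!Rpow_mult_distr. f_equal. unfold u. field. lra. }
    assert (L : exp (Re (RtoC t * Q x)) <= exp (- u)).
    { assert (L : Re (RtoC t * Q x) <= - u).
      { replace (Re (RtoC t * Q x)) with (t * Re (Q x)) by (unfold Re, Im; simpl; ring).
        apply Rle_trans with (t * - (c / (1 + Rabs x))); [now apply Rmult_le_compat_l|].
        unfold u. right. field. lra. }
      destruct L as [L| ->]; [left; now apply exp_increasing|lra]. }
    apply Rle_trans with (t ^ M * exp (- u)); [apply Rmult_le_compat_l; [now apply pow_le|exact L]|].
    assert (0 < / c) by now apply Rinv_0_lt_compat.
    rewrite E. apply Rle_trans with (u ^ M * exp (- u) * ((/ c) ^ M * (1 + Rabs x) ^ M)); [right; ring|].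
    apply Rle_trans with (K * ((/ c) ^ M * (1 + Rabs x) ^ M)).
    - apply Rmult_le_compat_r; [|now apply HK].
      apply Rmult_le_pos; apply pow_le; lra.
    - rewrite -Rmult_assoc. apply Rmult_le_compat_l.
      + apply Rmult_le_pos; [|apply pow_le; lra].
        apply Rle_trans with (u ^ M * exp (- u)); [|now apply HK].
        apply Rmult_le_pos; [now apply pow_le|left; apply exp_pos].
      + apply pow_incr. lra. }
  intros n. revert M. induction n as [|n IH]; intros M; split; auto.
  exists (fun (t : nonnegreal) eta =>
    cderive Q eta * (RtoC (t ^ S M) * cexp (RtoC t * Q eta)))%C.
  split.
  - intros t x. eapply cder_eq; [apply cder_cmult; now apply cder_exp_scaled|].
    simpl pow. rewrite RtoC_mult. ring.
  - apply (jet_mult _ n (fun _ => cderive Q)).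
    + intros; apply slow_plus; auto. intros; lra.
    + intros; now apply slow_mult.
    + apply (symbol_of_sym2 (fun _ : nonnegreal => 2)); [intros; lra|].
      exact (symbol_derive _ _ HQ).
    + apply IH.
Qed.

(** * Square roots of affine functions *)

Definition affine_root (A B b eta : R) : C := csqrt (A + B * eta, b).

Lemma affine_root_sqr A B b eta :
  (affine_root A B b eta * affine_root A B b eta)%C = (A + B * eta, b).
Proof. apply csqrt_sqr. Qed.

Lemma affine_root_Re A B b eta : 0 < b -> 0 < Re (affine_root A B b eta).
Proof. intros Hb. apply csqrt_Re_pos. simpl. lra. Qed.

Lemma affine_root_Im A B b eta :
  2 * (Re (affine_root A B b eta) * Im (affine_root A B b eta)) = b.
Proof.
  generalize (affine_root_sqr A B b eta). generalize (affine_root A B b eta). intros z E.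
  apply (f_equal Im) in E. simpl in E.
  unfold Re, Im. nra.
Qed.

Lemma affine_root_neq0 A B b eta : 0 < b -> affine_root A B b eta <> RtoC 0.
Proof. intros Hb E. generalize (affine_root_Re A B b eta Hb). rewrite E. simpl. lra. Qed.

(** The explicit formula for the real part gives differentiability, the imaginary
    part being [b / (2 Re)]; the value follows by differentiating the square. *)
Lemma cder_affine_root A B b eta : 0 < b ->
  cder (affine_root A B b) eta (RtoC (B / 2) * / affine_root A B b eta)%C.
Proof.
  intros Hb.
  assert (H1 : ex_derive (fun t => Re (affine_root A B b t)) eta).
  { simpl. unfold Cmod. simpl. auto_derive.
    set (w := A + B * eta).
    assert (Hp : 0 < w * (w * 1) + b * (b * 1)) by (generalize (Rle_0_sqr w); unfold Rsqr; nra).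
    repeat split; auto.
    assert (Hs := sqrt_sqrt _ (Rlt_le _ _ Hp)).
    assert (Hs0 := sqrt_pos (w * (w * 1) + b * (b * 1))).
    set (q := sqrt _) in *.
    assert (0 < q + w); [|lra].
    destruct (Rlt_dec 0 (q + w)); [assumption|exfalso]. nra. }
  assert (H2 : ex_derive (fun t => Im (affine_root A B b t)) eta).
  { apply (ex_derive_ext (fun t => b / (2 * Re (affine_root A B b t)))).
    - intros t. assert (Hr := affine_root_Re A B b t Hb).
      rewrite -{1}(affine_root_Im A B b t). lazymatch goal with |- ?x = ?y => change (@eq R x y) end. field. lra.
    - assert (K : forall (u : R -> R) (x : R), 0 < u x -> ex_derive u x ->
        ex_derive (fun t => b / (2 * u t)) x).
      { intros u x Hu Hx. auto_derive. repeat split; [assumption|lra]. }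
      apply (K (fun t => Re (affine_root A B b t))); [now apply affine_root_Re|exact H1]. }
  set (l := (Derive (fun t => Re (affine_root A B b t)) eta,
             Derive (fun t => Im (affine_root A B b t)) eta) : C).
  assert (Hl : cder (affine_root A B b) eta l) by (split; apply Derive_correct; assumption).
  assert (Hn := affine_root_neq0 A B b eta Hb).
  eapply cder_eq; [exact Hl|].
  assert (K : (l * affine_root A B b eta + affine_root A B b eta * l)%C = RtoC B).
  { eapply cder_unique.
    - apply (cder_mult (affine_root A B b) (affine_root A B b)); exact Hl.
    - replace (fun t => affine_root A B b t * affine_root A B b t)%C
        with (fun t => (A + B * t, b) : C).
      + split; simpl; auto_derive; auto; ring.
      + fext t. symmetry. apply affine_root_sqr. }
  replace (RtoC (B / 2)) with (RtoC B * / RtoC 2)%C.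
  - rewrite -K. field. exact Hn.
  - unfold Rdiv. now rewrite RtoC_mult RtoC_inv.
Qed.

Lemma affine_root_Cmod2 A B b eta : Cmod (affine_root A B b eta) ^ 2 = Cmod (A + B * eta, b).
Proof. rewrite -affine_root_sqr Cmod_mult. ring. Qed.

Lemma affine_root_lower A B b eta : 0 < b -> b <= Cmod (affine_root A B b eta) ^ 2.
Proof.
  intros Hb. rewrite affine_root_Cmod2. eapply Rle_trans; [|apply im_le_Cmod].
  simpl. apply Rle_abs.
Qed.

Lemma affine_root_upper A B b eta : 0 < b ->
  Cmod (affine_root A B b eta) <= (1 + Rabs A + Rabs B + b) * (1 + Rabs eta).
Proof.
  intros Hb. set (m := Cmod _).
  assert (Hm : m ^ 2 <= Rabs A + Rabs B * Rabs eta + b).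
  { unfold m. rewrite affine_root_Cmod2. eapply Rle_trans; [apply Cmod_le_sum|]. simpl.
    rewrite (Rabs_pos_eq b); [|lra]. apply Rplus_le_compat_r.
    rewrite -Rabs_mult. apply Rabs_triang. }
  assert (m <= 1 + m ^ 2) by nra.
  assert (Ha := Rabs_pos A). assert (He := Rabs_pos eta). assert (HB := Rabs_pos B).
  assert (0 <= Rabs A * Rabs eta) by now apply Rmult_le_pos.
  assert (0 <= b * Rabs eta) by (apply Rmult_le_pos; lra). lra.
Qed.

(** The derivative is a multiple of 1 / root, which has slow growth because the
    modulus of the root is bounded below: the imaginary part [b] of the radicand
    does not vanish. *)
Lemma symbol_affine_root A B b : 0 < b -> sym2 (affine_root A B b).
Proof.
  intros Hb. assert (Hs : slow (fun _ : unit => 2) (fun _ => affine_root A B b)).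
  { apply slow_intro with (c := 1 + Rabs A + Rabs B + b) (n := 1%nat); [intros; lra|].
    intros _ x. eapply Rle_trans; [now apply affine_root_upper|].
    generalize (Rabs_pos A) (Rabs_pos B) (Rabs_pos x). intros. nra. }
  assert (Hi : slow (fun _ : unit => 2) (fun _ x => / affine_root A B b x)%C).
  { apply slow_intro with (c := 1 + / b) (n := 0%nat); [intros; lra|].
    intros _ x. rewrite pow_O Rmult_1_r Cmod_inv; [|now apply affine_root_neq0].
    assert (L := affine_root_lower A B b x Hb).
    assert (P : 0 < Cmod (affine_root A B b x)) by now apply Cmod_gt_0, affine_root_neq0.
    set (m := Cmod _) in *.
    assert (Hib : 0 < / b) by now apply Rinv_0_lt_compat.
    assert (Him : 0 < / m) by now apply Rinv_0_lt_compat.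
    assert (L2 : (/ m) ^ 2 <= / b).
    { rewrite pow_inv. apply Rinv_le_contravar; assumption. }
    nra. }
  intros n. induction n as [|n IH]; split; auto.
  exists (fun _ x => RtoC (B / 2) * / affine_root A B b x)%C. split.
  - intros _ x. now apply cder_affine_root.
  - apply (jet_mult _ n (fun _ _ => RtoC (B / 2))).
    + intros; apply slow_plus; auto. intros; lra.
    + intros; now apply slow_mult.
    + apply symbol_const, two_le_two.
    + apply (jet_inv _ n (fun _ => affine_root A B b)); auto using two_le_two.
      intros; now apply affine_root_neq0.
Qed.

Lemma symbol_inv_one_plus_affine_root A B b : 0 < b ->
  sym2 (fun x => / (1 + affine_root A B b x))%C.
Proof.
  intros Hb.
  assert (L : forall x, 1 <= Cmod (1 + affine_root A B b x)).
  { intros x. eapply Rle_trans; [|apply re_le_Cmod].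
    assert (P := affine_root_Re A B b x Hb).
    change (Re (1 + affine_root A B b x)) with (1 + Re (affine_root A B b x)).
    rewrite Rabs_pos_eq; lra. }
  assert (N : forall x, (1 + affine_root A B b x)%C <> RtoC 0).
  { intros x. apply Cmod_gt_0. specialize (L x). lra. }
  apply (symbol_inv _ (fun _ x => 1 + affine_root A B b x)%C); auto using two_le_two.
  - apply slow_intro with (c := 1) (n := 0%nat); [intros; lra|]. intros _ x.
    rewrite pow_O Rmult_1_r Cmod_inv; auto. rewrite -{2}Rinv_1. apply Rinv_le_contravar; [lra|apply L].
  - apply (symbol_plus _ (fun _ _ => RtoC 1)); [apply two_le_two| |now apply symbol_affine_root].
    apply symbol_const, two_le_two.
Qed.

(** Twice the product of the real and imaginary parts is [b], and the real part
    grows at most linearly. *)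
Lemma affine_root_Im_lower A B b : 0 < b -> exists c, 0 < c /\
  forall eta, c / (1 + Rabs eta) <= Im (affine_root A B b eta).
Proof.
  intros Hb. set (K := 1 + Rabs A + Rabs B + b).
  assert (HK : 0 < K). { unfold K. generalize (Rabs_pos A) (Rabs_pos B). lra. }
  exists (b / (2 * K)). split; [apply Rdiv_lt_0_compat; lra|]. intros eta.
  assert (P := affine_root_Re A B b eta Hb). assert (E := affine_root_Im A B b eta).
  assert (U := affine_root_upper A B b eta Hb). fold K in U.
  assert (U' := re_le_Cmod (affine_root A B b eta)). rewrite Rabs_pos_eq in U'; [|lra].
  set (u := Re _) in *. set (v := Im _) in *. assert (Hx := Rabs_pos eta).
  assert (0 < v) by nra.
  apply Rmult_le_reg_r with (2 * K * (1 + Rabs eta)); [apply Rmult_lt_0_compat; lra|].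
  replace (b / (2 * K) / (1 + Rabs eta) * (2 * K * (1 + Rabs eta))) with b by (field; lra).
  rewrite -E. apply Rle_trans with (2 * ((K * (1 + Rabs eta)) * v)); [|right; ring].
  apply Rmult_le_compat_l; [lra|]. apply Rmult_le_compat_r; lra.
Qed.

(** * Evolution families of distributions *)

Lemma lin_plus (T : dist) f h : dist_linear T -> schwartz f -> schwartz h ->
  T (fun y => f y + h y)%C = (T f + T h)%C.
Proof.
  intros HT Hf Hh. generalize (HT (RtoC 1) (RtoC 1) f h Hf Hh). rewrite !Cmult_1_l. intros <-.
  f_equal. fext y. ring.
Qed.

Lemma lin_cmult (T : dist) (c : C) f : dist_linear T -> schwartz f ->
  T (fun y => c * f y)%C = (c * T f)%C.
Proof.
  intros HT Hf. generalize (HT c (RtoC 0) f f Hf Hf). rewrite Cmult_0_l Cplus_0_r. intros <-.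
  f_equal. fext y. ring.
Qed.

Lemma lin_zero (T : dist) f : dist_linear T -> schwartz f -> T (fun y => RtoC 0 * f y)%C = RtoC 0.
Proof. intros HT Hf. rewrite lin_cmult; auto. ring. Qed.

Lemma dist_linear_comp (T : dist) (A : (R -> C) -> R -> C) :
  dist_linear T -> (forall f, schwartz f -> schwartz (A f)) ->
  (forall a b f h, schwartz f -> schwartz h ->
     A (fun y => a * f y + b * h y)%C = (fun y => a * A f y + b * A h y)%C) ->
  dist_linear (fun f => T (A f)).
Proof. intros HT HA Hl a b f h Hf Hh. rewrite Hl; auto. Qed.

Lemma dist_linear_symbol (T : dist) (m : R -> C) : dist_linear T ->
  (forall f, schwartz f -> schwartz (fun y => m y * f y)%C) ->
  dist_linear (fun f => T (fun y => m y * f y)%C).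
Proof.
  intros HT Hm. apply (dist_linear_comp T (fun f y => m y * f y)%C); auto.
  intros; fext y. ring.
Qed.

Definition family_on (S : R -> Prop) (T : R -> dist) : Prop :=
  (forall x, S x -> dist_linear (T x)) /\
  exists n, forall x f, S x -> schwartz f ->
    Cmod (T x f) <= (2 + Rabs x) ^ n * schwartz_norm n f.

(** The weak form of the equation T' = a T. *)
Definition evolves (S : R -> Prop) (T : R -> dist) (a : R -> C) : Prop :=
  forall x f, S x -> schwartz f ->
    wder S (fun y => T y f) x (T x (fun eta => a eta * f eta)%C).

Lemma wder_subset (S S' : R -> Prop) f x l :
  (forall y, S' y -> S y) -> wder S f x l -> wder S' f x l.
Proof.
  intros HS H e He. destruct (H e He) as [d [Hd K]]. exists d. split; [assumption|].
  intros y Hy. now apply K, HS.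
Qed.

Lemma family_on_subset (S S' : R -> Prop) T :
  (forall y, S' y -> S y) -> family_on S T -> family_on S' T.
Proof.
  intros HS [H1 [n H2]]. split; [auto|]. exists n. auto.
Qed.

Lemma evolves_subset (S S' : R -> Prop) T a :
  (forall y, S' y -> S y) -> evolves S T a -> evolves S' T a.
Proof. intros HS H x f Hx Hf. apply (wder_subset S); auto. Qed.

Lemma schwartz_exp (Q : R -> C) (t : R) f : sym2 Q -> (forall eta, Re (Q eta) <= 0) -> 0 <= t ->
  schwartz f -> schwartz (fun eta => cexp (RtoC t * Q eta) * f eta)%C.
Proof.
  intros HQ HR Ht Hf.
  assert (H : sbounded (fun p : nonnegreal => 2 + p)
    (fun p f eta => cexp (RtoC p * Q eta) * f eta)%C).
  { apply (sbounded_symbol _ (fun (p : nonnegreal) eta => cexp (RtoC p * Q eta))%C).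
    - intros p; generalize (cond_nonneg p); lra.
    - apply (symbol_exp (fun p : nonnegreal => 2 + p) nonneg); auto;
      intros p; generalize (cond_nonneg p); lra. }
  exact (proj1 H (mknonnegreal t Ht) f Hf).
Qed.

(** Product rule for the pairing of an evolving distribution with the evolving
    test function exp(tau Q) f. The test function is expanded to second order; the
    remainder is bounded by [symbol_exp_remainder], and the first order term
    converges because T y applied to a fixed Schwartz function is continuous
    in [y]. *)
Lemma pairing_derivative (S : R -> Prop) (T : R -> dist) (a Q : R -> C) (t0 sg x : R) f :
  family_on S T -> evolves S T a -> sym2 a -> sym2 Q -> (forall eta, Re (Q eta) <= 0) ->
  sg * sg = 1 -> (forall y, S y -> 0 <= t0 + sg * y) -> S x -> schwartz f ->
  wder S (fun y => T y (fun eta => cexp (RtoC (t0 + sg * y) * Q eta) * f eta)%C) x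
    (T x (fun eta => (a eta + RtoC sg * Q eta) * (cexp (RtoC (t0 + sg * x) * Q eta) * f eta))%C).
Proof.
  intros [Hlin [n Hn]] Hev Ha HQ HR Hsg Htau Hx Hf.
  set (tau := fun y => t0 + sg * y) in *.
  set (m := fun y eta => (cexp (RtoC (tau y) * Q eta) * f eta)%C).
  assert (Hm : forall y, S y -> schwartz (m y)) by (intros y Hy; apply schwartz_exp; auto; now apply Htau).
  assert (Hmx := Hm x Hx).
  assert (HQm : schwartz (fun eta => Q eta * m x eta)%C) by now apply schwartz_symbol.
  assert (Ham : schwartz (fun eta => a eta * m x eta)%C) by now apply schwartz_symbol.
  assert (HG := sbounded_symbol tsize _ tsize_ge2 (symbol_exp_remainder Q HQ HR)).
  destruct HG as [HG1 HG2]. destruct (HG2 n) as [k Hk].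
  set (K := (3 + Rabs x) ^ n * ((3 + 2 * tau x) ^ k * schwartz_norm k f)).
  assert (HK0 : 0 <= K).
  { unfold K. apply Rmult_le_pos; [apply pow_le; generalize (Rabs_pos x); lra|].
    apply Rmult_le_pos; [apply pow_le; generalize (Htau x Hx); unfold tau; lra|].
    now apply schwartz_norm_pos. }
  (* The expansion is paired with T y rather than T x, which has the bound
     [Hn] uniformly for y near x. *)
  assert (Hexp : forall y, S y -> Rabs (y - x) <= 1 ->
     Cmod (T y (m y) - T y (m x) - RtoC (sg * (y - x)) * T y (fun eta => Q eta * m x eta))%C
       <= K * Rabs (y - x) ^ 2).
  { intros y Hy Hyx. destruct (Req_dec y x) as [->|Hne].
    { rewrite Rminus_diag Rmult_0_r. replace (_ - _ - _)%C with (RtoC 0) by ring.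
      rewrite Cmod_0. apply Rmult_le_pos; [assumption|apply pow2_ge_0]. }
    assert (Hd : tau y - tau x = sg * (y - x)) by (unfold tau; ring).
    assert (Hd' : Rabs (tau y - tau x) = Rabs (y - x)).
    { rewrite Hd Rabs_mult. replace (Rabs sg) with 1; [ring|].
      assert (E : Rabs sg * Rabs sg = 1) by (rewrite -Rabs_mult Hsg; apply Rabs_R1).
      generalize (Rabs_pos sg). nra. }
    assert (Hp : 0 <= fst (tau x, tau y) /\ 0 <= snd (tau x, tau y) /\ fst (tau x, tau y) <> snd (tau x, tau y)).
    { simpl. split; [now apply Htau|split; [now apply Htau|]].
      intros E. rewrite E Rminus_diag Rabs_R0 in Hd'.
      assert (0 < Rabs (y - x)) by (apply Rabs_pos_lt; lra). lra. }
    set (p := exist _ (tau x, tau y) Hp : two_points).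
    set (G := fun eta => (exp_remainder Q p eta * f eta)%C).
    assert (HGs : schwartz G) by now apply (HG1 p f).
    assert (E : m y = (fun eta => m x eta + (RtoC (sg * (y - x)) * (Q eta * m x eta)
       + RtoC ((y - x) ^ 2) * G eta))%C).
    { fext eta. unfold m, G, exp_remainder.
      change (pt1 p) with (tau x). change (pt2 p) with (tau y).
      assert (H0 : RtoC (tau y - tau x) <> RtoC 0).
      { apply RtoC_neq0. intros E. simpl in Hp. lra. }
      replace (RtoC ((y - x) ^ 2)) with (RtoC (tau y - tau x) * RtoC (tau y - tau x))%C.
      - rewrite -Hd. field. exact H0.
      - rewrite -RtoC_mult Hd. f_equal. replace (sg * (y - x) * (sg * (y - x)))
          with ((sg * sg) * (y - x) ^ 2) by ring. rewrite Hsg. ring. }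
    assert (HTy := Hlin y Hy).
    rewrite E (lin_plus _ (m x)); auto.
    2: { apply schwartz_plus; now apply schwartz_cmult. }
    rewrite (lin_plus _ (fun eta => RtoC (sg * (y - x)) * (Q eta * m x eta))%C
      (fun eta => RtoC ((y - x) ^ 2) * G eta)%C); auto using schwartz_cmult.
    rewrite !lin_cmult; auto.
    replace (_ - _ - _)%C with (RtoC ((y - x) ^ 2) * T y G)%C by ring.
    rewrite Cmod_mult Cmod_R RPow_abs Rmult_comm.
    apply Rmult_le_compat_r; [apply Rabs_pos|].
    eapply Rle_trans; [now apply Hn|]. unfold K.
    assert (Hy1 : Rabs y <= Rabs x + 1).
    { replace y with (x + (y - x)) by ring. eapply Rle_trans; [apply Rabs_triang|]. lra. }
    apply Rmult_le_compat.
    - apply pow_le. generalize (Rabs_pos y). lra.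
    - now apply schwartz_norm_pos.
    - apply pow_incr. generalize (Rabs_pos y). lra.
    - eapply Rle_trans; [now apply (Hk p f)|].
      apply Rmult_le_compat_r; [now apply schwartz_norm_pos|].
      apply pow_incr. unfold tsize. change (pt1 p) with (tau x). change (pt2 p) with (tau y).
      simpl in Hp. assert (tau y - tau x <= 1).
      { eapply Rle_trans; [apply Rle_abs|]. lra. }
      lra. }
  rewrite (_ : (fun eta => (a eta + RtoC sg * Q eta) * (cexp (RtoC (tau x) * Q eta) * f eta))%C
    = (fun eta => a eta * m x eta + RtoC sg * (Q eta * m x eta))%C).
  2: { fext eta. unfold m. ring. }
  rewrite lin_plus; auto; [|now apply schwartz_cmult]. rewrite lin_cmult; auto.
  assert (E1 := Hev x (m x) Hx Hmx). assert (E2 := wder_cont _ _ _ _ (Hev x _ Hx HQm)).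
  intros e He.
  destruct (E1 (e / 3)) as [d1 [Hd1 K1]]; [lra|].
  destruct (E2 (e / 3)) as [d2 [Hd2 K2]]; [lra|].
  assert (Hd3 : 0 < e / 3 / (K + 1)) by (apply Rdiv_lt_0_compat; lra).
  exists (Rmin (Rmin d1 d2) (Rmin 1 (e / 3 / (K + 1)))).
  split; [repeat apply Rmin_pos; lra|].
  intros y Hy Hyx.
  assert (Y1 : Rabs (y - x) < d1).
  { eapply Rlt_le_trans; [exact Hyx|]. eapply Rle_trans; [apply Rmin_l|apply Rmin_l]. }
  assert (Y2 : Rabs (y - x) < d2).
  { eapply Rlt_le_trans; [exact Hyx|]. eapply Rle_trans; [apply Rmin_l|apply Rmin_r]. }
  assert (Y3 : Rabs (y - x) < 1).
  { eapply Rlt_le_trans; [exact Hyx|]. eapply Rle_trans; [apply Rmin_r|apply Rmin_l]. }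
  assert (Y4 : Rabs (y - x) < e / 3 / (K + 1)).
  { eapply Rlt_le_trans; [exact Hyx|]. eapply Rle_trans; [apply Rmin_r|apply Rmin_r]. }
  specialize (K1 y Hy Y1). specialize (K2 y Hy Y2). specialize (Hexp y Hy (Rlt_le _ _ Y3)).
  cbv beta in K1, K2.
  change (Cmod (T y (m y) - T x (m x) - RtoC (y - x) * (T x (fun eta => a eta * m x eta)
    + RtoC sg * T x (fun eta => Q eta * m x eta)))%C <= e * Rabs (y - x)).
  set (A := T y (m y)) in *. set (B := T y (m x)) in *. set (D := T x (m x)) in *.
  set (Q1 := T y (fun eta => Q eta * m x eta)%C) in *. set (Q0 := T x (fun eta => Q eta * m x eta)%C) in *.
  set (A0 := T x (fun eta => a eta * m x eta)%C) in *.
  replace (A - D - RtoC (y - x) * (A0 + RtoC sg * Q0))%C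
    with ((B - D - RtoC (y - x) * A0) + RtoC (sg * (y - x)) * (Q1 - Q0)
       + (A - B - RtoC (sg * (y - x)) * Q1))%C by (rewrite RtoC_mult; ring).
  eapply Rle_trans; [apply Cmod_triangle|].
  eapply Rle_trans; [apply Rplus_le_compat_r, Cmod_triangle|].
  rewrite Cmod_mult Cmod_R Rabs_mult.
  assert (Rabs sg = 1).
  { assert (E : Rabs sg * Rabs sg = 1) by (rewrite -Rabs_mult Hsg; apply Rabs_R1).
    generalize (Rabs_pos sg). nra. }
  assert (P := Rabs_pos (y - x)).
  assert (K3 : K * Rabs (y - x) ^ 2 <= e / 3 * Rabs (y - x)).
  { apply Rmult_lt_compat_r with (r := K + 1) in Y4; [|lra].
    replace (e / 3 / (K + 1) * (K + 1)) with (e / 3) in Y4 by (field; lra).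
    replace (K * Rabs (y - x) ^ 2) with (K * Rabs (y - x) * Rabs (y - x)) by ring.
    apply Rmult_le_compat_r; [assumption|]. nra. }
  assert (K4 : Rabs sg * Rabs (y - x) * Cmod (Q1 - Q0)%C <= e / 3 * Rabs (y - x)).
  { rewrite H Rmult_1_l Rmult_comm. apply Rmult_le_compat_r; lra. }
  lra.
Qed.

(** When the generators cancel, the pairing is constant. *)
Lemma transport (S : R -> Prop) (T : R -> dist) (a Q : R -> C) (t0 sg x0 x1 : R) f :
  family_on S T -> evolves S T a -> sym2 a -> sym2 Q -> (forall eta, Re (Q eta) <= 0) ->
  sg * sg = 1 -> (forall eta, a eta + RtoC sg * Q eta = 0)%C -> x0 <= x1 ->
  (forall y, x0 <= y <= x1 -> S y /\ 0 <= t0 + sg * y) -> schwartz f ->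
  T x1 (fun eta => cexp (RtoC (t0 + sg * x1) * Q eta) * f eta)%C
  = T x0 (fun eta => cexp (RtoC (t0 + sg * x0) * Q eta) * f eta)%C.
Proof.
  intros HT Hev Ha HQ HR Hsg H0 Hx HS Hf.
  apply (wder_zero_constant
    (fun y => T y (fun eta => cexp (RtoC (t0 + sg * y) * Q eta) * f eta)%C)); [assumption|].
  intros x Hxx.
  assert (HSS : forall y, x0 <= y <= x1 -> S y) by (intros; now apply HS).
  assert (K := pairing_derivative (fun y => x0 <= y <= x1) T a Q t0 sg x f
    (family_on_subset _ _ _ HSS HT) (evolves_subset _ _ _ _ HSS Hev) Ha HQ HR Hsg
    (fun y Hy => proj2 (HS y Hy)) Hxx Hf).
  refine (wder_ext _ _ _ _ _ _ Hxx (fun _ _ => eq_refl) _ K).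
  assert (Hm : schwartz (fun eta => cexp (RtoC (t0 + sg * x) * Q eta) * f eta)%C).
  { apply schwartz_exp; auto. apply HS; assumption. }
  rewrite -(lin_zero (T x) _ (proj1 HT x (HSS _ Hxx)) Hm).
  f_equal. fext eta. now rewrite H0.
Qed.

(** Test [T] at time [x0 + t] with exp(- t a) f: by [transport] the pairing equals
    T x0 f, while the test function decays like any power of [t] in every
    seminorm and [T] grows only polynomially. *)
Lemma growing_evolution_zero (T : R -> dist) (a : R -> C) (c : R) :
  family_on (fun x => 0 <= x) T -> evolves (fun x => 0 <= x) T a -> sym2 a -> 0 < c ->
  (forall eta, c / (1 + Rabs eta) <= Re (a eta)) ->
  forall x f, 0 <= x -> schwartz f -> T x f = RtoC 0.
Proof.
  intros HT Hev Ha Hc HR x0 f Hx0 Hf.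
  set (Q := fun eta => (- (1) * a eta)%C).
  assert (HQ : sym2 Q) by (apply (symbol_cmult _ _ (fun _ => a)); [apply two_le_two|exact Ha]).
  assert (HQR : forall eta, Re (Q eta) <= - (c / (1 + Rabs eta))).
  { intros eta. unfold Q. specialize (HR eta).
    replace (Re (- (1) * a eta)%C) with (- Re (a eta)) by (unfold Re, Im; simpl; ring). lra. }
  assert (HQ0 : forall eta, Re (Q eta) <= 0).
  { intros eta. eapply Rle_trans; [apply HQR|].
    assert (0 < c / (1 + Rabs eta)) by (apply Rdiv_lt_0_compat; generalize (Rabs_pos eta); lra). lra. }
  destruct (proj2 HT) as [n Hn].
  assert (HD := sbounded_symbol _ _ (fun _ => Rle_refl 2)
     (symbol_exp_decay Q c (S n) HQ Hc HQR)).
  destruct HD as [HD1 HD2]. destruct (HD2 n) as [k Hk].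
  set (K := 2 ^ k * schwartz_norm k f).
  assert (HK : 0 <= K) by (apply Rmult_le_pos; [apply pow_le; lra|now apply schwartz_norm_pos]).
  assert (B : forall t, 0 <= t -> t ^ S n * Cmod (T x0 f) <= (2 + x0 + t) ^ n * K).
  { intros t Ht.
    assert (E := transport _ T a Q (- x0) 1 x0 (x0 + t) f HT Hev Ha HQ HQ0 ltac:(ring)
      ltac:(intros; unfold Q; ring) ltac:(lra) ltac:(intros; lra) Hf).
    replace (- x0 + 1 * x0) with 0 in E by ring.
    replace (- x0 + 1 * (x0 + t)) with t in E by ring.
    replace (fun eta => cexp (RtoC 0 * Q eta) * f eta)%C with f in E.
    2: { fext eta. rewrite Cmult_0_l cexp_0. ring. }
    set (h := fun eta => (RtoC (t ^ S n) * cexp (RtoC t * Q eta) * f eta)%C).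
    assert (Hh : schwartz h) by exact (HD1 (mknonnegreal t Ht) f Hf).
    replace (t ^ S n * Cmod (T x0 f)) with (Cmod (T (x0 + t) h)).
    - eapply Rle_trans; [apply Hn; [lra|exact Hh]|].
      rewrite Rabs_pos_eq; [|lra]. rewrite Rplus_assoc. 
      apply Rmult_le_compat_l; [apply pow_le; lra|]. exact (Hk (mknonnegreal t Ht) f Hf).
    - rewrite -E.
      transitivity (Cmod (RtoC (t ^ S n) * T (x0 + t)%R (fun eta => cexp (RtoC t * Q eta) * f eta))%C).
      2: { rewrite Cmod_mult Cmod_R Rabs_pos_eq; [reflexivity|now apply pow_le]. }
      f_equal. rewrite -(lin_cmult (T (x0 + t))).
      + f_equal. fext eta. unfold h. ring.
      + apply HT. lra.
      + now apply schwartz_exp. }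
  apply Cmod_eq_0. apply Rle_antisym; [|apply Cmod_ge_0].
  apply le_epsilon. intros e He. rewrite Rplus_0_l.
  (* From t^(n+1) |T x0 f| <= (2 + x0 + t)^n K: the first entry of the maximum
     makes 2 + x0 + t <= 2 t, the second then bounds |T x0 f| by e. *)
  set (t := Rmax (2 + x0) (2 ^ n * K / e)).
  assert (T1 : 2 + x0 <= t) by apply Rmax_l. assert (T2 : 2 ^ n * K / e <= t) by apply Rmax_r.
  specialize (B t ltac:(lra)).
  assert (H1 : (2 + x0 + t) ^ n <= 2 ^ n * t ^ n).
  { rewrite -Rpow_mult_distr. apply pow_incr. lra. }
  assert (Ht : 0 < t ^ n) by (apply pow_lt; lra).
  apply Rmult_le_reg_l with (t ^ S n); [apply pow_lt; lra|].
  eapply Rle_trans; [exact B|].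
  apply Rle_trans with (2 ^ n * t ^ n * K); [now apply Rmult_le_compat_r|].
  apply Rmult_le_compat_r with (r := e) in T2; [|lra].
  replace (2 ^ n * K / e * e) with (2 ^ n * K) in T2 by (field; lra).
  simpl. replace (t * t ^ n * e) with (t ^ n * (t * e)) by ring.
  replace (2 ^ n * t ^ n * K) with (t ^ n * (2 ^ n * K)) by ring.
  apply Rmult_le_compat_l; lra.
Qed.

(** * Integrals over compact intervals *)

Definition is_cint (f : R -> C) (a b : R) (l : C) : Prop :=
  is_RInt (V := R_NormedModule) (fun t => Re (f t)) a b (Re l) /\
  is_RInt (V := R_NormedModule) (fun t => Im (f t)) a b (Im l).

Lemma is_cint_unique f a b l l' : is_cint f a b l -> is_cint f a b l' -> l = l'.
Proof.
  intros [H1 H2] [H3 H4]. apply C_ext.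
  - apply (is_RInt_unique (V := R_CompleteNormedModule)) in H1.
    apply (is_RInt_unique (V := R_CompleteNormedModule)) in H3. now rewrite -H1 -H3.
  - apply (is_RInt_unique (V := R_CompleteNormedModule)) in H2.
    apply (is_RInt_unique (V := R_CompleteNormedModule)) in H4. now rewrite -H2 -H4.
Qed.

Lemma is_cint_plus f g a b lf lg : is_cint f a b lf -> is_cint g a b lg ->
  is_cint (fun t => f t + g t)%C a b (lf + lg)%C.
Proof.
  intros [H1 H2] [H3 H4]; split; simpl.
  - exact (is_RInt_plus (V := R_NormedModule) _ _ _ _ _ _ H1 H3).
  - exact (is_RInt_plus (V := R_NormedModule) _ _ _ _ _ _ H2 H4).
Qed.

Lemma is_cint_cmult c f a b l : is_cint f a b l -> is_cint (fun t => c * f t)%C a b (c * l)%C.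
Proof.
  intros [H1 H2]; split; simpl.
  - exact (is_RInt_minus (V := R_NormedModule) _ _ _ _ _ _
      (is_RInt_scal (V := R_NormedModule) _ _ _ (Re c) _ H1)
      (is_RInt_scal (V := R_NormedModule) _ _ _ (Im c) _ H2)).
  - exact (is_RInt_plus (V := R_NormedModule) _ _ _ _ _ _
      (is_RInt_scal (V := R_NormedModule) _ _ _ (Re c) _ H2)
      (is_RInt_scal (V := R_NormedModule) _ _ _ (Im c) _ H1)).
Qed.

Lemma is_cint_ext f g a b l : (forall t, Rmin a b < t < Rmax a b -> f t = g t) ->
  is_cint f a b l -> is_cint g a b l.
Proof.
  intros H [H1 H2]; split.
  - eapply is_RInt_ext; [|exact H1]. intros t Ht. cbv beta. now rewrite (H t Ht).
  - eapply is_RInt_ext; [|exact H2]. intros t Ht. cbv beta. now rewrite (H t Ht).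
Qed.

Lemma is_cint_ex f a b : (forall t, Rmin a b <= t <= Rmax a b -> ccont f t) ->
  exists l, is_cint f a b l.
Proof.
  intros H.
  destruct (ex_RInt_continuous (V := R_CompleteNormedModule) (fun t => Re (f t)) a b) as [l1 H1].
  { intros z Hz. exact (proj1 (H z Hz)). }
  destruct (ex_RInt_continuous (V := R_CompleteNormedModule) (fun t => Im (f t)) a b) as [l2 H2].
  { intros z Hz. exact (proj2 (H z Hz)). }
  exists (l1, l2). split; assumption.
Qed.

Lemma is_cint_bound f a b l M : a <= b -> (forall t, a <= t <= b -> Cmod (f t) <= M) ->
  is_cint f a b l -> Cmod l <= 2 * ((b - a) * M).
Proof.
  intros Hab HM [H1 H2]. apply Cmod_le_of_parts.
  - apply: (norm_RInt_le_const (V := R_NormedModule) _ a b _ M Hab _ H1).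
    intros t Ht. eapply Rle_trans; [|now apply (HM t)]. exact (re_le_Cmod (f t)).
  - apply: (norm_RInt_le_const (V := R_NormedModule) _ a b _ M Hab _ H2).
    intros t Ht. eapply Rle_trans; [|now apply (HM t)]. exact (im_le_Cmod (f t)).
Qed.

Lemma is_cint_derive (G g : R -> C) a b :
  (forall t, Rmin a b <= t <= Rmax a b -> cder G t (g t)) ->
  (forall t, Rmin a b <= t <= Rmax a b -> ccont g t) ->
  is_cint g a b (G b - G a)%C.
Proof.
  intros Hd Hc. split.
  - exact (is_RInt_derive (V := R_CompleteNormedModule) (fun t => Re (G t)) (fun t => Re (g t)) a b
      (fun t Ht => proj1 (Hd t Ht)) (fun t Ht => proj1 (Hc t Ht))).
  - exact (is_RInt_derive (V := R_CompleteNormedModule) (fun t => Im (G t)) (fun t => Im (g t)) a b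
      (fun t Ht => proj2 (Hd t Ht)) (fun t Ht => proj2 (Hc t Ht))).
Qed.

Definition primitive (f : R -> C) (a x : R) : C :=
  (RInt (V := R_CompleteNormedModule) (fun t => Re (f t)) a x,
   RInt (V := R_CompleteNormedModule) (fun t => Im (f t)) a x).

Lemma primitive_is_cint f a x : (forall t, ccont f t) -> is_cint f a x (primitive f a x).
Proof.
  intros H. split; apply (RInt_correct (V := R_CompleteNormedModule)), ex_RInt_continuous.
  - intros z _. exact (proj1 (H z)).
  - intros z _. exact (proj2 (H z)).
Qed.

Lemma cder_primitive f a x : (forall t, ccont f t) -> cder (primitive f a) x (f x).
Proof.
  intros H. split; simpl.
  - apply (is_derive_RInt (V := R_NormedModule) (fun t => Re (f t)) _ a).
    + apply filter_forall. intros y. exact (proj1 (primitive_is_cint f a y H)).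
    + exact (proj1 (H x)).
  - apply (is_derive_RInt (V := R_NormedModule) (fun t => Im (f t)) _ a).
    + apply filter_forall. intros y. exact (proj2 (primitive_is_cint f a y H)).
    + exact (proj2 (H x)).
Qed.

Lemma primitive_eq f a x l : is_cint f a x l -> primitive f a x = l.
Proof.
  intros [H1 H2]. apply C_ext; simpl; now apply (is_RInt_unique (V := R_CompleteNormedModule)).
Qed.

Lemma primitive_point f a : primitive f a a = RtoC 0.
Proof.
  apply primitive_eq. split; apply (is_RInt_point (V := R_NormedModule)).
Qed.

Lemma ccont_eps f x :
  (forall e, 0 < e -> exists d, 0 < d /\ forall y, Rabs (y - x) < d -> Cmod (f y - f x)%C < e) ->
  ccont f x.
Proof.
  intros H. split; apply filterlim_locally; intros e;
    destruct (H e (cond_pos e)) as [d [Hd K]]; exists (mkposreal d Hd); intros y Hy.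
  - change (Rabs (Re (f y) - Re (f x)) < e).
    eapply Rle_lt_trans; [|exact (K y Hy)]. exact (re_le_Cmod (f y - f x)%C).
  - change (Rabs (Im (f y) - Im (f x)) < e).
    eapply Rle_lt_trans; [|exact (K y Hy)]. exact (im_le_Cmod (f y - f x)%C).
Qed.

Lemma eps_ccont f x : ccont f x ->
  forall e, 0 < e -> exists d, 0 < d /\ forall y, Rabs (y - x) < d -> Cmod (f y - f x)%C < e.
Proof.
  intros [H1 H2] e He.
  assert (He' : 0 < e / 3) by lra.
  assert (K1 := proj1 (filterlim_locally (F := locally x) _ _) H1 (mkposreal _ He')).
  assert (K2 := proj1 (filterlim_locally (F := locally x) _ _) H2 (mkposreal _ He')).
  destruct K1 as [d1 K1], K2 as [d2 K2].
  exists (Rmin d1 d2). split; [apply Rmin_stable_in_posreal|]. intros y Hy.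
  eapply Rle_lt_trans; [apply (Cmod_le_of_parts _ (e / 3))|lra].
  - left. apply (K1 y). eapply Rlt_le_trans; [exact Hy|apply Rmin_l].
  - left. apply (K2 y). eapply Rlt_le_trans; [exact Hy|apply Rmin_r].
Qed.

Definition hcont (p : R -> C) : Prop := forall x, 0 <= x -> forall e, 0 < e ->
  exists d, 0 < d /\ forall y, 0 <= y -> Rabs (y - x) < d -> Cmod (p y - p x)%C < e.

(** Precomposing with [Rmax 0] extends a function continuous on the half-line to
    the whole line, where primitives can be differentiated everywhere. *)
Lemma hcont_clamp p : hcont p -> forall x, ccont (fun t => p (Rmax 0 t)) x.
Proof.
  intros H x. apply ccont_eps. intros e He.
  destruct (H (Rmax 0 x) (Rmax_l _ _) e He) as [d [Hd K]]. exists d. split; [assumption|].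
  intros y Hy. apply K; [apply Rmax_l|]. eapply Rle_lt_trans; [|exact Hy].
  unfold Rmax, Rabs. destruct (Rle_dec 0 x), (Rle_dec 0 y); repeat destruct Rcase_abs; lra.
Qed.

Lemma hcont_ccont p x : hcont p -> 0 < x -> ccont p x.
Proof.
  intros H Hx. apply ccont_eps. intros e He.
  destruct (H x (Rlt_le _ _ Hx) e He) as [d [Hd K]].
  exists (Rmin d x). split; [now apply Rmin_pos|]. intros y Hy. apply K.
  - assert (Rabs (y - x) < x) by (eapply Rlt_le_trans; [exact Hy|apply Rmin_r]).
    apply Rabs_def2 in H0. lra.
  - eapply Rlt_le_trans; [exact Hy|apply Rmin_l].
Qed.

(** * Test functions and vector-valued distributions *)

(** The support lies in the open interval (a, b): the slack makes the property
    stable under derivation and gives vanishing at the end points. *)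
Definition supp (a b : R) (th : R -> C) : Prop :=
  smooth th /\ 0 < a /\ exists a0 b0, a < a0 < b0 /\ b0 < b /\
    forall x, (x < a0 \/ b0 < x) -> th x = RtoC 0.

Lemma supp_of_test th : test_pos th -> exists a b, supp a b th.
Proof.
  intros [H [a [b [Hab H0]]]]. exists (a / 2), (b + 1). split; [assumption|]. split; [lra|].
  exists a, b. repeat split; try lra. exact H0.
Qed.

Lemma supp_test a b th : supp a b th -> test_pos th.
Proof.
  intros [H [Ha [a0 [b0 [H1 [H2 H0]]]]]]. split; [assumption|]. exists a0, b0.
  split; [lra|assumption].
Qed.

Lemma supp_zero a b th x : supp a b th -> x <= a \/ b <= x -> th x = RtoC 0.
Proof. intros [_ [_ [a0 [b0 [H1 [H2 H0]]]]]] Hx. apply H0. lra. Qed.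

Lemma supp_lt a b th : supp a b th -> 0 < a < b.
Proof. intros [_ [Ha [a0 [b0 [H1 [H2 H0]]]]]]. lra. Qed.

Lemma supp_derive a b th : supp a b th -> supp a b (cderive th).
Proof.
  intros [Hs [Ha [a0 [b0 [H1 [H2 H0]]]]]]. split; [now apply smooth_cderive|]. split; [assumption|].
  exists a0, b0. repeat split; try lra. intros x Hx.
  assert (L : locally x (fun t => th t = RtoC 0)).
  { destruct Hx as [Hx|Hx].
    - assert (Hp : 0 < a0 - x) by lra. exists (mkposreal _ Hp). intros y Hy.
      change (Rabs (y - x) < a0 - x) in Hy. apply Rabs_def2 in Hy. apply H0. left. lra.
    - assert (Hp : 0 < x - b0) by lra. exists (mkposreal _ Hp). intros y Hy.
      change (Rabs (y - x) < x - b0) in Hy. apply Rabs_def2 in Hy. apply H0. right. lra. }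
  apply C_ext.
  - change (Derive (fun t => Re (th t)) x = 0).
    rewrite (Derive_ext_loc _ (fun _ => 0)); [apply Derive_const|].
    revert L. apply filter_imp. intros y ->. reflexivity.
  - change (Derive (fun t => Im (th t)) x = 0).
    rewrite (Derive_ext_loc _ (fun _ => 0)); [apply Derive_const|].
    revert L. apply filter_imp. intros y ->. reflexivity.
Qed.

Lemma test_derive th : test_pos th -> test_pos (cderive th).
Proof. intros H. destruct (supp_of_test th H) as [a [b Hs]]. eapply supp_test, supp_derive, Hs. Qed.

Lemma supp_ccont a b th x : supp a b th -> ccont th x.
Proof. intros H. exact (cder_ccont _ _ _ (smooth_cder th x (proj1 H))). Qed.

(** Eventually the lower bound is below [a] and the upper bound beyond [b]. *)
Lemma gen_int_compact (h : R -> R) (a b l : R) : 0 < a < b ->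
  (forall x, x <= a \/ b <= x -> h x = 0) -> is_RInt (V := R_NormedModule) h a b l ->
  is_RInt_gen (V := R_NormedModule) h (at_right 0) (Rbar_locally p_infty) l.
Proof.
  intros Hab H0 Hl P HP. unfold filtermapi.
  refine (Filter_prod _ _ _ (fun s => 0 < s < a) (fun t => b < t) _ _ _).
  - assert (Ha : 0 < a) by lra. exists (mkposreal a Ha). intros y Hy Hy0.
    change (Rabs (y - 0) < a) in Hy. apply Rabs_def2 in Hy. lra.
  - now exists b.
  - intros s t Hs Ht. exists l. split; [|exact (locally_singleton _ _ HP)]. simpl.
    assert (Z : forall u v, u <= v -> (forall x, u < x < v -> h x = 0) ->
       is_RInt (V := R_NormedModule) h u v 0).
    { intros u v Huv Hz. evar_last.
      - apply (is_RInt_ext (V := R_NormedModule) (fun _ => 0)).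
        + intros x Hx. rewrite Rmin_left in Hx; [|assumption]. rewrite Rmax_right in Hx; [|assumption].
          symmetry. now apply Hz.
        + apply (is_RInt_const (V := R_NormedModule)).
      - unfold scal; simpl. unfold mult; simpl. ring. }
    replace l with (plus (0 : R) (plus l (0 : R))) by (unfold plus; simpl; ring).
    apply (is_RInt_Chasles (V := R_NormedModule)) with a.
    + apply Z; [lra|]. intros x Hx. apply H0. lra.
    + apply (is_RInt_Chasles (V := R_NormedModule)) with b; [exact Hl|].
      apply Z; [lra|]. intros x Hx. apply H0. lra.
Qed.

Lemma vdist_of_eval (u : R -> dist) th f a b l : supp a b th ->
  is_cint (fun x => th x * u x f)%C a b l -> vdist_of u th f = l.
Proof.
  intros Hs [H1 H2]. assert (Hab := supp_lt _ _ _ Hs).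
  assert (Z := fun x => supp_zero a b th x Hs).
  refine (is_RInt_gen_unique (V := C_R_CompleteNormedModule) _ l _).
  refine (is_RInt_gen_pair _ _ _ l _ _).
  - apply (gen_int_compact _ a b); [assumption| |exact H1].
    intros x Hx. rewrite (Z x Hx). simpl. ring.
  - apply (gen_int_compact _ a b); [assumption| |exact H2].
    intros x Hx. rewrite (Z x Hx). simpl. ring.
Qed.

Lemma vdist_of_cint (u : R -> dist) th f a b : supp a b th ->
  (forall x, 0 < x -> ccont (fun x => u x f) x) ->
  is_cint (fun x => th x * u x f)%C a b (vdist_of u th f).
Proof.
  intros Hs Hc. assert (Hab := supp_lt _ _ _ Hs).
  destruct (is_cint_ex (fun x => th x * u x f)%C a b) as [l Hl].
  - intros t Ht. rewrite Rmin_left in Ht; [|lra].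
    apply ccont_mult; [now apply (supp_ccont a b)|]. apply Hc. lra.
  - now rewrite (vdist_of_eval u th f a b l Hs Hl).
Qed.

Lemma by_parts a b th (P P' : R -> C) l : supp a b th ->
  (forall x, 0 < x -> cder P x (P' x)) -> (forall x, 0 < x -> ccont P' x) ->
  is_cint (fun x => th x * P' x)%C a b l ->
  is_cint (fun x => cderive th x * P x)%C a b (- l)%C.
Proof.
  intros Hs Hd Hc Hl. assert (Hab := supp_lt _ _ _ Hs).
  assert (Hsd := supp_derive _ _ _ Hs).
  assert (E : is_cint (fun x => cderive th x * P x + th x * P' x)%C a b (RtoC 0)).
  { replace (RtoC 0) with (th b * P b - th a * P a)%C.
    - apply (is_cint_derive (fun x => th x * P x)%C); intros t Ht;
        (rewrite Rmin_left in Ht; [|lra]).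
      + apply cder_mult; [apply smooth_cder, Hs|apply Hd; lra].
      + assert (Hct := cder_ccont _ _ _ (Hd t ltac:(lra))).
        apply ccont_plus; apply ccont_mult; auto.
        * now apply (supp_ccont a b).
        * now apply (supp_ccont a b).
        * apply Hc. lra.
    - rewrite !(supp_zero a b th); auto; try lra. ring. }
  replace (- l)%C with (0 + (- (1)) * l)%C by ring.
  apply (is_cint_ext (fun x => (cderive th x * P x + th x * P' x) + (- (1)) * (th x * P' x))%C).
  - intros t _. ring.
  - apply is_cint_plus; [exact E|now apply is_cint_cmult].
Qed.

Lemma vdist_linear (T : R -> dist) th : test_pos th ->
  (forall x, 0 < x -> dist_linear (T x)) ->
  (forall f x, schwartz f -> 0 < x -> ccont (fun x => T x f) x) ->
  dist_linear (vdist_of T th).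
Proof.
  intros Ht HT Hc c d f h Hf Hh.
  destruct (supp_of_test th Ht) as [a [b Hs]]. assert (Hab := supp_lt _ _ _ Hs).
  apply (vdist_of_eval _ _ _ a b _ Hs).
  apply (is_cint_ext (fun x => c * (th x * T x f) + d * (th x * T x h))%C).
  - intros t Ht'. rewrite Rmin_left in Ht'; [|lra]. rewrite (HT t ltac:(lra)); auto. ring.
  - apply is_cint_plus; apply is_cint_cmult; apply vdist_of_cint; auto.
Qed.

Lemma evolves_cder T m x f : evolves (fun x => 0 <= x) T m -> 0 < x -> schwartz f ->
  cder (fun y => T y f) x (T x (fun eta => m eta * f eta)%C).
Proof.
  intros HT Hx Hf. apply (cder_of_wder (fun y => 0 <= y)) with (r := x); [assumption| |].
  - intros y Hy. apply Rabs_def2 in Hy. lra.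
  - apply HT; [lra|assumption].
Qed.

Lemma vdist_parts (T : R -> dist) th m f : test_pos th ->
  evolves (fun x => 0 <= x) T m -> sym2 m -> schwartz f ->
  vdist_of T (cderive th) f = (- vdist_of T th (fun eta => m eta * f eta))%C.
Proof.
  intros Ht HT Hm Hf. destruct (supp_of_test th Ht) as [a [b Hs]].
  assert (Hmf : schwartz (fun eta => m eta * f eta)%C) by now apply schwartz_symbol.
  apply (vdist_of_eval _ _ _ a b); [now apply supp_derive|].
  apply (by_parts a b th (fun x => T x f) (fun x => T x (fun eta => m eta * f eta)%C)); auto.
  - intros x Hx. now apply evolves_cder.
  - intros x Hx. exact (cder_ccont _ _ _ (evolves_cder T m x _ HT Hx Hmf)).
  - apply vdist_of_cint; [assumption|].
    intros x Hx. exact (cder_ccont _ _ _ (evolves_cder T m x _ HT Hx Hmf)).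
Qed.

(** * Weakly affine functions *)

Lemma cder_affine (f : R -> C) (c d x : R) (l : C) :
  cder f (c + d * x) l -> cder (fun y => f (c + d * y)) x (RtoC d * l)%C.
Proof.
  intros [H1 H2].
  assert (K : forall g : R -> R, forall dg, is_derive g (c + d * x) dg ->
    is_derive (fun y => g (c + d * y)) x (d * dg)).
  { intros g dg Hg. apply (is_derive_comp (V := R_NormedModule) g (fun y => c + d * y)).
    - exact Hg.
    - auto_derive; [exact I|ring]. }
  split.
  - replace (Re (RtoC d * l)) with (d * Re l) by (unfold Re, Im; simpl; ring).
    exact (K (fun t => Re (f t)) _ H1).
  - replace (Im (RtoC d * l)) with (d * Im l) by (unfold Re, Im; simpl; ring).
    exact (K (fun t => Im (f t)) _ H2).
Qed.

Lemma smooth_affine (f : R -> C) (c d : R) : smooth f -> smooth (fun y => f (c + d * y)).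
Proof.
  intros Hf. apply smooth_jet. intros n. revert f Hf.
  induction n as [|n IH]; intros f Hf; split; auto.
  exists (fun _ y => RtoC d * cderive f (c + d * y)%R)%C. split.
  - intros _ x. now apply cder_affine, smooth_cder.
  - apply (jet_mult _ n (fun _ _ => RtoC d)); auto.
    + now apply (jet_cst (fun _ : unit -> R -> C => True) n (fun _ => RtoC d)).
    + now apply IH, smooth_cderive.
Qed.

(** The functions x^(-k) exp(-1/x), extended by zero; their derivatives stay in
    their span. *)
Definition flat (k : nat) (x : R) : R :=
  match Rlt_dec 0 x with left _ => (/ x) ^ k * exp (- / x) | right _ => 0 end.

Lemma flat_neg k x : x <= 0 -> flat k x = 0.
Proof. intros H. unfold flat. destruct Rlt_dec; [lra|reflexivity]. Qed.

Lemma flat_pos k x : 0 < x -> flat k x = (/ x) ^ k * exp (- / x).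
Proof. intros H. unfold flat. destruct Rlt_dec; [reflexivity|lra]. Qed.

Lemma flat_ge0 k x : 0 <= flat k x.
Proof.
  unfold flat. destruct Rlt_dec; [|lra]. apply Rmult_le_pos; [|left; apply exp_pos].
  apply pow_le. left. now apply Rinv_0_lt_compat.
Qed.

(** At the origin, |flat k y| <= K y^2 because s^(k+2) exp(-s) is bounded. *)
Lemma is_derive_flat k x :
  is_derive (flat k) x (- INR k * flat (S k) x + flat (S (S k)) x).
Proof.
  destruct (Rtotal_order x 0) as [Hx|[->|Hx]].
  - rewrite !flat_neg; try lra. replace (_ + 0) with 0 by ring.
    apply (is_derive_ext_loc (fun _ => 0)); [|apply: is_derive_const].
    assert (Hp : 0 < - x) by lra. exists (mkposreal _ Hp). intros y Hy.
    change (Rabs (y - x) < - x) in Hy. apply Rabs_def2 in Hy. symmetry. apply flat_neg. lra.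
  - rewrite !flat_neg; try lra. replace (_ + 0) with 0 by ring.
    destruct (pow_exp_bound (S (S k))) as [K HK].
    assert (HK0 : 0 <= K).
    { eapply Rle_trans; [|apply (HK 0); lra]. simpl. lra. }
    assert (B : forall y, Rabs (flat k y) <= K * y ^ 2).
    { intros y. rewrite Rabs_pos_eq; [|apply flat_ge0]. unfold flat.
      destruct Rlt_dec as [Hy|Hy]; [|apply Rmult_le_pos; [assumption|apply pow2_ge_0]].
      assert (Hi : 0 < / y) by now apply Rinv_0_lt_compat.
      replace ((/ y) ^ k * exp (- / y)) with ((/ y) ^ S (S k) * exp (- / y) * y ^ 2).
      - apply Rmult_le_compat_r; [apply pow2_ge_0|]. apply HK. lra.
      - simpl. field. lra. }
    apply is_derive_Reals. intros e He.
    assert (Hd : 0 < e / (K + 1)) by (apply Rdiv_lt_0_compat; lra).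
    exists (mkposreal _ Hd). simpl. intros h Hh0 Hh.
    rewrite (flat_neg k 0); [|lra]. rewrite Rplus_0_l !Rminus_0_r.
    unfold Rdiv. rewrite Rabs_mult Rabs_inv.
    assert (P : 0 < Rabs h) by now apply Rabs_pos_lt.
    apply Rmult_lt_reg_r with (Rabs h); [assumption|].
    rewrite Rmult_assoc Rinv_l; [|lra]. rewrite Rmult_1_r.
    eapply Rle_lt_trans; [apply B|]. rewrite -(pow2_abs h).
    apply Rmult_lt_compat_r with (r := K + 1) in Hh; [|lra].
    replace (e / (K + 1) * (K + 1)) with e in Hh by (field; lra).
    replace (K * Rabs h ^ 2) with (K * Rabs h * Rabs h) by ring. nra.
  - rewrite !flat_pos; try lra.
    apply (is_derive_ext_loc (fun y => (/ y) ^ k * exp (- / y))).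
    + exists (mkposreal _ Hx). intros y Hy.
      change (Rabs (y - x) < x) in Hy. apply Rabs_def2 in Hy. symmetry. apply flat_pos. lra.
    + auto_derive; [lra|]. destruct k as [|k].
      * simpl. field. lra.
      * rewrite (S_INR k). simpl pred. simpl pow. field. lra.
Qed.

Lemma smooth_flat k : smooth (fun x => RtoC (flat k x)).
Proof.
  apply smooth_jet. intros n. revert k. induction n as [|n IH]; intros k; split; auto.
  exists (fun _ x => RtoC (- INR k) * RtoC (flat (S k) x) + RtoC (flat (S (S k)) x))%C. split.
  - intros _ x. rewrite -RtoC_mult -RtoC_plus. split; simpl.
    + apply is_derive_flat.
    + apply: is_derive_const.
  - apply (jet_plus _ n (fun _ x => RtoC (- INR k) * RtoC (flat (S k) x))%C); auto.
    apply (jet_mult _ n (fun _ _ => RtoC (- INR k))); auto.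
    now apply (jet_cst (fun _ : unit -> R -> C => True) n (fun _ => RtoC (- INR k))).
Qed.

Definition bump (x : R) : R := flat 0 (1 + 1 * x) * flat 0 (1 + -1 * x).

Lemma smooth_bump : smooth (fun x => RtoC (bump x)).
Proof.
  replace (fun x => RtoC (bump x))
    with (fun x => RtoC (flat 0 (1 + 1 * x)) * RtoC (flat 0 (1 + -1 * x)))%C.
  - apply smooth_mult.
    + exact (smooth_affine _ 1 1 (smooth_flat 0)).
    + exact (smooth_affine _ 1 (-1) (smooth_flat 0)).
  - fext x. unfold bump. now rewrite RtoC_mult.
Qed.

Lemma bump_ge0 x : 0 <= bump x.
Proof. apply Rmult_le_pos; apply flat_ge0. Qed.

Lemma bump_out x : x <= -1 \/ 1 <= x -> bump x = 0.
Proof.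
  intros [H|H]; unfold bump.
  - rewrite (flat_neg 0 (1 + 1 * x)); lra.
  - rewrite (flat_neg 0 (1 + -1 * x)); lra.
Qed.

Lemma bump_pos x : -1 < x < 1 -> 0 < bump x.
Proof.
  intros H. unfold bump. rewrite !flat_pos; try lra. rewrite !pow_O !Rmult_1_l.
  apply Rmult_lt_0_compat; apply exp_pos.
Qed.

Definition ramp1 : R -> C := primitive (fun x => RtoC (bump x)) (-1).
(** A smooth version of the positive part: its second derivative is a bump, it
    vanishes on the left and is affine on the right. A combination of translates
    that annihilates affine functions is therefore a test function. *)
Definition ramp2 : R -> C := primitive ramp1 (-1).
Definition mass : C := ramp1 1.

Lemma ccont_bump x : ccont (fun x => RtoC (bump x)) x.
Proof. exact (cder_ccont _ _ _ (smooth_cder _ x smooth_bump)). Qed.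

Lemma cder_ramp1 x : cder ramp1 x (RtoC (bump x)).
Proof. apply (cder_primitive (fun x => RtoC (bump x))). apply ccont_bump. Qed.

Lemma cder_ramp2 x : cder ramp2 x (ramp1 x).
Proof. apply cder_primitive. intros t. exact (cder_ccont _ _ _ (cder_ramp1 t)). Qed.

Lemma smooth_ramp2 : smooth ramp2.
Proof. eapply smooth_intro; [apply cder_ramp2|]. eapply smooth_intro; [apply cder_ramp1|apply smooth_bump]. Qed.

Lemma wder_zero_of_cder (f : R -> C) a b : a <= b ->
  (forall x, a <= x <= b -> cder f x (RtoC 0)) -> f b = f a.
Proof. intros Hab H. apply wder_zero_constant; auto. intros x Hx. now apply wder_of_cder, H. Qed.

Lemma ramp1_left x : x <= -1 -> ramp1 x = RtoC 0.
Proof.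
  intros Hx. rewrite -(wder_zero_of_cder ramp1 x (-1) Hx); [apply primitive_point|].
  intros y Hy. eapply cder_eq; [apply cder_ramp1|]. f_equal. apply bump_out. lra.
Qed.

Lemma ramp1_right x : 1 <= x -> ramp1 x = mass.
Proof.
  intros Hx. apply (wder_zero_of_cder ramp1 1 x Hx).
  intros y Hy. eapply cder_eq; [apply cder_ramp1|]. f_equal. apply bump_out. lra.
Qed.

Lemma ramp2_left x : x <= -1 -> ramp2 x = RtoC 0.
Proof.
  intros Hx. rewrite -(wder_zero_of_cder ramp2 x (-1) Hx); [apply primitive_point|].
  intros y Hy. eapply cder_eq; [apply cder_ramp2|]. apply ramp1_left. lra.
Qed.

Lemma ramp2_right x : 1 <= x -> ramp2 x = (ramp2 1 + mass * RtoC (x - 1))%C.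
Proof.
  intros Hx.
  assert (E := wder_zero_of_cder (fun y => ramp2 y + (- mass) * RtoC y)%C 1 x Hx).
  cbv beta in E. rewrite RtoC_minus.
  replace (ramp2 x) with (ramp2 x + - mass * RtoC x + mass * RtoC x)%C by ring.
  rewrite E; [ring|]. intros y Hy. eapply cder_eq.
  - apply cder_plus; [apply cder_ramp2|]. apply cder_cmult, cder_id.
  - rewrite ramp1_right; [ring|lra].
Qed.

Lemma mass_pos : 0 < Re mass.
Proof.
  apply RInt_gt_0; [lra| |].
  - intros x Hx. now apply bump_pos.
  - intros x Hx. exact (proj1 (ccont_bump x)).
Qed.

(** Integrating [q] against a bump of width [d] at [c] gives nearly
    [d * mass * q c]. *)
Lemma bump_average (q : R -> C) (c d a b e : R) : 0 < d -> 0 <= e -> a <= b ->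
  (forall y, ccont q y) -> a <= c - d -> c + d <= b ->
  (forall y, Rabs (y - c) <= d -> Cmod (q y - q c)%C <= e) ->
  exists l, is_cint (fun y => RtoC (bump (- c / d + / d * y)) * q y)%C a b l /\
    Cmod (l - RtoC d * mass * q c)%C <= 2 * (d * (Re mass * e)).
Proof.
  intros Hd He Hab Hq Ha Hb Hqc.
  assert (Hi : 0 < / d) by now apply Rinv_0_lt_compat.
  assert (Aff : forall y, - c / d + / d * y = (y - c) * / d) by (intros; field; lra).
  set (w := fun y => RtoC (bump (- c / d + / d * y))).
  assert (Hw : forall y, ccont w y).
  { intros y. exact (cder_ccont _ _ _ (smooth_cder _ y (smooth_affine _ (- c / d) (/ d) smooth_bump))). }
  assert (I1 : is_cint w a b (RtoC d * mass)%C).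
  { replace (RtoC d * mass)%C with (RtoC d * ramp1 (- c / d + / d * b) - RtoC d * ramp1 (- c / d + / d * a))%C.
    - apply (is_cint_derive (fun y => RtoC d * ramp1 (- c / d + / d * y))%C w); auto.
      intros t _. eapply cder_eq; [apply cder_cmult, cder_affine, cder_ramp1|].
      unfold w. rewrite Cmult_assoc -RtoC_mult Rinv_r; [ring|lra].
    - rewrite !Aff ramp1_right.
      2: { apply Rmult_le_reg_r with d; [assumption|]. rewrite Rmult_assoc Rinv_l; lra. }
      rewrite ramp1_left; [ring|].
      apply Rmult_le_reg_r with d; [assumption|]. rewrite Rmult_assoc Rinv_l; lra. }
  destruct (is_cint_ex (fun y => w y * q y)%C a b) as [l Hl].
  { intros t _. apply ccont_mult; auto. }
  exists l. split; [exact Hl|].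
  assert (I2 : is_cint (fun y => w y * (q y - q c))%C a b (l - RtoC d * mass * q c)%C).
  { apply (is_cint_ext (fun y => w y * q y + (- q c) * w y)%C); [intros; ring|].
    replace (l - RtoC d * mass * q c)%C with (l + (- q c) * (RtoC d * mass))%C by ring.
    apply is_cint_plus; [exact Hl|now apply is_cint_cmult]. }
  assert (I3 : is_RInt (V := R_NormedModule) (fun y => e * Re (w y)) a b (d * (Re mass * e))).
  { replace (d * (Re mass * e)) with (e * Re (RtoC d * mass)%C) by (unfold Re, Im; simpl; ring).
    exact (is_RInt_scal (V := R_NormedModule) _ _ _ e _ (proj1 I1)). }
  assert (B : forall y, Cmod (w y * (q y - q c))%C <= e * Re (w y)).
  { intros y. unfold w. rewrite Cmod_mult Cmod_R Rabs_pos_eq; [|apply bump_ge0].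
    simpl Re. rewrite Rmult_comm.
    destruct (Rle_dec (Rabs (y - c)) d) as [Hy|Hy].
    - apply Rmult_le_compat_r; [apply bump_ge0|now apply Hqc].
    - rewrite bump_out; [lra|]. rewrite Aff. apply Rnot_le_lt in Hy.
      destruct (Rle_dec 0 (y - c)) as [Hs|Hs].
      + right. rewrite Rabs_pos_eq in Hy; [|assumption].
        apply Rmult_le_reg_r with d; [assumption|]. rewrite Rmult_assoc Rinv_l; lra.
      + left. rewrite Rabs_left in Hy; [|lra].
        apply Rmult_le_reg_r with d; [assumption|]. rewrite Rmult_assoc Rinv_l; lra. }
  apply Cmod_le_of_parts.
  - apply: (norm_RInt_le (V := R_NormedModule) _ _ a b _ _ Hab _ (proj1 I2) I3).
    intros y _. eapply Rle_trans; [|apply B]. exact (re_le_Cmod (w y * (q y - q c))%C).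
  - apply: (norm_RInt_le (V := R_NormedModule) _ _ a b _ _ Hab _ (proj2 I2) I3).
    intros y _. eapply Rle_trans; [|apply B]. exact (im_le_Cmod (w y * (q y - q c))%C).
Qed.

(** For the points [x], 1 and 2 there are weights annihilating affine functions.
    The corresponding combination of rescaled translates of [ramp2] is a test
    function whose second derivative is the same combination of bumps, so in the
    limit of vanishing width the combination of values of [q] is zero. *)
Lemma weak_affine (q : R -> C) : (forall x, ccont q x) ->
  (forall th a b, supp a b th -> is_cint (fun x => cderive (cderive th) x * q x)%C a b (RtoC 0)) ->
  forall x, 0 < x -> q x = (RtoC (2 - x) * q 1%R + RtoC (x - 1) * q 2%R)%C.
Proof.
  intros Hq Hw x Hx.
  (* These weights annihilate affine functions of the base point. *)
  set (comb := fun h : R -> C => (h x + (RtoC (x - 2) * h 1%R + RtoC (1 - x) * h 2%R))%C).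
  set (W := comb q).
  assert (HW : W = RtoC 0).
  2: { replace (q x) with (W + (RtoC (2 - x) * q 1%R + RtoC (x - 1) * q 2%R))%C.
       - rewrite HW. ring.
       - unfold W, comb. rewrite !RtoC_minus. ring. }
  set (V := 1 + (Rabs (x - 2) + Rabs (1 - x))).
  assert (HV : 0 < V) by (unfold V; generalize (Rabs_pos (x - 2)) (Rabs_pos (1 - x)); lra).
  apply Cmod_eq_0. apply Rle_antisym; [|apply Cmod_ge_0]. apply le_epsilon.
  intros e0 He0. rewrite Rplus_0_l.
  set (e := e0 / (2 * V)). assert (He : 0 < e) by (apply Rdiv_lt_0_compat; lra).
  destruct (eps_ccont _ _ (Hq x) e He) as [d0 [Hd0 K0]].
  destruct (eps_ccont _ _ (Hq 1) e He) as [d1 [Hd1 K1]].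
  destruct (eps_ccont _ _ (Hq 2) e He) as [d2 [Hd2 K2]].
  set (xm := Rmin x 1). assert (Hxm : 0 < xm) by (apply Rmin_pos; lra).
  set (d := Rmin (Rmin d0 d1) (Rmin d2 xm) / 2).
  assert (Hd : 0 < d).
  { unfold d. assert (0 < Rmin (Rmin d0 d1) (Rmin d2 xm)) by (repeat apply Rmin_pos; lra). lra. }
  assert (D : d < d0 /\ d < d1 /\ d < d2 /\ d < xm /\ d <= xm / 2).
  { unfold d in *. generalize (Rmin_l (Rmin d0 d1) (Rmin d2 xm)) (Rmin_r (Rmin d0 d1) (Rmin d2 xm))
     (Rmin_l d0 d1) (Rmin_r d0 d1) (Rmin_l d2 xm) (Rmin_r d2 xm). lra. }
  assert (Hx1 : xm <= x) by apply Rmin_l. assert (Hx2 : xm <= 1) by apply Rmin_r.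
  set (xM := Rmax x 2). assert (Hx3 : x <= xM) by apply Rmax_l. assert (Hx4 : 2 <= xM) by apply Rmax_r.
  set (a := xm / 4). set (b := xM + d + 1).
  set (L := fun c y => ramp2 (- c / d + / d * y)).
  set (L1 := fun c y => (RtoC (/ d) * ramp1 (- c / d + / d * y))%C).
  set (L2 := fun c y => (RtoC (/ d) * (RtoC (/ d) * RtoC (bump (- c / d + / d * y))))%C).
  assert (DL : forall c y, cder (L c) y (L1 c y)).
  { intros c y. apply cder_affine, cder_ramp2. }
  assert (DL1 : forall c y, cder (L1 c) y (L2 c y)).
  { intros c y. apply cder_cmult, cder_affine, cder_ramp1. }
  assert (Dcomb : forall l dl : R -> R -> C, (forall c y, cder (l c) y (dl c y)) ->
      forall y, cder (fun y => comb (fun c => l c y)) y (comb (fun c => dl c y))).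
  { intros l dl Hl y. apply cder_plus; [apply Hl|]. apply cder_plus; apply cder_cmult, Hl. }
  set (th := fun y => comb (fun c => L c y)).
  assert (Hi : 0 < / d) by now apply Rinv_0_lt_compat.
  assert (Aff : forall c y, - c / d + / d * y = (y - c) * / d) by (intros; field; lra).
  assert (Hth : supp a b th).
  { split; [|split; [unfold a; lra|]].
    - assert (S : forall c, smooth (L c)) by (intros c; exact (smooth_affine _ _ _ smooth_ramp2)).
      apply smooth_plus; [apply S|].
      apply smooth_plus; apply smooth_mult; auto using smooth_const.
    - exists (xm - d), (xM + d). unfold a, b. repeat split; try lra.
      intros y [Hy|Hy]; unfold th, comb, L; rewrite !Aff.
      + assert (Z : forall c, xm <= c -> ramp2 ((y - c) * / d) = RtoC 0).
        { intros c Hc. apply ramp2_left.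
          apply Rmult_le_reg_r with d; [assumption|]. rewrite Rmult_assoc Rinv_l; lra. }
        rewrite !Z; try lra. ring.
      + assert (Z : forall c, c <= xM ->
          ramp2 ((y - c) * / d) = (ramp2 1%R + mass * (RtoC y * RtoC (/ d) - RtoC c * RtoC (/ d) - 1))%C).
        { intros c Hc. rewrite ramp2_right.
          - rewrite RtoC_minus RtoC_mult RtoC_minus. ring.
          - apply Rmult_le_reg_r with d; [assumption|]. rewrite Rmult_assoc Rinv_l; lra. }
        rewrite !Z; try lra. rewrite !RtoC_minus. ring. }
  assert (Hab := supp_lt _ _ _ Hth).
  assert (E2 : cderive (cderive th) = fun y => comb (fun c => L2 c y)).
  { unfold th. rewrite (cderive_fun _ _ (Dcomb _ _ DL)). exact (cderive_fun _ _ (Dcomb _ _ DL1)). }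
  assert (I := Hw th a b Hth). rewrite E2 in I.
  destruct (bump_average q x d a b e) as [l0 [I0 B0]]; auto; try (unfold a, b in *; lra).
  { intros y Hy. left. apply K0. lra. }
  destruct (bump_average q 1 d a b e) as [l1 [I1 B1]]; auto; try (unfold a, b in *; lra).
  { intros y Hy. left. apply K1. lra. }
  destruct (bump_average q 2 d a b e) as [l2 [I2 B2]]; auto; try (unfold a, b in *; lra).
  { intros y Hy. left. apply K2. lra. }
  assert (Hd0' : RtoC d <> RtoC 0) by (apply RtoC_neq0; lra).
  assert (S0 : (l0 + (RtoC (x - 2) * l1 + RtoC (1 - x) * l2))%C = RtoC 0).
  { assert (J : is_cint (fun y => comb (fun c => L2 c y) * q y)%C a b
      (RtoC (/ d) * RtoC (/ d) * (l0 + (RtoC (x - 2) * l1 + RtoC (1 - x) * l2)))%C).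
    { apply (is_cint_ext (fun y => RtoC (/ d) * RtoC (/ d) * (RtoC (bump (- x / d + / d * y)) * q y +
        (RtoC (x - 2) * (RtoC (bump (- (1) / d + / d * y)) * q y) +
         RtoC (1 - x) * (RtoC (bump (- (2) / d + / d * y)) * q y))))%C).
      - intros t _. unfold comb, L2. ring.
      - apply is_cint_cmult. apply is_cint_plus; [exact I0|].
        apply is_cint_plus; apply is_cint_cmult; assumption. }
    assert (U := is_cint_unique _ _ _ _ _ I J).
    replace (l0 + (RtoC (x - 2) * l1 + RtoC (1 - x) * l2))%C with (RtoC d * RtoC d * (RtoC (/ d) * RtoC (/ d)
      * (l0 + (RtoC (x - 2) * l1 + RtoC (1 - x) * l2))))%C.
    - rewrite -U. ring.
    - rewrite RtoC_inv; [field; exact Hd0'|lra]. }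
  assert (F1 : (RtoC d * mass * W)%C = (- ((l0 - RtoC d * mass * q x)
     + (RtoC (x - 2) * (l1 - RtoC d * mass * q 1%R) + RtoC (1 - x) * (l2 - RtoC d * mass * q 2%R))))%C).
  { transitivity (- ((l0 - RtoC d * mass * q x)
     + (RtoC (x - 2) * (l1 - RtoC d * mass * q 1%R) + RtoC (1 - x) * (l2 - RtoC d * mass * q 2%R)))
     + (l0 + (RtoC (x - 2) * l1 + RtoC (1 - x) * l2)))%C.
    - unfold W, comb. ring.
    - rewrite S0. ring. }
  assert (F2 : d * Cmod mass * Cmod W <= 2 * (d * (Re mass * e)) * V).
  { rewrite -{1}(Rabs_pos_eq d); [|lra]. rewrite -Cmod_R -!Cmod_mult F1 Cmod_opp.
    eapply Rle_trans; [apply Cmod_triangle|].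
    eapply Rle_trans; [apply Rplus_le_compat_l, Cmod_triangle|].
    rewrite !Cmod_mult !Cmod_R. unfold V.
    assert (P1 := Rabs_pos (x - 2)). assert (P2 := Rabs_pos (1 - x)). nra. }
  assert (M := mass_pos).
  assert (M' : Re mass <= Cmod mass) by (eapply Rle_trans; [apply Rle_abs|apply re_le_Cmod]).
  apply Rmult_le_reg_l with (d * Cmod mass); [apply Rmult_lt_0_compat; lra|].
  eapply Rle_trans; [exact F2|].
  replace (2 * (d * (Re mass * e)) * V) with (d * Re mass * e0) by (unfold e; field; lra).
  apply Rmult_le_compat_r; [lra|]. apply Rmult_le_compat_l; lra.
Qed.

(** * Families over the half-line *)

Lemma sym2_plus f g : sym2 f -> sym2 g -> sym2 (fun x => f x + g x)%C.
Proof. intros Hf Hg. apply (symbol_plus _ (fun _ => f) (fun _ => g)); auto using two_le_two. Qed.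

Lemma sym2_mult f g : sym2 f -> sym2 g -> sym2 (fun x => f x * g x)%C.
Proof. intros Hf Hg. apply (symbol_mult _ (fun _ => f) (fun _ => g)); auto using two_le_two. Qed.

Lemma sym2_const c : sym2 (fun _ => c).
Proof. apply symbol_const, two_le_two. Qed.

Lemma sym2_id : sym2 RtoC.
Proof. apply symbol_id, two_le_two. Qed.

Lemma sym2_ext f g : (forall x, f x = g x) -> sym2 f -> sym2 g.
Proof. intros H. now rewrite (functional_extensionality _ _ H). Qed.

Local Notation hline := (fun x => 0 <= x).
Local Notation hsize := (fun x : nonnegreal => 2 + x).

Lemma hsize_ge2 : forall x : nonnegreal, 2 <= 2 + x.
Proof. intros x; generalize (cond_nonneg x); lra. Qed.

Lemma dbounded_plus {P} (s : P -> R) T U : (forall p, 2 <= s p) ->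
  dbounded s T -> dbounded s U -> dbounded s (fun p f => T p f + U p f)%C.
Proof.
  intros Hs [n Hn] [k Hk]. exists (S (n + k)). intros p f Hf.
  eapply Rle_trans; [apply Cmod_triangle|].
  assert (B1 : Cmod (T p f) <= s p ^ (n + k) * schwartz_norm (n + k) f).
  { eapply Rle_trans; [now apply Hn|]. apply scale_mono; auto; lia. }
  assert (B2 : Cmod (U p f) <= s p ^ (n + k) * schwartz_norm (n + k) f).
  { eapply Rle_trans; [now apply Hk|]. apply scale_mono; auto; lia. }
  assert (B3 : schwartz_norm (n + k) f <= schwartz_norm (S (n + k)) f) by (apply schwartz_norm_mono; auto; lia).
  assert (B4 := schwartz_norm_pos (n + k) f Hf). assert (Hsp := Hs p).
  assert (B5 : 0 <= s p ^ (n + k)) by (apply pow_le; lra).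
  apply Rle_trans with (2 * (s p ^ (n + k) * schwartz_norm (n + k) f)); [lra|].
  simpl pow. rewrite Rmult_assoc. apply Rmult_le_compat; [lra|now apply Rmult_le_pos|assumption|].
  now apply Rmult_le_compat_l.
Qed.

Lemma dbounded_cmult {P} (s : P -> R) c T : (forall p, 2 <= s p) ->
  dbounded s T -> dbounded s (fun p f => c * T p f)%C.
Proof.
  intros Hs [n Hn]. destruct (pow2_above (Cmod c)) as [k Hk]. exists (k + n)%nat. intros p f Hf.
  rewrite Cmod_mult pow_add Rmult_assoc. apply Rmult_le_compat; try apply Cmod_ge_0.
  - now apply size_const.
  - eapply Rle_trans; [now apply Hn|].
    apply Rmult_le_compat_l; [apply pow_le; generalize (Hs p); lra|].
    apply schwartz_norm_mono; auto; lia.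
Qed.

Lemma family_on_hline (T : R -> dist) : (forall x, 0 <= x -> dist_linear (T x)) ->
  dbounded hsize (fun x => T (nonneg x)) -> family_on hline T.
Proof.
  intros H1 [n H2]. split; [exact H1|]. exists n. intros x f Hx Hf.
  rewrite Rabs_pos_eq; [|assumption]. exact (H2 (mknonnegreal x Hx) f Hf).
Qed.

Lemma dbounded_symbol (U : nonnegreal -> dist) m : sym2 m -> dbounded hsize U ->
  dbounded hsize (fun x f => U x (fun eta => m eta * f eta)%C).
Proof.
  intros Hm HU. apply (dbounded_comp hsize U (fun _ f eta => m eta * f eta)%C hsize_ge2 HU).
  apply (sbounded_symbol hsize (fun _ => m) hsize_ge2).
  now apply (symbol_of_sym2 hsize _ hsize_ge2).
Qed.

Lemma linear_plus (U W : dist) : dist_linear U -> dist_linear W -> dist_linear (fun f => U f + W f)%C.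
Proof. intros HU HW a b f h Hf Hh. rewrite HU; auto. rewrite HW; auto. ring. Qed.

Lemma linear_cmult c (U : dist) : dist_linear U -> dist_linear (fun f => c * U f)%C.
Proof. intros HU a b f h Hf Hh. rewrite HU; auto. ring. Qed.

Lemma linear_symbol m (U : dist) : sym2 m -> dist_linear U -> dist_linear (fun f => U (fun eta => m eta * f eta)%C).
Proof. intros Hm HU. apply dist_linear_symbol; auto. intros; now apply schwartz_symbol. Qed.

Lemma evolves_const (S : R -> Prop) (T : dist) : dist_linear T -> evolves S (fun _ => T) (fun _ => RtoC 0).
Proof.
  intros HT x f Hx Hf. rewrite lin_zero; auto. apply wder_of_cder, cder_const.
Qed.

(** The instance of [pairing_derivative] where the distribution is constant. *)
Lemma evolves_exp (T : dist) (Q : R -> C) : dist_linear T ->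
  dbounded (fun _ : unit => 2) (fun _ => T) -> sym2 Q -> (forall eta, Re (Q eta) <= 0) ->
  evolves (fun x => 0 <= x) (fun x f => T (fun eta => cexp (RtoC x * Q eta) * f eta)%C) Q.
Proof.
  intros HT HB HQ HR x f Hx Hf.
  assert (HF : family_on (fun x => 0 <= x) (fun _ => T)).
  { split; [auto|]. destruct HB as [n Hn]. exists n. intros y h _ Hh.
    eapply Rle_trans; [now apply (Hn tt)|]. apply Rmult_le_compat_r; [now apply schwartz_norm_pos|].
    apply pow_incr. generalize (Rabs_pos y). lra. }
  assert (K := pairing_derivative (fun x => 0 <= x) (fun _ => T) (fun _ => RtoC 0) Q 0 1 x f HF
    (evolves_const _ _ HT) (sym2_const _) HQ HR ltac:(ring) ltac:(intros; lra) Hx Hf).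
  refine (wder_ext _ _ _ _ _ _ Hx _ _ K).
  - intros t Ht. f_equal. fext eta. do 4 f_equal. ring.
  - f_equal. fext eta.
    replace (0 + 1 * x) with x by ring. ring.
Qed.

Lemma exp_family_linear (T : dist) (Q : R -> C) x : dist_linear T -> sym2 Q ->
  (forall eta, Re (Q eta) <= 0) -> 0 <= x ->
  dist_linear (fun f => T (fun eta => cexp (RtoC x * Q eta) * f eta)%C).
Proof.
  intros HT HQ HR Hx. apply (dist_linear_symbol T (fun eta => cexp (RtoC x * Q eta))%C); auto.
  intros; now apply schwartz_exp.
Qed.

Lemma exp_family_bounded (T : dist) (Q : R -> C) :
  dbounded (fun _ : unit => 2) (fun _ => T) -> sym2 Q -> (forall eta, Re (Q eta) <= 0) ->
  exists n, forall x f, 0 <= x -> schwartz f ->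
    Cmod (T (fun eta => cexp (RtoC x * Q eta) * f eta)%C) <= (2 + x) ^ n * schwartz_norm n f.
Proof.
  intros HB HQ HR.
  assert (Hs : forall p : nonnegreal, 2 <= 2 + p) by (intros p; generalize (cond_nonneg p); lra).
  assert (D := dbounded_comp (fun p : nonnegreal => 2 + p) (fun _ => T)
    (fun (p : nonnegreal) f eta => cexp (RtoC p * Q eta) * f eta)%C Hs).
  destruct D as [n Hn].
  - apply (dbounded_reparam (fun _ : unit => 2) _ (fun _ => tt) (fun _ => T)); auto.
    intros p; generalize (cond_nonneg p); lra.
  - apply (sbounded_symbol _ (fun (p : nonnegreal) eta => cexp (RtoC p * Q eta))%C); auto.
    apply (symbol_exp (fun p : nonnegreal => 2 + p) nonneg); auto.
    intros p; generalize (cond_nonneg p); lra.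
  - exists n. intros x f Hx Hf. exact (Hn (mknonnegreal x Hx) f Hf).
Qed.

Lemma filterlim_C_eps {T : Type} (G : (T -> Prop) -> Prop) {FG : Filter G} (f : T -> C) (l : C) :
  (forall e, 0 < e -> G (fun t => Cmod (f t - l)%C < e)) -> filterlim f G (locally l).
Proof.
  intros H. apply (filterlim_locally (U := C_UniformSpace)). intros e.
  generalize (H e (cond_pos e)). apply filter_imp. intros t Ht.
  exact (C_NormedModule_mixin_compat1 l (f t) e Ht).
Qed.

Lemma filterlim_C_elim {T : Type} (G : (T -> Prop) -> Prop) {FG : Filter G} (f : T -> C) (l : C) :
  filterlim f G (locally l) -> forall e, 0 < e -> G (fun t => Cmod (f t - l)%C < e).
Proof.
  intros H e He. assert (He' : 0 < e / 2) by lra.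
  generalize (proj1 (filterlim_locally (U := C_UniformSpace) (F := G) f l) H (mkposreal _ He')).
  apply filter_imp. intros t Ht.
  assert (K := C_NormedModule_mixin_compat2 l (f t) (mkposreal _ He') Ht). simpl in K.
  assert (sqrt 2 < 2).
  { rewrite -{2}(sqrt_square 2); [|lra]. apply sqrt_lt_1; lra. }
  change (Cmod (f t - l)%C < sqrt 2 * (e / 2)) in K.
  eapply Rlt_trans; [exact K|]. nra.
Qed.

Lemma hcont_filterlim p x : hcont p -> 0 <= x ->
  filterlim p (within (fun t => 0 <= t) (locally x)) (locally (p x)).
Proof.
  intros H Hx. apply filterlim_C_eps. { apply within_filter, locally_filter. }
  intros e He. destruct (H x Hx e He) as [d [Hd K]]. exists (mkposreal d Hd). intros y Hy Hy0.
  now apply K.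
Qed.

Lemma filterlim_hcont p :
  (forall x, 0 <= x -> filterlim p (within (fun t => 0 <= t) (locally x)) (locally (p x))) -> hcont p.
Proof.
  intros H x Hx e He.
  destruct (filterlim_C_elim _ _ _ (H x Hx) e He) as [d K].
  exists d. split; [apply cond_pos|]. intros y Hy Hyx. now apply K.
Qed.

Lemma evolves_hcont T m f : evolves (fun x => 0 <= x) T m -> schwartz f -> hcont (fun x => T x f).
Proof. intros H Hf x Hx. exact (wder_cont _ _ _ _ (H x f Hx Hf)). Qed.

Lemma wder_right_derivative (p : R -> C) (l : C) : wder (fun x => 0 <= x) p 0 l ->
  filterlim (fun h => Cdiv (Cminus (p h) (p 0%R)) (RtoC h)) (at_right 0) (locally l).
Proof.
  intros H. apply filterlim_C_eps. { apply within_filter, locally_filter. }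
  intros e He. destruct (H (e / 2) ltac:(lra)) as [d [Hd K]]. exists (mkposreal d Hd).
  intros y Hy Hy0. change (Rabs (y - 0) < d) in Hy.
  specialize (K y ltac:(lra) Hy). rewrite Rminus_0_r in K. rewrite (Rabs_pos_eq y) in K; [|lra].
  assert (Hn : RtoC y <> RtoC 0) by (apply RtoC_neq0; lra).
  replace (Cdiv (Cminus (p y) (p 0%R)) (RtoC y) - l)%C
    with ((p y - p 0%R - RtoC y * l) / RtoC y)%C by (field; exact Hn).
  rewrite Cmod_div; auto. rewrite Cmod_R (Rabs_pos_eq y); [|lra].
  apply Rmult_lt_reg_r with y; [assumption|].
  unfold Rdiv. rewrite Rmult_assoc Rinv_l; [|lra]. nra.
Qed.

Lemma tempered_intro (T : dist) n K : dist_linear T -> 0 <= K ->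
  (forall f, schwartz f -> Cmod (T f) <= K * schwartz_norm n f) -> tempered T.
Proof.
  intros HT HK H. split; [assumption|]. exists n, K. intros f Hf M HM.
  eapply Rle_trans; [now apply H|]. apply Rmult_le_compat_l; [assumption|].
  now apply schwartz_norm_le.
Qed.

Lemma tempered_bound (T : dist) : tempered T -> dbounded (fun _ : unit => 2) (fun _ => T).
Proof. intros H. now apply tempered_dbounded. Qed.

Lemma fourier_fun_comb (a b : C) f h : schwartz f -> schwartz h ->
  F (fun y => a * f y + b * h y)%C = (fun eta => a * F f eta + b * F h eta)%C.
Proof. intros Hf Hh. fext eta. now apply fourier_comb. Qed.

Lemma fourier_dist_linear (T : dist) : dist_linear T -> dist_linear (fun f => T (F f)).
Proof.
  intros HT. apply (dist_linear_comp T F); auto using schwartz_fourier, fourier_fun_comb.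
Qed.

Lemma fourier_inv_dist_linear (T : dist) : dist_linear T -> dist_linear (fun f => T (fourier_inv f)).
Proof.
  intros HT. apply (dist_linear_comp T fourier_inv); auto using schwartz_fourier_inv, fourier_inv_comb.
Qed.

(** * The characteristic roots of the problem *)

Section Problem.

Context (eps nu kx ky : R).
Context (He : 0 < eps) (Hnu : 0 < nu) (Hk : kx ^ 2 + ky ^ 2 = 1) (Hkx : 0 < kx) (Hky : ky <> 0).

Local Notation rt := (root eps nu kx ky).
Local Notation Rm := (Rminus eps nu kx ky).

(** The second root of the characteristic polynomial. *)
Definition Rp (eta : R) : C :=
  (Ci * RtoC (kx * eta / ky) - Ci * RtoC (kx / (eps * ky ^ 2)) * (RtoC 1 + rt eta))%C.

(** The factor between the transform of [g] and that of the trace at [x = 0]. *)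
Definition trace_symbol (eta : R) : C := (RtoC 2 * / (RtoC 1 + rt eta))%C.

Lemma ky2_pos : 0 < ky ^ 2.
Proof. now apply pow2_gt_0. Qed.

Lemma root_imaginary_part_pos : 0 < 2 * nu * eps * ky ^ 2 / kx ^ 2.
Proof.
  assert (K := ky2_pos). apply Rdiv_lt_0_compat; [|now apply pow_lt].
  apply Rmult_lt_0_compat; [|assumption]. repeat apply Rmult_lt_0_compat; lra.
Qed.

Lemma root_affine :
  rt = affine_root 1 (- (2 * eps * ky / kx ^ 2)) (2 * nu * eps * ky ^ 2 / kx ^ 2).
Proof.
  fext eta. unfold root, affine_root. f_equal.
  apply C_ext; unfold Re, Im; simpl; field; lra.
Qed.

Lemma sym2_root : sym2 rt.
Proof. rewrite root_affine. apply symbol_affine_root, root_imaginary_part_pos. Qed.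

Lemma sym2_affine_combination (c : R) : sym2 (fun eta => Ci * RtoC (kx * eta / ky)
  - Ci * RtoC (kx / (eps * ky ^ 2)) * (RtoC 1 + RtoC c * rt eta))%C.
Proof.
  apply (sym2_ext (fun eta => Ci * RtoC (kx / ky) * RtoC eta
    + (- (Ci * RtoC (kx / (eps * ky ^ 2)))) * (RtoC 1 + RtoC c * rt eta))%C).
  - intros eta. replace (kx * eta / ky) with (kx / ky * eta) by (field; assumption).
    rewrite RtoC_mult. ring.
  - apply sym2_plus; [apply (sym2_mult (fun _ => _)); [apply sym2_const|apply sym2_id]|].
    apply (sym2_mult (fun _ => _)); [apply sym2_const|].
    apply (sym2_plus (fun _ => _)); [apply sym2_const|].
    apply (sym2_mult (fun _ => _)); [apply sym2_const|exact sym2_root].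
Qed.

Lemma sym2_Rm : sym2 Rm.
Proof.
  apply (fun H => sym2_ext _ _ H (sym2_affine_combination (-1))). intros eta. unfold Rminus. replace (RtoC (-1)) with (- (1))%C by (apply C_ext; simpl; ring). ring.
Qed.

Lemma sym2_Rp : sym2 Rp.
Proof.
  apply (fun H => sym2_ext _ _ H (sym2_affine_combination 1)). intros eta. unfold Rp. ring.
Qed.

Lemma sym2_trace : sym2 trace_symbol.
Proof.
  unfold trace_symbol. apply (sym2_mult (fun _ => _)); [apply sym2_const|].
  rewrite root_affine. apply symbol_inv_one_plus_affine_root, root_imaginary_part_pos.
Qed.

Lemma one_plus_root_neq0 eta : (RtoC 1 + rt eta)%C <> RtoC 0.
Proof.
  intros E. apply (f_equal Re) in E. change (1 + Re (rt eta) = 0) in E. revert E.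
  rewrite root_affine. generalize (affine_root_Re 1 (- (2 * eps * ky / kx ^ 2)) _ eta root_imaginary_part_pos).
  lra.
Qed.

(** The real parts are, up to sign, a positive multiple of the imaginary part of
    the square root. They tend to zero at one end of the frequency line, so only a
    bound depending on the frequency holds. *)
Lemma root_real_parts : exists c, 0 < c /\ forall eta,
  Re (Rm eta) <= - (c / (1 + Rabs eta)) /\ c / (1 + Rabs eta) <= Re (Rp eta).
Proof.
  destruct (affine_root_Im_lower 1 (- (2 * eps * ky / kx ^ 2)) _ root_imaginary_part_pos) as [c [Hc Hc']].
  rewrite -root_affine in Hc'. set (k := kx / (eps * ky ^ 2)).
  assert (Hkk : 0 < k).
  { apply Rdiv_lt_0_compat; [assumption|]. apply Rmult_lt_0_compat; [assumption|exact ky2_pos]. }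
  exists (k * c). split; [now apply Rmult_lt_0_compat|]. intros eta. specialize (Hc' eta).
  assert (E1 : Re (Rm eta) = - (k * Im (rt eta))).
  { unfold Rminus. fold k. destruct (rt eta). unfold Re, Im; simpl. ring. }
  assert (E2 : Re (Rp eta) = k * Im (rt eta)).
  { unfold Rp. fold k. destruct (rt eta). unfold Re, Im; simpl. ring. }
  rewrite E1 E2. replace (k * c / (1 + Rabs eta)) with (k * (c / (1 + Rabs eta))) by (unfold Rdiv; ring).
  split; [apply Ropp_le_contravar|]; apply Rmult_le_compat_l; lra.
Qed.

Lemma Rm_Re_nonpos eta : Re (Rm eta) <= 0.
Proof.
  destruct root_real_parts as [c [Hc Hb]]. destruct (Hb eta) as [B _].
  assert (0 < c / (1 + Rabs eta)); [|lra].
  apply Rdiv_lt_0_compat; [assumption|generalize (Rabs_pos eta); lra].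
Qed.

(** With [c2], [alpha] and [beta], the transformed interior equation reads
    c2 u'' - alpha u' + beta u = 0. *)
Definition c2 : C := RtoC (eps / 2 * ky ^ 2).
Definition alpha (eta : R) : C := (Ci * RtoC (eps * kx * ky * eta) - Ci * RtoC kx)%C.
Definition beta (eta : R) : C :=
  (- RtoC (ky * eta) - RtoC (eps / 2 * kx ^ 2 * eta ^ 2) + Ci * RtoC nu)%C.

Lemma c2_neq0 : c2 <> RtoC 0.
Proof.
  apply RtoC_neq0. assert (K := ky2_pos).
  assert (0 < eps / 2 * ky ^ 2) by (apply Rmult_lt_0_compat; lra). lra.
Qed.

(** Vieta's formula for the sum of the roots. *)
Lemma alpha_eq eta : alpha eta = (c2 * (Rm eta + Rp eta))%C.
Proof.
  unfold alpha, c2, Rminus, Rp.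
  destruct (rt eta). apply C_ext; unfold Re, Im; simpl; field; split; assumption || lra.
Qed.

(** Vieta's formula for the product of the roots. *)
Lemma beta_eq eta : beta eta = (c2 * (Rm eta * Rp eta))%C.
Proof.
  unfold beta, c2.
  (* Homogenizing with kx^2 + ky^2 = 1 makes the claim a rational identity. *)
  assert (Er : (rt eta * rt eta)%C
    = (1 - 2 * (eps * ky * eta / kx ^ 2) * (kx ^ 2 + ky ^ 2), 2 * nu * (eps * ky ^ 2 / kx ^ 2))).
  { unfold root. rewrite csqrt_sqr Hk. apply C_ext; unfold Re, Im; simpl; ring. }
  symmetry.
  transitivity (RtoC (eps / 2 * ky ^ 2) * ((Ci * RtoC (kx * eta / ky) - Ci * RtoC (kx / (eps * ky ^ 2)))
     * (Ci * RtoC (kx * eta / ky) - Ci * RtoC (kx / (eps * ky ^ 2)))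
     - (Ci * RtoC (kx / (eps * ky ^ 2))) * (Ci * RtoC (kx / (eps * ky ^ 2))) * (rt eta * rt eta)))%C.
  { unfold Rminus, Rp. ring. }
  rewrite Er. apply C_ext; unfold Re, Im; simpl; field; repeat split; assumption || lra.
Qed.

Lemma sym2_alpha : sym2 alpha.
Proof.
  apply (sym2_ext _ _ (fun eta => eq_sym (alpha_eq eta))).
  apply (sym2_mult (fun _ => c2)); [apply sym2_const|].
  apply sym2_plus; [exact sym2_Rm|exact sym2_Rp].
Qed.

Lemma sym2_beta : sym2 beta.
Proof.
  apply (sym2_ext _ _ (fun eta => eq_sym (beta_eq eta))).
  apply (sym2_mult (fun _ => c2)); [apply sym2_const|].
  apply sym2_mult; [exact sym2_Rm|exact sym2_Rp].
Qed.

Lemma schwartz_Rm f : schwartz f -> schwartz (fun eta => Rm eta * f eta)%C.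
Proof. apply schwartz_symbol, sym2_Rm. Qed.

Lemma schwartz_Rp f : schwartz f -> schwartz (fun eta => Rp eta * f eta)%C.
Proof. apply schwartz_symbol, sym2_Rp. Qed.

Lemma schwartz_alpha f : schwartz f -> schwartz (fun eta => alpha eta * f eta)%C.
Proof. apply schwartz_symbol, sym2_alpha. Qed.

Lemma schwartz_beta f : schwartz f -> schwartz (fun eta => beta eta * f eta)%C.
Proof. apply schwartz_symbol, sym2_beta. Qed.

(** The transformed interior equation, tested. The sign of the [alpha] term is that
    of the integration by parts implicit in [vdx]. *)
Lemma interior_operator_fourier (u : R -> dist) (th f : R -> C) :
  let T := fun x f => u x (F f) in let U := vdist_of u in
  (forall x, 0 < x -> dist_linear (T x)) ->
  (forall f x, schwartz f -> 0 < x -> ccont (fun x => T x f) x) ->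
  test_pos th -> schwartz f ->
  vadd
    (vscal Ci (vadd (vscal (RtoC kx) (vdx U)) (vscal (RtoC ky) (vdy U))))
    (vadd
      (vscal (RtoC (eps / 2))
        (vadd (vscal (RtoC (kx ^ 2)) (vdy (vdy U)))
          (vadd (vscal (RtoC (- (2 * kx * ky))) (vdx (vdy U)))
                (vscal (RtoC (ky ^ 2)) (vdx (vdx U))))))
      (vscal (Cmult Ci (RtoC nu)) U)) th (F f)
  = (c2 * vdist_of T (cderive (cderive th)) f
     + (vdist_of T (cderive th) (fun eta => alpha eta * f eta)
        + vdist_of T th (fun eta => beta eta * f eta)))%C.
Proof.
  intros T U Hlin Hcont Hth Hf.
  assert (Hf1 := schwartz_mulx' f Hf). assert (Hf2 := schwartz_mulx' _ Hf1).
  unfold vadd, vscal, vdx, vdy, dist_dy.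
  rewrite (cderive_fourier f Hf) (cderive_fourier _ Hf1).
  change (U th (F f)) with (vdist_of T th f).
  change (U (cderive th) (F f)) with (vdist_of T (cderive th) f).
  change (U (cderive (cderive th)) (F f)) with (vdist_of T (cderive (cderive th)) f).
  change (U th (F (mulx f))) with (vdist_of T th (mulx f)).
  change (U (cderive th) (F (mulx f))) with (vdist_of T (cderive th) (mulx f)).
  change (U th (F (mulx (mulx f)))) with (vdist_of T th (mulx (mulx f))).
  assert (HL0 := vdist_linear T th Hth Hlin Hcont).
  assert (HL1 := vdist_linear T _ (test_derive th Hth) Hlin Hcont).
  set (L0 := vdist_of T th) in *. set (L1 := vdist_of T (cderive th)) in *.
  set (L2 := vdist_of T (cderive (cderive th))) in *.
  assert (A1 : L1 (fun eta => alpha eta * f eta)%C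
    = (- RtoC (eps * kx * ky) * L1 (mulx f) + (- (Ci * RtoC kx)) * L1 f)%C).
  { rewrite -(HL1 _ _ (mulx f) f Hf1 Hf). f_equal. fext eta.
    unfold alpha, mulx. destruct (f eta). apply C_ext; unfold Re, Im; simpl; ring. }
  assert (A0 : L0 (fun eta => beta eta * f eta)%C
    = ((- (Ci * RtoC ky)) * L0 (mulx f) + (RtoC (eps / 2 * kx ^ 2) * L0 (mulx (mulx f))
        + (Ci * RtoC nu) * L0 f))%C).
  { transitivity (L0 (fun eta => RtoC 1 * ((- (Ci * RtoC ky)) * mulx f eta
        + RtoC (eps / 2 * kx ^ 2) * mulx (mulx f) eta) + (Ci * RtoC nu) * f eta)%C).
    - f_equal. fext eta. unfold beta, mulx.
      destruct (f eta). apply C_ext; unfold Re, Im; simpl; field.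
    - assert (S12 := schwartz_plus _ _ (schwartz_cmult (- (Ci * RtoC ky))%C _ Hf1)
        (schwartz_cmult (RtoC (eps / 2 * kx ^ 2)) _ Hf2)). cbv beta in S12.
      rewrite (HL0 (RtoC 1) (Ci * RtoC nu)%C _ f S12 Hf) (HL0 _ _ (mulx f) _ Hf1 Hf2). ring. }
  rewrite A1 A0. unfold c2.
  replace (RtoC (- (2 * kx * ky))) with (- (RtoC 2 * RtoC kx * RtoC ky))%C
    by (rewrite RtoC_opp !RtoC_mult; reflexivity).
  replace (RtoC (eps / 2 * kx ^ 2)) with (RtoC (eps / 2) * RtoC (kx ^ 2))%C by (now rewrite RtoC_mult).
  replace (RtoC (eps / 2 * ky ^ 2)) with (RtoC (eps / 2) * RtoC (ky ^ 2))%C by (now rewrite RtoC_mult).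
  replace (RtoC (eps * kx * ky)) with (RtoC (eps / 2) * (RtoC 2 * RtoC kx * RtoC ky))%C
    by (rewrite -!RtoC_mult; f_equal; field).
  ring.
Qed.

(** When d/dx acts as [Rm], the boundary operator is the multiplication by
    kx (1 + root): the terms linear in the frequency cancel. *)
Lemma boundary_operator_fourier (L : dist) f : dist_linear L -> schwartz f ->
  (Ci * RtoC (eps * ky) * (RtoC kx * (- L (mulx f)) - RtoC ky * L (fun eta => Rm eta * f eta))
   + RtoC (2 * kx) * L f)%C = L (fun eta => RtoC kx * ((RtoC 1 + rt eta) * f eta))%C.
Proof.
  intros HL Hf.
  assert (Hm := schwartz_mulx' f Hf). assert (HR := schwartz_Rm f Hf).
  assert (S12 := schwartz_plus _ _ (schwartz_cmult (- (Ci * RtoC (eps * ky) * RtoC kx))%C _ Hm)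
    (schwartz_cmult (- (Ci * RtoC (eps * ky) * RtoC ky))%C _ HR)). cbv beta in S12.
  transitivity (L (fun eta => RtoC 1 * ((- (Ci * RtoC (eps * ky) * RtoC kx)) * mulx f eta
    + (- (Ci * RtoC (eps * ky) * RtoC ky)) * (Rm eta * f eta)) + RtoC (2 * kx) * f eta)%C).
  - rewrite (HL (RtoC 1) (RtoC (2 * kx)) _ f S12 Hf) (HL _ _ (mulx f) _ Hm HR). ring.
  - f_equal. fext eta. unfold mulx, Rminus.
    destruct (rt eta), (f eta). apply C_ext; unfold Re, Im; simpl; field; split; assumption || lra.
Qed.

Context (g : dist) (Hg : tempered g).

(** * Existence *)

Definition trace_hat : dist := fun f => g (F (fun eta => trace_symbol eta * f eta)%C).

Definition sol_hat (x : R) : dist := fun f =>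
  trace_hat (fun eta => cexp (RtoC x * Rm eta) * f eta)%C.

Definition sol (x : R) : dist := fun f => sol_hat x (fourier_inv f).

Lemma trace_hat_linear : dist_linear trace_hat.
Proof.
  apply (dist_linear_symbol (fun f => g (F f))); [apply fourier_dist_linear, Hg|].
  intros f. apply schwartz_symbol, sym2_trace.
Qed.

Lemma trace_hat_bounded : dbounded (fun _ : unit => 2) (fun _ => trace_hat).
Proof.
  exact (dbounded_comp _ (fun _ => g) _ two_le_two (tempered_bound g Hg)
    (sbounded_comp _ (fun _ => F) _ two_le_two sbounded_fourier
      (sbounded_symbol _ _ two_le_two sym2_trace))).
Qed.

Lemma sol_hat_evolves : evolves hline sol_hat Rm.
Proof.
  exact (evolves_exp trace_hat Rm trace_hat_linear trace_hat_bounded sym2_Rm Rm_Re_nonpos).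
Qed.

Lemma sol_hat_linear x : 0 <= x -> dist_linear (sol_hat x).
Proof. exact (exp_family_linear trace_hat Rm x trace_hat_linear sym2_Rm Rm_Re_nonpos). Qed.

Lemma sol_hat_bounded : exists n, forall x f, 0 <= x -> schwartz f ->
  Cmod (sol_hat x f) <= (2 + x) ^ n * schwartz_norm n f.
Proof. exact (exp_family_bounded trace_hat Rm trace_hat_bounded sym2_Rm Rm_Re_nonpos). Qed.

Lemma sol_hat_0 f : sol_hat 0 f = trace_hat f.
Proof. unfold sol_hat. f_equal. fext eta. rewrite Cmult_0_l cexp_0. ring. Qed.

Lemma sol_of_fourier x f : schwartz f -> sol x (F f) = sol_hat x f.
Proof. intros Hf. unfold sol. now rewrite (fourier_inv_l f Hf). Qed.

Lemma vdist_sol_fourier th f : schwartz f ->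
  vdist_of (fun x f => sol x (F f)) th f = vdist_of sol_hat th f.
Proof.
  intros Hf.
  change (vdist_of sol_hat th (fourier_inv (F f)) = vdist_of sol_hat th f).
  now rewrite (fourier_inv_l f Hf).
Qed.

Lemma sol_linear x : 0 <= x -> dist_linear (sol x).
Proof. intros Hx. now apply fourier_inv_dist_linear, sol_hat_linear. Qed.

Lemma sol_bound : exists n k, forall x f, 0 <= x -> schwartz f ->
  Cmod (sol x f) <= (2 + x) ^ n * (2 ^ k * schwartz_norm k f).
Proof.
  destruct sol_hat_bounded as [n Hn]. destruct (proj2 sbounded_fourier_inv n) as [k Hk'].
  exists n, k. intros x f Hx Hf.
  eapply Rle_trans; [apply Hn; [assumption|now apply schwartz_fourier_inv]|].
  apply Rmult_le_compat_l; [apply pow_le; lra|]. now apply (Hk' tt).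
Qed.

(** Each x-derivative may be replaced by a multiplication by [Rm], after which the
    symbol is the characteristic polynomial at its root [Rm]. *)
Lemma sol_interior : interior_equation eps nu kx ky sol.
Proof.
  intros th f Hth Hf. cbv zeta.
  assert (Hphi := schwartz_fourier_inv f Hf). rewrite -(fourier_inv_r f Hf).
  set (phi := fourier_inv f) in *. clearbody phi. assert (HRp := schwartz_Rm _ Hphi).
  rewrite interior_operator_fourier; auto.
  - rewrite !vdist_sol_fourier; auto using schwartz_alpha, schwartz_beta.
    assert (Hth' := test_derive th Hth).
    assert (HL : dist_linear (vdist_of sol_hat th)).
    { apply vdist_linear; auto.
      - intros x Hx. apply sol_hat_linear. lra.
      - intros h x Hh Hx. exact (cder_ccont _ _ _ (evolves_cder _ Rm x h sol_hat_evolves Hx Hh)). }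
    rewrite !(vdist_parts sol_hat _ Rm); auto using sol_hat_evolves, sym2_Rm, schwartz_alpha.
    set (L := vdist_of sol_hat th) in *.
    transitivity (L (fun eta => RtoC 0 * phi eta)%C); [|now apply lin_zero].
    transitivity (L (fun eta => c2 * (Rm eta * (Rm eta * phi eta))
      + RtoC 1 * ((- (1)) * (Rm eta * (alpha eta * phi eta)) + RtoC 1 * (beta eta * phi eta)))%C).
    + assert (S1 := schwartz_Rm _ HRp). assert (S2 := schwartz_Rm _ (schwartz_alpha _ Hphi)).
      assert (S3 := schwartz_beta _ Hphi).
      assert (S23 := schwartz_plus _ _ (schwartz_cmult (- (1))%C _ S2) (schwartz_cmult (RtoC 1) _ S3)).
      rewrite (HL _ _ _ _ S1 S23) (HL _ _ _ _ S2 S3). ring.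
    + f_equal. fext eta. rewrite alpha_eq beta_eq. ring.
  - intros x Hx. apply fourier_dist_linear, sol_linear. lra.
  - intros h x Hh Hx.
    exact (cder_ccont _ _ _ (evolves_cder _ Rm x _ sol_hat_evolves Hx
      (schwartz_fourier_inv _ (schwartz_fourier h Hh)))).
Qed.

(** The trace of the x-derivative is the distribution with transform Rm times that
    of the trace. *)
Lemma sol_boundary : boundary_condition eps kx ky g sol.
Proof.
  exists (fun f => sol_hat 0 (fun eta => Rm eta * fourier_inv f eta)%C).
  assert (HL0 := sol_hat_linear 0 (Rle_refl 0)).
  split; [split|].
  - apply tempered_dbounded. split.
    + apply (fourier_inv_dist_linear (fun f => sol_hat 0 (fun eta => Rm eta * f eta)%C)).
      exact (linear_symbol Rm (sol_hat 0) sym2_Rm HL0).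
    + destruct sol_hat_bounded as [m Hm].
      apply (dbounded_comp _ (fun _ => sol_hat 0)
        (fun _ f eta => Rm eta * fourier_inv f eta)%C two_le_two).
      * exists m. intros _ f Hf. specialize (Hm 0 f (Rle_refl 0) Hf). rewrite Rplus_0_r in Hm. exact Hm.
      * exact (sbounded_comp _ _ (fun _ => fourier_inv) two_le_two
          (sbounded_symbol _ (fun _ => Rm) two_le_two sym2_Rm) sbounded_fourier_inv).
  - intros f Hf. apply (wder_right_derivative (fun h => sol h f)).
    apply sol_hat_evolves; [lra|now apply schwartz_fourier_inv].
  - intros f Hf. unfold dist_dy, sol.
    rewrite (fourier_inv_derive f Hf). assert (Ephi := fourier_inv_r f Hf).
    assert (Hphi := schwartz_fourier_inv f Hf). set (phi := fourier_inv f) in *. clearbody phi.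
    rewrite (boundary_operator_fourier _ phi HL0 Hphi) sol_hat_0 -Ephi.
    rewrite -(lin_cmult _ _ phi (fourier_dist_linear g (proj1 Hg)) Hphi).
    unfold trace_hat. do 2 f_equal. fext eta.
    unfold trace_symbol. rewrite RtoC_mult. field. apply one_plus_root_neq0.
Qed.

Lemma sol_is_solution : is_solution eps nu kx ky g sol.
Proof.
  destruct sol_bound as [n [k B]].
  split; [|split; [|split; [|split]]].
  - intros x Hx. apply (tempered_intro _ k ((2 + x) ^ n * 2 ^ k)).
    + now apply sol_linear.
    + apply Rmult_le_pos; apply pow_le; lra.
    + intros f Hf. rewrite Rmult_assoc. now apply B.
  - intros f Hf x Hx. apply (hcont_filterlim (fun t => sol t f)); [|assumption].
    apply (evolves_hcont _ _ (fourier_inv f) sol_hat_evolves). now apply schwartz_fourier_inv.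
  - exists (n + k)%nat, (2 ^ n * 2 ^ k). intros x Hx f Hf M HM.
    eapply Rle_trans; [now apply B|].
    assert (HkM : schwartz_norm k f <= M).
    { apply schwartz_norm_le. intros i j y Hi Hj. apply HM; lia. }
    assert (H0 := schwartz_norm_pos k f Hf).
    assert (P : forall m, 0 <= 2 ^ m) by (intros; apply pow_le; lra).
    apply Rle_trans with (2 ^ n * (1 + x) ^ (n + k) * (2 ^ k * M)); [|right; ring].
    apply Rmult_le_compat; [apply pow_le; lra|now apply Rmult_le_pos| |now apply Rmult_le_compat_l].
    apply Rle_trans with (2 ^ n * (1 + x) ^ n).
    + rewrite -Rpow_mult_distr. apply pow_incr. lra.
    + apply Rmult_le_compat_l; [apply P|]. apply Rle_pow; [lra|lia].
  - exact sol_interior.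
  - exact sol_boundary.
Qed.

Lemma sol_symbol x eta :
  solution_symbol eps nu kx ky x eta = (trace_symbol eta * cexp (RtoC x * Rm eta))%C.
Proof. unfold solution_symbol, trace_symbol. now rewrite (Cmult_comm (Rm _)). Qed.

Lemma solution_symbol_slow x : 0 <= x -> slowly_increasing (solution_symbol eps nu kx ky x).
Proof.
  intros Hx. assert (Hs : forall _ : unit, 2 <= 2 + x) by (intros; lra).
  apply (symbol_slowly_increasing (fun _ : unit => 2 + x) (fun _ => solution_symbol eps nu kx ky x) tt Hs).
  replace (solution_symbol eps nu kx ky x) with (fun eta => trace_symbol eta * cexp (RtoC x * Rm eta))%C.
  - apply (symbol_mult _ (fun _ => trace_symbol)); [exact Hs|apply symbol_of_sym2; [exact Hs|exact sym2_trace]|].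
    apply (symbol_exp (fun _ : unit => 2 + x) (fun _ => x)); [exact Hs|intros; lra|exact sym2_Rm|exact Rm_Re_nonpos].
  - fext eta. symmetry. apply sol_symbol.
Qed.

Lemma sol_fourier x :
  dist_eq (fourier (sol x)) (dist_mul (solution_symbol eps nu kx ky x) (fourier g)).
Proof.
  intros f Hf. unfold fourier, dist_mul. rewrite sol_of_fourier; auto.
  unfold sol_hat, trace_hat. do 2 f_equal. fext eta. rewrite sol_symbol. ring.
Qed.

Lemma sol_fourier_equation :
  let Uhat := vdist_of (fun x => fourier (sol x)) in
  vdist_null (vadd (vdx Uhat) (vscal (RtoC (-1)) (vmul Rm Uhat))).
Proof.
  intros Uhat th f Hth Hf. unfold vadd, vdx, vscal, vmul, dist_mul.
  change Uhat with (vdist_of (fun x f => sol x (F f))).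
  rewrite !vdist_sol_fourier; auto using schwartz_Rm.
  rewrite (vdist_parts _ th Rm f Hth sol_hat_evolves sym2_Rm Hf).
  replace (RtoC (-1)) with (- (1))%C by (apply C_ext; simpl; ring). ring.
Qed.

Context (v : R -> dist) (Hv : is_solution eps nu kx ky g v).

(** * Uniqueness *)

Definition vhat (x : R) : dist := fun f => v x (F f).

Definition vhat_primitive (f : R -> C) : R -> C := primitive (fun t => vhat (Rmax 0 t) f) 0.

Lemma vhat_linear x : 0 <= x -> dist_linear (vhat x).
Proof. intros Hx. apply fourier_dist_linear. now apply (proj1 Hv x Hx). Qed.

Lemma vhat_bounded : dbounded hsize (fun x => vhat (nonneg x)).
Proof.
  assert (D : dbounded hsize (fun x => v (nonneg x))).
  { destruct (proj1 (proj2 (proj2 Hv))) as [N [K B]]. destruct (pow2_above K) as [j Hj].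
    exists (j + N)%nat. intros x f Hf. assert (Hx := cond_nonneg x).
    eapply Rle_trans; [apply (B x Hx f Hf _ (schwartz_norm_seminorm N f Hf))|].
    assert (H0 := schwartz_norm_pos N f Hf).
    apply Rle_trans with ((2 + x) ^ j * (2 + x) ^ N * schwartz_norm N f).
    - apply Rmult_le_compat_r; [assumption|]. apply Rle_trans with ((2 + x) ^ j * (1 + x) ^ N).
      + apply Rmult_le_compat_r; [apply pow_le; lra|]. apply size_const; lra.
      + apply Rmult_le_compat_l; [apply pow_le; lra|]. apply pow_incr. lra.
    - rewrite -pow_add. apply Rmult_le_compat_l; [apply pow_le; lra|].
      apply schwartz_norm_mono; auto; lia. }
  exact (dbounded_comp _ _ (fun _ => F) hsize_ge2 D
    (sbounded_reparam _ hsize (fun _ => tt) (fun _ => F) (fun p => conj (Rlt_le _ _ Rlt_0_2) (hsize_ge2 p)) sbounded_fourier)).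
Qed.

Lemma vhat_hcont f : schwartz f -> hcont (fun x => vhat x f).
Proof.
  intros Hf. apply filterlim_hcont. intros x Hx.
  apply (proj1 (proj2 Hv) (F f)); [now apply schwartz_fourier|assumption].
Qed.

Lemma vhat_clamp_ccont f x : schwartz f -> ccont (fun t => vhat (Rmax 0 t) f) x.
Proof. intros Hf. exact (hcont_clamp _ (vhat_hcont f Hf) x). Qed.

Lemma vhat_ccont f x : schwartz f -> 0 < x -> ccont (fun t => vhat t f) x.
Proof. intros Hf Hx. exact (hcont_ccont _ x (vhat_hcont f Hf) Hx). Qed.

Lemma cder_vhat_primitive f x : schwartz f -> cder (vhat_primitive f) x (vhat (Rmax 0 x) f).
Proof. intros Hf. apply (cder_primitive (fun t => vhat (Rmax 0 t) f)). intros; now apply vhat_clamp_ccont. Qed.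

Lemma vhat_primitive_is_cint f x : schwartz f -> is_cint (fun t => vhat (Rmax 0 t) f) 0 x (vhat_primitive f x).
Proof. intros Hf. apply primitive_is_cint. intros; now apply vhat_clamp_ccont. Qed.

Lemma weak_equation th f : test_pos th -> schwartz f ->
  (c2 * vdist_of vhat (cderive (cderive th)) f
   + (vdist_of vhat (cderive th) (fun eta => alpha eta * f eta)
      + vdist_of vhat th (fun eta => beta eta * f eta)))%C = RtoC 0.
Proof.
  intros Hth Hf. rewrite -(proj1 (proj2 (proj2 (proj2 Hv))) th (F f) Hth (schwartz_fourier f Hf)).
  symmetry. apply (interior_operator_fourier v th f); auto.
  - intros x Hx. apply vhat_linear. lra.
  - intros h x Hh Hx. now apply vhat_ccont.
Qed.

(** Integrated twice against a test function, the primitives reproduce the lower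
    order terms of the equation; the difference of the two sides is weakly affine,
    hence affine, first for [x > 0] and by continuity at [x = 0]. *)
Lemma affine_up_to_primitives f : schwartz f -> exists A B : C, forall x, 0 <= x ->
  (c2 * vhat x f)%C = (A + B * RtoC x + (vhat_primitive (fun eta => alpha eta * f eta)%C x
     - primitive (vhat_primitive (fun eta => beta eta * f eta)%C) 0 x))%C.
Proof.
  intros Hf.
  assert (Ha := schwartz_alpha f Hf).
  assert (Hb := schwartz_beta f Hf).
  set (fa := fun eta => (alpha eta * f eta)%C) in *. set (fb := fun eta => (beta eta * f eta)%C) in *.
  assert (CJ : forall h, schwartz h -> forall x, ccont (vhat_primitive h) x).
  { intros h Hh x. exact (cder_ccont _ _ _ (cder_vhat_primitive h x Hh)). }
  (* By the equation, q'' vanishes weakly on x > 0. *)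
  set (q := fun x => (c2 * vhat (Rmax 0 x) f + ((- (1)) * vhat_primitive fa x + primitive (vhat_primitive fb) 0 x))%C).
  assert (Hq : forall x, ccont q x).
  { intros x. apply ccont_plus.
    - apply (ccont_mult (fun _ => c2)); [apply ccont_const|now apply vhat_clamp_ccont].
    - apply ccont_plus.
      + apply (ccont_mult (fun _ => (- (1))%C)); [apply ccont_const|now apply CJ].
      + exact (cder_ccont _ _ _ (cder_primitive (vhat_primitive fb) 0 x (CJ fb Hb))). }
  assert (Hw : forall th a b, supp a b th -> is_cint (fun x => cderive (cderive th) x * q x)%C a b (RtoC 0)).
  { intros th a b Hs. assert (Hs1 := supp_derive _ _ _ Hs). assert (Hs2 := supp_derive _ _ _ Hs1).
    assert (Hab := supp_lt _ _ _ Hs).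
    assert (Hth := supp_test _ _ _ Hs).
    assert (V : forall t h, supp a b t -> schwartz h ->
      is_cint (fun x => t x * vhat (Rmax 0 x) h)%C a b (vdist_of vhat t h)).
    { intros t h Ht Hh. apply (is_cint_ext (fun x => t x * vhat x h)%C).
      - intros x Hx. rewrite Rmin_left in Hx; [|lra]. rewrite Rmax_right; [reflexivity|lra].
      - apply vdist_of_cint; auto. intros; now apply vhat_ccont. }
    rewrite -(weak_equation th f Hth Hf). fold fa fb.
    apply (is_cint_ext (fun x => c2 * (cderive (cderive th) x * vhat (Rmax 0 x) f)
      + ((- (1)) * (cderive (cderive th) x * vhat_primitive fa x) + cderive (cderive th) x * primitive (vhat_primitive fb) 0 x))%C).
    { intros t _. unfold q. ring. }
    apply is_cint_plus; [apply is_cint_cmult; now apply V|].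
    apply is_cint_plus.
    - replace (vdist_of vhat (cderive th) fa) with (- (1) * (- vdist_of vhat (cderive th) fa))%C by ring.
      apply is_cint_cmult. apply (by_parts a b (cderive th) (vhat_primitive fa) (fun x => vhat (Rmax 0 x) fa)); auto.
      + intros; now apply cder_vhat_primitive.
      + intros; now apply vhat_clamp_ccont.
    - replace (vdist_of vhat th fb) with (- (- vdist_of vhat th fb))%C by ring.
      apply (by_parts a b (cderive th) (primitive (vhat_primitive fb) 0) (vhat_primitive fb)); auto.
      + intros; apply cder_primitive. now apply CJ.
      + apply (by_parts a b th (vhat_primitive fb) (fun x => vhat (Rmax 0 x) fb)); auto.
        * intros; now apply cder_vhat_primitive.
        * intros; now apply vhat_clamp_ccont. }
  assert (W := weak_affine q Hq Hw).
  set (A := (RtoC 2 * q 1%R - q 2%R)%C). set (B := (q 2%R - q 1%R)%C).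
  set (D := fun x => (q x + (- (1)) * (A + B * RtoC x))%C).
  assert (HD : forall x, 0 < x -> D x = RtoC 0).
  { intros x Hx. unfold D, A, B. rewrite (W x Hx) !RtoC_minus. ring. }
  assert (HDc : ccont D 0).
  { apply ccont_plus; [apply Hq|].
    exact (cder_ccont _ _ _ (cder_cmult (- (1))%C (fun x => A + B * RtoC x)%C 0 _
      (cder_plus _ _ _ _ _ (cder_const A 0) (cder_cmult B _ 0 _ (cder_id 0))))). }
  assert (HD0 : D 0 = RtoC 0).
  { apply Cmod_eq_0. apply Rle_antisym; [|apply Cmod_ge_0]. apply le_epsilon. intros e Hpos.
    rewrite Rplus_0_l. destruct (eps_ccont D 0 HDc e Hpos) as [d [Hd K]].
    specialize (K (d / 2)). rewrite Rminus_0_r Rabs_pos_eq in K; [|lra].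
    specialize (K ltac:(lra)). rewrite HD in K; [|lra].
    replace (RtoC 0 - D 0)%C with (- D 0)%C in K by ring. rewrite Cmod_opp in K. lra. }
  exists A, B. intros x Hx.
  assert (E : D x = RtoC 0) by (destruct Hx as [Hx|<-]; [now apply HD|exact HD0]).
  assert (Eq : q x = (A + B * RtoC x)%C).
  { replace (q x) with (D x + (A + B * RtoC x))%C.
    - rewrite E. ring.
    - unfold D. ring. }
  rewrite -Eq. unfold q. rewrite (Rmax_right 0 x Hx). ring.
Qed.

Lemma vhat_derivative_exists f : schwartz f -> exists B : C, forall x, 0 <= x ->
  wder hline (fun t => vhat t f) x (/ c2 * (B + (vhat x (fun eta => alpha eta * f eta)
    - vhat_primitive (fun eta => beta eta * f eta) x)))%C.
Proof.
  intros Hf. destruct (affine_up_to_primitives f Hf) as [A [B E]]. exists B. intros x Hx.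
  assert (Ha := schwartz_alpha f Hf).
  assert (Hb := schwartz_beta f Hf).
  set (fa := fun eta => (alpha eta * f eta)%C) in *. set (fb := fun eta => (beta eta * f eta)%C) in *.
  assert (C0 := c2_neq0).
  assert (K : wder hline (fun t => / c2 * (A + B * RtoC t + (vhat_primitive fa t - primitive (vhat_primitive fb) 0 t)))%C x
    (/ c2 * (0 + B * 1 + (vhat (Rmax 0 x) fa - vhat_primitive fb x)))%C).
  { apply wder_cmult, wder_of_cder. apply cder_plus.
    - apply cder_plus; [apply cder_const|]. apply cder_cmult, cder_id.
    - apply cder_minus; [now apply cder_vhat_primitive|]. apply cder_primitive.
      intros t. exact (cder_ccont _ _ _ (cder_vhat_primitive fb t Hb)). }
  refine (wder_ext _ _ _ _ _ _ Hx _ _ K).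
  - intros t Ht. rewrite -(E t Ht). field. exact C0.
  - rewrite (Rmax_right 0 x Hx). ring.
Qed.

(** The x-derivative of [vhat]. The free constant is expressed by the trace [u1] of
    the derivative, so that this is a tempered distribution with polynomial growth
    in [x]. *)
Definition vhat_dx (u1 : dist) (x : R) : dist := fun f =>
  (u1 (F f) + / c2 * (vhat x (fun eta => alpha eta * f eta) + (- (1)) * vhat 0 (fun eta => alpha eta * f eta)
    + (- (1)) * vhat_primitive (fun eta => beta eta * f eta) x))%C.

(** The slope of the affine function is determined by comparing the derivatives at
    [x = 0]. *)
Lemma vhat_derivative u1 : is_dx_at_0 v u1 -> forall f x, schwartz f -> 0 <= x ->
  wder hline (fun t => vhat t f) x (vhat_dx u1 x f).
Proof.
  intros [_ Hu1] f x Hf Hx. destruct (vhat_derivative_exists f Hf) as [B E].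
  assert (E0 := wder_right_derivative _ _ (E 0 (Rle_refl 0))). cbv beta in E0.
  assert (E1 := Hu1 (F f) (schwartz_fourier f Hf)).
  assert (PF : ProperFilter' (at_right 0)) by (apply Proper_StrongProper, at_right_proper_filter).
  assert (U := filterlim_locally_unique (V := C_NormedModule) (F := at_right 0) _ _ _ E1 E0).
  refine (wder_ext _ _ _ _ _ _ Hx (fun _ _ => eq_refl) _ (E x Hx)).
  unfold vhat_dx. rewrite U. unfold vhat_primitive at 2. rewrite primitive_point.
  field. exact c2_neq0.
Qed.

Lemma vhat_primitive_linear x : 0 <= x -> dist_linear (fun f => vhat_primitive f x).
Proof.
  intros Hx a b f h Hf Hh. apply primitive_eq.
  apply (is_cint_ext (fun t => a * vhat (Rmax 0 t) f + b * vhat (Rmax 0 t) h)%C).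
  - intros t _. symmetry. apply vhat_linear; auto. apply Rmax_l.
  - apply is_cint_plus; apply is_cint_cmult; now apply vhat_primitive_is_cint.
Qed.

Lemma vhat_primitive_bounded : dbounded hsize (fun x f => vhat_primitive f (nonneg x)).
Proof.
  destruct vhat_bounded as [n Hn]. exists (S (S n)). intros x f Hf. assert (Hx := cond_nonneg x).
  assert (H0 := schwartz_norm_pos n f Hf).
  assert (Hp : 0 <= (2 + x) ^ n) by (apply pow_le; lra).
  eapply Rle_trans.
  { apply (is_cint_bound (fun t => vhat (Rmax 0 t) f) 0 x _ ((2 + x) ^ n * schwartz_norm n f) Hx); [|now apply vhat_primitive_is_cint].
    intros t Ht. assert (Ht0 : 0 <= Rmax 0 t) by apply Rmax_l.
    eapply Rle_trans; [exact (Hn (mknonnegreal _ Ht0) f Hf)|]. simpl.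
    apply Rmult_le_compat_r; [assumption|]. apply pow_incr.
    rewrite Rmax_right; lra. }
  apply Rle_trans with ((2 + x) * (2 + x) * ((2 + x) ^ n * schwartz_norm n f)).
  - rewrite Rminus_0_r -Rmult_assoc. apply Rmult_le_compat_r; [now apply Rmult_le_pos|]. nra.
  - simpl pow. rewrite !Rmult_assoc. do 2 (apply Rmult_le_compat_l; [lra|]).
    apply Rmult_le_compat_l; [assumption|]. apply schwartz_norm_mono; auto.
Qed.

Lemma vhat_dx_linear u1 x : tempered u1 -> 0 <= x -> dist_linear (vhat_dx u1 x).
Proof.
  intros Hu Hx. apply linear_plus; [apply fourier_dist_linear, Hu|].
  apply linear_cmult, linear_plus; [apply linear_plus|].
  - apply (linear_symbol alpha (vhat x)); [exact sym2_alpha|now apply vhat_linear].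
  - apply linear_cmult. apply (linear_symbol alpha (vhat 0)); [exact sym2_alpha|apply vhat_linear; lra].
  - apply linear_cmult. apply (linear_symbol beta (fun f => vhat_primitive f x)); [exact sym2_beta|now apply vhat_primitive_linear].
Qed.

Lemma vhat_dx_bounded u1 : tempered u1 -> dbounded hsize (fun x => vhat_dx u1 (nonneg x)).
Proof.
  intros Hu. assert (B := vhat_bounded).
  assert (C0 : forall U : dist, dbounded (fun _ : unit => 2) (fun _ => U) -> dbounded hsize (fun _ => U)).
  { intros U HU. apply (dbounded_reparam (fun _ : unit => 2) hsize (fun _ => tt) (fun _ => U)); auto.
    intros p. generalize (cond_nonneg p). lra. }
  apply (dbounded_plus hsize (fun _ f => u1 (F f))); [exact hsize_ge2| |].
  - apply C0. exact (dbounded_comp _ (fun _ => u1) _ two_le_two (tempered_bound u1 Hu) sbounded_fourier).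
  - apply (dbounded_cmult hsize (/ c2)%C); [exact hsize_ge2|].
    apply (dbounded_plus hsize); [exact hsize_ge2|apply (dbounded_plus hsize); [exact hsize_ge2| |]|].
    + apply (dbounded_symbol (fun x => vhat (nonneg x))); [exact sym2_alpha|exact B].
    + apply (dbounded_cmult hsize); [exact hsize_ge2|].
      apply (dbounded_symbol (fun _ => vhat 0)); [exact sym2_alpha|].
      apply C0. destruct B as [n Hn]. exists n. intros _ f Hf.
      specialize (Hn (mknonnegreal 0 (Rle_refl 0)) f Hf). simpl in Hn. rewrite Rplus_0_r in Hn. exact Hn.
    + apply (dbounded_cmult hsize); [exact hsize_ge2|].
      apply (dbounded_symbol (fun x f => vhat_primitive f (nonneg x))); [exact sym2_beta|exact vhat_primitive_bounded].
Qed.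

(** The combination that isolates the exponential with generator [Rp]. *)
Definition growing_part (u1 : dist) (x : R) : dist := fun f => (vhat_dx u1 x f + (- (1)) * vhat x (fun eta => Rm eta * f eta))%C.

Lemma growing_part_family u1 : tempered u1 -> family_on hline (growing_part u1).
Proof.
  intros Hu. apply family_on_hline.
  - intros x Hx. apply linear_plus; [now apply vhat_dx_linear|].
    apply linear_cmult. apply (linear_symbol Rm (vhat x)); [exact sym2_Rm|now apply vhat_linear].
  - apply (dbounded_plus hsize (fun x => vhat_dx u1 (nonneg x))); [exact hsize_ge2|now apply vhat_dx_bounded|].
    apply (dbounded_cmult hsize); [exact hsize_ge2|].
    apply (dbounded_symbol (fun x => vhat (nonneg x))); [exact sym2_Rm|exact vhat_bounded].
Qed.

(** Factorization of the equation of order two: with Vieta's formulas,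
    (d/dx - Rp) (d/dx - Rm) is the operator of the equation up to the factor [c2]. *)
Lemma growing_part_evolves u1 : is_dx_at_0 v u1 -> evolves hline (growing_part u1) Rp.
Proof.
  intros Hu x f Hx Hf.
  assert (Ha := schwartz_alpha f Hf).
  assert (Hb := schwartz_beta f Hf).
  assert (Hm := schwartz_Rm f Hf).
  assert (Hp := schwartz_Rp f Hf). assert (Hmp := schwartz_Rm _ Hp).
  assert (K : wder hline (fun t => growing_part u1 t f) x
    ((0 + / c2 * (vhat_dx u1 x (fun eta => alpha eta * f eta)%C + (- (1)) * 0
       + (- (1)) * vhat (Rmax 0 x) (fun eta => beta eta * f eta)%C))
     + (- (1)) * vhat_dx u1 x (fun eta => Rm eta * f eta)%C)%C).
  { apply wder_plus; [apply wder_plus; [apply wder_of_cder, cder_const|]|].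
    - apply wder_cmult, wder_plus; [apply wder_plus|].
      + now apply vhat_derivative.
      + apply wder_cmult, wder_of_cder, cder_const.
      + apply wder_cmult, wder_of_cder. now apply cder_vhat_primitive.
    - apply wder_cmult. now apply vhat_derivative. }
  refine (wder_ext _ _ _ _ _ _ Hx (fun _ _ => eq_refl) _ K).
  assert (HD := vhat_dx_linear u1 x (proj1 Hu) Hx). assert (HT := vhat_linear x Hx).
  assert (EA : vhat_dx u1 x (fun eta => alpha eta * f eta)%C
    = (c2 * vhat_dx u1 x (fun eta => Rm eta * f eta) + c2 * vhat_dx u1 x (fun eta => Rp eta * f eta))%C).
  { rewrite -(HD c2 c2 _ _ Hm Hp). f_equal. fext eta.
    rewrite alpha_eq. ring. }
  assert (EB : vhat x (fun eta => beta eta * f eta)%C = (c2 * vhat x (fun eta => Rm eta * (Rp eta * f eta)))%C).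
  { rewrite -(lin_cmult (vhat x) c2 _ HT Hmp). f_equal. fext eta.
    rewrite beta_eq. ring. }
  rewrite (Rmax_right 0 x Hx) EA EB. unfold growing_part. field. exact c2_neq0.
Qed.

Lemma growing_part_zero u1 : is_dx_at_0 v u1 -> forall x f, 0 <= x -> schwartz f -> growing_part u1 x f = RtoC 0.
Proof.
  intros Hu. destruct root_real_parts as [c [Hc Hb]].
  apply (growing_evolution_zero (growing_part u1) Rp c).
  - apply growing_part_family, Hu.
  - now apply growing_part_evolves.
  - exact sym2_Rp.
  - exact Hc.
  - intros eta. apply Hb.
Qed.

Lemma vhat_dx_eq u1 : is_dx_at_0 v u1 -> forall x f, 0 <= x -> schwartz f ->
  vhat_dx u1 x f = vhat x (fun eta => Rm eta * f eta)%C.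
Proof.
  intros Hu x f Hx Hf. assert (E := growing_part_zero u1 Hu x f Hx Hf). unfold growing_part in E.
  replace (vhat_dx u1 x f) with (vhat_dx u1 x f + - (1) * vhat x (fun eta => Rm eta * f eta)
    + vhat x (fun eta => Rm eta * f eta))%C by ring.
  rewrite E. ring.
Qed.

Lemma vhat_evolves u1 : is_dx_at_0 v u1 -> evolves hline vhat Rm.
Proof. intros Hu x f Hx Hf. rewrite -(vhat_dx_eq u1 Hu x f Hx Hf). now apply vhat_derivative. Qed.

(** The boundary condition is tested with [trace_symbol] times [f], to cancel the
    factor 1 + root of [boundary_operator_fourier]. *)
Lemma vhat_trace f : schwartz f -> vhat 0 f = trace_hat f.
Proof.
  intros Hf. destruct (proj2 (proj2 (proj2 (proj2 Hv)))) as [u1 [Hu Hbc]].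
  set (h := fun eta => (trace_symbol eta * f eta)%C).
  assert (Hh : schwartz h) by (apply schwartz_symbol; [exact sym2_trace|exact Hf]).
  assert (K := Hbc (F h) (schwartz_fourier h Hh)). unfold dist_dy in K.
  rewrite (cderive_fourier h Hh) in K.
  change (v 0 (F (mulx h))) with (vhat 0 (mulx h)) in K. change (v 0 (F h)) with (vhat 0 h) in K.
  assert (E2 : u1 (F h) = vhat 0 (fun eta => Rm eta * h eta)%C).
  { rewrite -(vhat_dx_eq u1 Hu 0 h (Rle_refl 0) Hh). unfold vhat_dx, vhat_primitive. rewrite primitive_point. ring. }
  assert (HT := vhat_linear 0 (Rle_refl 0)).
  rewrite E2 (boundary_operator_fourier (vhat 0) h HT Hh) in K.
  change (g (F h)) with (trace_hat f) in K.
  assert (E3 : (RtoC (2 * kx) * vhat 0 f = RtoC (2 * kx) * trace_hat f)%C).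
  { rewrite -K -(lin_cmult (vhat 0) _ f HT Hf). f_equal. fext eta.
    unfold h, trace_symbol. rewrite RtoC_mult. field. apply one_plus_root_neq0. }
  assert (N : RtoC (2 * kx) <> RtoC 0) by (apply RtoC_neq0; lra).
  replace (vhat 0 f) with (/ RtoC (2 * kx) * (RtoC (2 * kx) * vhat 0 f))%C by (field; exact N).
  rewrite E3. field. exact N.
Qed.

(** [transport] from 0 to [x] with the test function exp((x - y) Rm) f,
    where x - y stays nonnegative and the real part of Rm negative: the backward
    equation is well posed on test functions. *)
Lemma solution_unique x : 0 <= x -> dist_eq (v x) (sol x).
Proof.
  intros Hx f Hf. destruct (proj2 (proj2 (proj2 (proj2 Hv)))) as [u1 [Hu _]].
  assert (Ef := fourier_inv_r f Hf). assert (Hphi := schwartz_fourier_inv f Hf).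
  unfold sol, sol_hat.
  assert (E := transport hline vhat Rm Rm x (-1) 0 x (fourier_inv f)
    (family_on_hline vhat vhat_linear vhat_bounded) (vhat_evolves u1 Hu) sym2_Rm sym2_Rm Rm_Re_nonpos ltac:(ring)).
  rewrite -vhat_trace.
  2: { apply schwartz_exp; auto; [exact sym2_Rm|exact Rm_Re_nonpos]. }
  replace (x + -1 * x) with 0 in E by ring. replace (x + -1 * 0) with x in E by ring.
  rewrite -E; auto.
  - transitivity (v x (F (fourier_inv f))); [now rewrite Ef|].
    change (vhat x (fourier_inv f) = vhat x (fun eta => cexp (RtoC 0 * Rm eta) * fourier_inv f eta)%C).
    f_equal. fext eta. rewrite Cmult_0_l cexp_0. ring.
  - intros eta. replace (RtoC (-1)) with (- (1))%C by (apply C_ext; simpl; ring). ring.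
  - intros; lra.
Qed.

End Problem.

Theorem proposition2 :
  forall (eps nu kx ky : R) (g : dist),
    0 < eps -> 0 < nu ->
    kx ^ 2 + ky ^ 2 = 1 -> 0 < kx -> ky <> 0 ->
    tempered g ->
    exists u : R -> dist,
      is_solution eps nu kx ky g u /\
      (forall v : R -> dist, is_solution eps nu kx ky g v ->
         forall x, 0 <= x -> dist_eq (v x) (u x)) /\
      (forall x, 0 <= x ->
         slowly_increasing (solution_symbol eps nu kx ky x) /\
         dist_eq (fourier (u x))
                 (dist_mul (solution_symbol eps nu kx ky x) (fourier g))) /\
      (slowly_increasing (Rminus eps nu kx ky) /\
       let Uhat := vdist_of (fun x => fourier (u x)) in
       vdist_null
         (vadd (vdx Uhat)
               (vscal (RtoC (-1)) (vmul (Rminus eps nu kx ky) Uhat)))).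
Proof.
  intros eps nu kx ky g He Hnu Hk Hx Hy Hg.
  exists (sol eps nu kx ky g). split; [|split; [|split; [|split]]].
  - now apply sol_is_solution.
  - intros v Hv x Hx0. now apply solution_unique.
  - intros x Hx0. split; [now apply solution_symbol_slow|apply sol_fourier].
  - apply (symbol_slowly_increasing (fun _ : unit => 2) (fun _ => Rminus eps nu kx ky) tt two_le_two).
    now apply sym2_Rm.
  - now apply sol_fourier_equation.
Qed.
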